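(* For $3\leq n\leq 9$, the numbers of pairwise non-isomorphic connected graphs on $n$ vertices with representation number $1$, $2$, $3$, $4$, and greater than $4$ (including $\infty$) are, respectively: \begin{itemize} \item $n=3$: $1, 1, 0, 0, 0$; \item $n=4$: $1, 5, 0, 0, 0$; \item $n=5$: $1, 20, 0, 0, 0$; \item $n=6$: $1, 109, 1, 0, 1$; \item $n=7$: $1, 788, 39, 0, 25$; \item $n=8$: $1, 8335, 1852, 0, 929$; \item $n=9$: $1, 117282, 88838, 2, 54957$. \end{itemize} Moreover, every connected graph on at most 9 vertices with representation number greater than $4$ is not word-representable; that is, no connected word-representable graph on at most 9 vertices has representation number greater than $4$.
   Context: All graphs are finite, simple and undirected. Two distinct letters $x,y$ alternate in a word $w$ if deleting from $w$ all letters other than $x$ and $y$ yields a word of the form $xyxy\cdots$ or $yxyx\cdots$ (of even or odd length). A word $w$ over the alphabet $V$, containing each letter of $V$ at least once, represents the graph $G=(V,E)$ if for all distinct $x,y\in V$, the letters $x$ and $y$ alternate in $w$ if and only if $xy\in E$. A graph is word-representable if some word represents it. A word is $k$-uniform if each letter of $V$ occurs in it exactly $k$ times. A graph is $k$-representable if it is represented by some $k$-uniform word. The representation number of $G$ is the least $k\geq 1$ such that $G$ is $k$-representable, and it is $\infty$ if $G$ is not word-representable (a graph is word-representable if and only if it is $k$-representable for some $k$). *)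

(* Defs.v *)
(* Library: MathComp, with [boolp] for the boolean reflection of Prop. *)
From HB Require Import structures.
From mathcomp Require Import all_boot all_fingroup.
From mathcomp Require Import boolp.

Set Implicit Arguments.
Unset Strict Implicit.
Unset Printing Implicit Defensive.

Section Graphs.
Variable T : finType.

(* The edge set is a set of two-element subsets of T, so graphs are simple and
   undirected, and Leibniz equality is equality of labelled graphs. *)
Record sgraph := SGraph {
  edges : {set {set T}};
  _ : [forall e in edges, #|e| == 2]
}.

HB.instance Definition _ := [isSub for edges].
HB.instance Definition _ := [Finite of sgraph by <:].

Implicit Types (G H : sgraph) (w : seq T) (x y : T) (k : nat).

(* [adj G x x] is false because [set x; x] is a singleton. *)
Definition adj G : rel T := fun x y => [set x; y] \in edges G.

Definition connected G : Prop := forall x y, connect (adj G) x y.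

Definition isomorphic : rel sgraph := fun G H =>
  [exists s : {perm T}, forall x, forall y, adj G x y == adj H (s x) (s y)].

(* The word x y x y ... of length n. *)
Definition altword x y (n : nat) : seq T :=
  mkseq (fun i => if odd i then y else x) n.

Definition alternate x y w : bool :=
  let u := [seq z <- w | pred2 x y z] in
  (u == altword x y (size u)) || (u == altword y x (size u)).

Definition represents w G : Prop :=
  (forall x, x \in w) /\
  (forall x y, x != y -> alternate x y w <-> adj G x y).

Definition word_representable G : Prop := exists w, represents w G.

Definition uniform k w : Prop := forall x, count_mem x w = k.

Definition k_representable k G : Prop :=
  exists2 w, uniform k w & represents w G.

(* [None] stands for infinity. *)
Definition is_repr_number G (r : option nat) : Prop :=
  match r with
  | Some k => [/\ 1 <= k, k_representable k G
                & forall j, 1 <= j -> k_representable j G -> k <= j]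
  | None => ~ word_representable G
  end.

Definition repr_number_gt k G : Prop :=
  exists2 r, is_repr_number G r & if r is Some j then k < j else True.

End Graphs.

(* Number of isomorphism classes of graphs on n vertices satisfying P,
   for an isomorphism-invariant P. *)
Definition num_graphs n (P : sgraph 'I_n -> Prop) : nat :=
  #|equivalence_partition (@isomorphic 'I_n) [set G | `[< P G >]]|.

Definition num_connected_repr n k : nat :=
  num_graphs (fun G : sgraph 'I_n => connected G /\ is_repr_number G (Some k)).

Definition num_connected_repr_gt n k : nat :=
  num_graphs (fun G : sgraph 'I_n => connected G /\ repr_number_gt k G).

Definition repr_counts n : seq nat :=
  [:: num_connected_repr n 1; num_connected_repr n 2; num_connected_repr n 3;
      num_connected_repr n 4; num_connected_repr_gt n 4].

(* Main.v *)
(** Adding to a graph H a vertex for which the pair (degree, sum of the degrees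
    of its neighbours) is lexicographically minimal yields every graph with one
    more vertex.  For each H with at most 8 vertices of a list of representatives,
    a certificate tree branches over the possible neighbourhoods of the new
    vertex; its leaves justify that the extension may be skipped (the new vertex
    is not minimal, or an automorphism of H or an explicit isomorphism leads to a
    kept extension) or determine the representation number of a kept extension.
    So the kept graphs represent all isomorphism classes.  They are pairwise
    non-isomorphic because there are only as many of them as classes, and the
    number of classes is bounded below by Burnside's lemma.

    Words are obtained by inserting the new letter into a word for H.  Failure of
    2-representability (such graphs are not circle graphs) and of word-representability is
    inherited by induced supergraphs, so it suffices to treat a list of small
    obstructions.  Uniform words are excluded by exhaustive insertion of letters.  For
    word-representability, of two adjacent letters of a uniform word one is always
    ahead in the prefix counts; this orients the graph without directed cycles,
    and without a directed path, closed by an arc from its first to its last vertex,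
    on which two vertices are non-adjacent.  A refutation branches over orientations
    until one of these configurations occurs. *)

(* Disconnected graphs have to be classified along with the connected ones: deleting a vertex of
   least degree may disconnect a graph, and Burnside's lemma counts all graphs. Connectivity matters
   only when the kept graphs are tallied.

   Up to isomorphism there are 274668 graphs on 9 vertices, so pairwise comparison is out of reach.
   A skipped extension only has to exhibit one isomorphism or one vertex earlier in the order, and
   an inequality in Burnside's lemma is enough, because the number of kept graphs meets it.

   The five statuses are the representation numbers 1 to 4 and non-word-representability. As
   k-representability is monotone in k, a status k > 1 needs one k-uniform word and the exclusion of
   k-1 alone. That no status for a finite number above 4 is needed is exactly the last assertion of
   the theorem.

   The certificates are computed by a program in this same development. Nothing is proved about it;
   only its output is checked. *)
From mathcomp Require Import all_boot all_fingroup boolp zify.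
From Stdlib Require Import BinNums.
From Corelib Require Import PosDef.
Require Import Defs.

Set Implicit Arguments.
Unset Strict Implicit.
Unset Printing Implicit Defensive.

(** * Coded graphs and certificates *)

(* Certificates store small numbers as constructors and not as unary numbers,
   which keeps the data terms small. *)
Inductive digit :=
  D0 | D1 | D2 | D3 | D4 | D5 | D6 | D7 | D8 | D9 | D10 | D11 | D12 | D13 | D14
| D15 | D16 | D17 | D18 | D19 | D20 | D21 | D22 | D23 | D24 | D25 | D26 | D27
| D28 | D29 | D30 | D31.

Definition digit_val (d : digit) : nat := match d with
  D0 => 0 | D1 => 1 | D2 => 2 | D3 => 3 | D4 => 4 | D5 => 5 | D6 => 6 | D7 => 7
| D8 => 8 | D9 => 9 | D10 => 10 | D11 => 11 | D12 => 12 | D13 => 13 | D14 => 14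
| D15 => 15 | D16 => 16 | D17 => 17 | D18 => 18 | D19 => 19 | D20 => 20
| D21 => 21 | D22 => 22 | D23 => 23 | D24 => 24 | D25 => 25 | D26 => 26
| D27 => 27 | D28 => 28 | D29 => 29 | D30 => 30 | D31 => 31 end.

Inductive digits := DN | DC (d : digit) (l : digits).
Fixpoint digits_val (l : digits) : seq nat := match l with DN => [::] | DC d l' => digit_val d :: digits_val l' end.

(* The newest vertex comes first; the row of a vertex lists its adjacency to the
   older ones, so that vertex p of H is vertex p.+1 of N :: H. *)
Definition code := seq (seq bool).

(** The diagonal has its own value, so a map that preserves entries is automatically injective. As
    the default of [nth], [Self] also makes [rowchk] reject indices out of range. *)
Inductive cell := Non | Adj | Self.
Definition cell_of (b : bool) := if b then Adj else Non.

Fixpoint zip_cells (cs : seq cell) (m : seq (seq cell)) : seq (seq cell) :=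
  match cs, m with c :: cs', r :: m' => (c :: r) :: zip_cells cs' m' | _, _ => [::] end.
Definition ext_mat (cs : seq cell) (m : seq (seq cell)) : seq (seq cell) :=
  (Self :: cs) :: zip_cells cs m.
Fixpoint mat (g : code) : seq (seq cell) :=
  match g with [::] => [::] | N :: H => ext_mat (map cell_of N) (mat H) end.

(** Conjunctions in the checkers are mostly written as conditionals, which stop at the first failure
    under call-by-value evaluation. *)
Fixpoint rowchk (r : seq bool) (f : seq nat) (row : seq cell) : bool :=
  match r, f with
  | b :: r', y :: f' =>
      match nth Self row y with
      | Adj => if b then rowchk r' f' row else false
      | Non => if b then false else rowchk r' f' row
      | Self => false
      end
  | [::], [::] => true
  | _, _ => false
  end.
Fixpoint embchk (p : code) (f : seq nat) (m : seq (seq cell)) : bool :=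
  match p, f with
  | r :: p', x :: f' =>
      match nth [::] m x with
      | [::] => false
      | row => if rowchk r f' row then embchk p' f' m else false
      end
  | [::], [::] => true
  | _, _ => false
  end.

(* bit strings in base 32, least significant bit first *)
Definition dbits (d : digit) (s : seq bool) : seq bool := match d with
  | D0 => [:: false, false, false, false, false & s]
  | D1 => [:: true, false, false, false, false & s]
  | D2 => [:: false, true, false, false, false & s]
  | D3 => [:: true, true, false, false, false & s]
  | D4 => [:: false, false, true, false, false & s]
  | D5 => [:: true, false, true, false, false & s]
  | D6 => [:: false, true, true, false, false & s]
  | D7 => [:: true, true, true, false, false & s]
  | D8 => [:: false, false, false, true, false & s]
  | D9 => [:: true, false, false, true, false & s]
  | D10 => [:: false, true, false, true, false & s]
  | D11 => [:: true, true, false, true, false & s]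
  | D12 => [:: false, false, true, true, false & s]
  | D13 => [:: true, false, true, true, false & s]
  | D14 => [:: false, true, true, true, false & s]
  | D15 => [:: true, true, true, true, false & s]
  | D16 => [:: false, false, false, false, true & s]
  | D17 => [:: true, false, false, false, true & s]
  | D18 => [:: false, true, false, false, true & s]
  | D19 => [:: true, true, false, false, true & s]
  | D20 => [:: false, false, true, false, true & s]
  | D21 => [:: true, false, true, false, true & s]
  | D22 => [:: false, true, true, false, true & s]
  | D23 => [:: true, true, true, false, true & s]
  | D24 => [:: false, false, false, true, true & s]
  | D25 => [:: true, false, false, true, true & s]
  | D26 => [:: false, true, false, true, true & s]
  | D27 => [:: true, true, false, true, true & s]
  | D28 => [:: false, false, true, true, true & s]
  | D29 => [:: true, false, true, true, true & s]
  | D30 => [:: false, true, true, true, true & s]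
  | D31 => [:: true, true, true, true, true & s]
  end.
Fixpoint bits (l : digits) : seq bool := match l with DN => [::] | DC d l' => dbits d (bits l') end.
Fixpoint decode (n : nat) (s : seq bool) : code := match n with
  | 0 => [::] | n'.+1 => take n' s :: decode n' (drop n' s) end.

(* letter counts of all prefixes of w, starting from the counts v *)
Fixpoint vecs (v : seq nat) (w : seq nat) : seq (seq nat) :=
  v :: match w with [::] => [::] | x :: w' => vecs (incr_nth v x) w' end.

(* In a k-uniform word x and u alternate iff the numbers of u's before the k
   occurrences of x are 0, ..., k-1 or 1, ..., k. *)
Definition t2 (a b : nat) : bool :=
  match a with
  | 0 => match b with 1 => true | _ => false end
  | 1 => match b with 2 => true | _ => false end
  | _ => false end.
Definition t3 (a b c : nat) : bool :=
  match a with
  | 0 => match b with 1 => match c with 2 => true | _ => false end | _ => false end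
  | 1 => match b with 2 => match c with 3 => true | _ => false end | _ => false end
  | _ => false end.
(** A row is compared with all letters including its own; [Self] accepts whatever results there. *)
Definition ceq (c : cell) (b : bool) : bool :=
  match c with Self => true | Adj => b | Non => if b then false else true end.

Fixpoint alt2 (a b : seq nat) (cs : seq cell) : bool :=
  match cs with
  | [::] => true
  | c :: cs' => match a, b with
    | x :: a', y :: b' => if ceq c (t2 x y) then alt2 a' b' cs' else false
    | _, _ => false end
  end.
Fixpoint alt3 (a b d : seq nat) (cs : seq cell) : bool :=
  match cs with
  | [::] => true
  | c :: cs' => match a, b, d with
    | x :: a', y :: b', z :: d' => if ceq c (t3 x y z) then alt3 a' b' d' cs' else false
    | _, _, _ => false end
  end.
Fixpoint eqsn (s t : seq nat) : bool := match s, t with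
  | [::], [::] => true | x :: s', y :: t' => if eqn x y then eqsn s' t' else false
  | _, _ => false end.
Fixpoint altk (k : nat) (vs : seq (seq nat)) (u : nat) (cs : seq cell) : bool :=
  match cs with
  | [::] => true
  | c :: cs' =>
    let s := [seq nth 0 v u | v <- vs] in
    if ceq c (eqsn s (iota 0 k) || eqsn s (iota 1 k)) then altk k vs u.+1 cs' else false
  end.

Fixpoint upd {A} (x : nat) (v : A) (acc : seq (seq A)) : seq (seq A) :=
  match acc, x with
  | r :: acc', 0 => (v :: r) :: acc'
  | r :: acc', x'.+1 => r :: upd x' v acc'
  | [::], _ => [::] end.
(** Row [x] collects the prefix counts just before the successive occurrences of the letter [x]. *)
Fixpoint occs (w : seq nat) (vs : seq (seq nat)) (acc : seq (seq (seq nat))) :=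
  match w, vs with
  | x :: w', v :: vs' => upd x v (occs w' vs' acc)
  | _, _ => acc end.
Definition row2 (os : seq (seq nat)) (cs : seq cell) : bool :=
  match os with [:: a; b] => alt2 a b cs | _ => false end.
Definition row3 (os : seq (seq nat)) (cs : seq cell) : bool :=
  match os with [:: a; b; c] => alt3 a b c cs | _ => false end.
Definition rowk (k : nat) (os : seq (seq nat)) (cs : seq cell) : bool :=
  if eqn (size os) k then altk k os 0 cs else false.
Fixpoint rows (row : seq (seq nat) -> seq cell -> bool) os m : bool :=
  match m with
  | [::] => true
  | cs :: m' => match os with o :: os' => if row o cs then rows row os' m' else false
                | _ => false end
  end.
Definition zv {A} (m : seq A) : seq nat := map (fun=> 0) m.
Definition wchk (row : seq (seq nat) -> seq cell -> bool) m (w : seq nat) : bool :=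
  rows row (occs w (vecs (zv m) w) (map (fun=> [::]) m)) m.

(* the prefix counts at the insertion points; each entry of ds is relative to the previous point *)
Fixpoint cutv (V : seq (seq nat)) (ds : seq nat) : seq (seq nat) := match ds with
  | [::] => [::]
  | d :: ds' => let V' := drop d V in match V' with
     | [::] => [::] | v :: _ => v :: cutv V' ds' end end.

(* An obstruction is inherited from the parent, or obstruction (a, b) of the list
   embeds by f. *)
Inductive ncert := Inh | Emb (a b : digit) (f : digits).
(* The representation number: 1, 2, 3, 4 or infinite.  In S2 and S3, w is the index of a
   word of the parent and the other digits are the cuts for the new letter; the
   obstruction shows that the number is not smaller. *)
Inductive stat :=
  | S1
  | S2 (w i j : digit)
  | S3 (c : ncert) (w i j k : digit)
  | S4 (a b : digit) (f : digits) (w : digits)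
  | SN (c : ncert).
(* Branching is on the oldest vertex first.  Prune, Wit: an older vertex precedes
   the new one in the minimality order; Aut: an automorphism of the parent, given
   by its index; Iso: the extension by N of the parent numbered (a, b, c) is kept
   and isomorphic by f. *)
Inductive tree :=
  | Node (a b : tree)
  | Prune (j : digit)
  | Wit (u : digit)
  | Aut (a b : digit)
  | Iso (a b c : digit) (N : digits) (f : digits)
  | Kept (s : stat).
Inductive ocert := NoC | OEmb (a b : digit) (f : digits).
(* hnw, hnc: embedded obstruction to word- and to 2-representability, if any;
   hw2, hw3: words for the cuts of S2 and S3 *)
Record hrec := HRec {
  hcode : digits;
  hauts : seq (seq digits);
  hnw : ocert;
  hnc : ocert;
  hw2 : seq digits;
  hw3 : seq digits;
  htree : tree }.
Definition norec := HRec DN [::] NoC NoC [::] [::] (Prune D0).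

Definition nth2 {A} (x : A) (s : seq (seq A)) (a b : digit) := nth x (nth [::] s (digit_val a)) (digit_val b).

(** A leaf met before all bits are read settles every completion of the bits read so far, as for
    [Prune]. *)
Fixpoint look (t : tree) (bs : seq bool) : tree :=
  match bs with
  | [::] => t
  | b :: bs' => match t with Node t0 t1 => look (if b then t1 else t0) bs' | _ => t end
  end.

Definition isadj c := match c with Adj => true | _ => false end.
Definition deg (r : seq cell) : nat := count isadj r.
Fixpoint sumr (r : seq cell) (ds : seq nat) : nat := match r, ds with
  | c :: r', d :: ds' => match c with Adj => d + sumr r' ds' | _ => sumr r' ds' end
  | _, _ => 0 end.
Fixpoint inter (r : seq cell) (N : seq bool) : nat := match r, N with
  | c :: r', b :: N' => match c with Adj => if b then (inter r' N').+1 else inter r' N' | _ => inter r' N' end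
  | _, _ => 0 end.

Section Check.
Variables (obsw obsc obs3 : seq (seq code)).
Variable n : nat.
Variable rec : digit -> digit -> digit -> hrec.
Definition getcode (r : hrec) : code := decode n (bits (hcode r)).

(** The empty code is the default of [nth2] and embeds in every graph, hence it must be rejected. *)
Definition emb_obs (obs : seq (seq code)) (a b : digit) (f : digits) m : bool :=
  match nth2 [::] obs a b with [::] => false | p => embchk p (digits_val f) m end.
Definition chk_ocert obs (c : ocert) m : bool := match c with NoC => true | OEmb a b f => emb_obs obs a b f m end.

Section Rec.
Variables (m : seq (seq cell)) (degs sums : seq nat).
Variables (auts : seq (seq digits)) (inw inc full : bool) (v2 v3 : seq (seq (seq nat))).
Variable T : tree.

Definition chk_ncert obs (inh : bool) (c : ncert) mg : bool :=
  match c with Inh => inh | Emb a b f => emb_obs obs a b f mg end.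

Definition chk_stat (s : stat) (N : seq bool) : bool :=
  let cs := map cell_of N in
  match s with
  | S1 => if all id N then full else false
  | S2 w i j => if row2 (cutv (nth [::] v2 (digit_val w)) [:: digit_val i; digit_val j]) cs
                then ~~ (if full then all id N else false) else false
  | S3 c w i j k => if row3 (cutv (nth [::] v3 (digit_val w)) [:: digit_val i; digit_val j; digit_val k]) cs
                    then chk_ncert obsc inc c (ext_mat cs m) else false
  | S4 a b f w => if wchk (rowk 4) (ext_mat cs m) (digits_val w) then emb_obs obs3 a b f (ext_mat cs m) else false
  | SN c => chk_ncert obsw inw c (ext_mat cs m)
  end.

Definition keptat (t : tree) (N : seq bool) : bool :=
  match look t (rev N) with Kept _ => true | _ => false end.

(* N: decided bits, youngest first; c = number of ones, S = sum of (deg+1) over ones *)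
Fixpoint chk (t : tree) (ds : seq nat) (N : seq bool) (dn : seq nat) (c S : nat) : bool :=
  match t with
  | Node a b => match ds with
    | d :: ds' => if chk a ds' (false :: N) (d :: dn) c S
                  then chk b ds' (true :: N) (d :: dn) c.+1 (d.+1 + S) else false
    | [::] => false end
  | Prune j => nth c dn (digit_val j) + nth false N (digit_val j) < c
  | Wit u => match ds with _ :: _ => false | [::] =>
       let u := digit_val u in
       let b := nth false N u in
       if nth c.+1 degs u + b <= c then
         nth 0 sums u + inter (nth [::] m u) N + (if b then c else 0) < S
       else false end
  | Aut a b => match ds with _ :: _ => false | [::] =>
       match nth2 DN auts a b with DN => false | s =>
       match look T (rev (map (nth false N) (digits_val s))) with
       | Iso _ _ _ _ _ | Kept _ => true | _ => false end end end
  | Iso a b d N' f => match ds with _ :: _ => false | [::] =>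
       let r := rec a b d in
       let N' := take n (bits N') in
       if keptat (htree r) N' then embchk (N' :: getcode r) (digits_val f) (ext_mat (map cell_of N) m) else false end
  | Kept s => match ds with _ :: _ => false | [::] => chk_stat s N end
  end.
End Rec.

Definition isC (c : ocert) := match c with NoC => false | _ => true end.
Definition chkrec (r : hrec) : bool :=
  let H := getcode r in
  let m := mat H in
  let ds := map deg m in
  let sums := map (fun row => sumr row ds) m in
  if all (all (fun s => embchk H (digits_val s) m)) (hauts r) then
  if chk_ocert obsw (hnw r) m then
  if chk_ocert obsc (hnc r) m then
  let w2 := map digits_val (hw2 r) in let w3 := map digits_val (hw3 r) in
  if all (wchk row2 m) w2 then
  if all (wchk row3 m) w3 then
    chk m ds sums (hauts r) (isC (hnw r)) (isC (hnc r)) (all (all id) H)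
      (map (vecs (zv m)) w2) (map (vecs (zv m)) w3) (htree r)
      (htree r) (rev ds) [::] [::] 0 0
  else false else false else false else false else false.

Fixpoint keptl (H : code) (t : tree) (N : seq bool) (acc : seq (code * stat)) :=
  match t with
  | Node a b => keptl H a (false :: N) (keptl H b (true :: N) acc)
  | Kept s => (N :: H, s) :: acc
  | _ => acc end.
Definition kept (rs : seq (seq (seq hrec))) : seq (code * stat) :=
  foldr (fun r acc => keptl (getcode r) (htree r) [::] acc) [::] (flatten (flatten rs)).
End Check.

Fixpoint meets (N c : seq bool) : bool := match N, c with
  | x :: N', y :: c' => if x then (if y then true else meets N' c') else meets N' c' | _, _ => false end.
Fixpoint join (c d : seq bool) : seq bool := match c, d with
  | x :: c', y :: d' => (x || y) :: join c' d' | _, _ => [::] end.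
Fixpoint comps (g : code) : seq (seq bool) := match g with
  | [::] => [::]
  | N :: H => let cs := comps H in
      (true :: foldr join (map (fun=> false) N) [seq c <- cs | meets N c])
      :: [seq false :: c | c <- cs & ~~ meets N c] end.
(** The newest vertex must meet every component of the older graph. So the components of a parent,
    computed once, decide connectivity for all its extensions. *)
Definition conn (g : code) : bool := match g with [::] => true | N :: H => all (meets N) (comps H) end.

(* Br: both orientations of the edge ij; Cyc: a directed cycle; Sht: a directed path
   p, x, q, y, r with an arc from its first to its last vertex and x, y not adjacent *)
Inductive rtree :=
  | Br (i j : digit) (a b : rtree)
  | Cyc (p : digits)
  | Sht (p : digits) (x : digit) (q : digits) (y : digit) (r : digits).
Definition ent (m : seq (seq cell)) i j := nth Self (nth [::] m i) j.
Section Refute.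
Variable m : seq (seq cell).
Fixpoint seti {A} (s : seq A) (i : nat) (f : A -> A) : seq A := match s, i with
  | [::], _ => [::] | x :: s', 0 => f x :: s' | x :: s', i'.+1 => x :: seti s' i' f end.
Definition arc (A : seq (seq bool)) i j := nth false (nth [::] A i) j.
Definition setarc (A : seq (seq bool)) i j := seti A i (fun r => seti r j (fun=> true)).
Fixpoint dpath (A : seq (seq bool)) x (p : seq nat) : bool := match p with
  | [::] => true | y :: p' => if arc A x y then dpath A y p' else false end.
Fixpoint refchk (t : rtree) (A : seq (seq bool)) : bool := match t with
  | Br i j a b => let i := digit_val i in let j := digit_val j in
     match ent m i j with
     | Adj => if refchk a (setarc A i j) then refchk b (setarc A j i) else false
     | _ => false end
  | Cyc p => match digits_val p with
     | x :: p' => if dpath A x p' then arc A (last x p') x else false | [::] => false end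
  | Sht p x q y r => let x := digit_val x in let y := digit_val y in
     match digits_val p ++ x :: digits_val q ++ y :: digits_val r with
     | s :: p' => if dpath A s p' then if arc A s (last s p') then
          match ent m x y with Non => true | _ => false end else false else false
     | [::] => false end
  end.
(* Rotating the word, the oldest vertex is its first letter, hence a source. *)
Definition start : seq (seq bool) :=
  rcons (map (map (fun=> false)) (behead m)) (map isadj (last [::] m)).
End Refute.
Definition refutes (g : code) (t : rtree) : bool := let m := mat g in refchk m t (start m).

(* cmpr: can the prefix count v follow p at consecutive occurrences of the new
   letter?  Counts only grow along the word, so Over ends the search. *)
Fixpoint nbr1 (N : seq bool) (v : seq nat) : bool := match N, v with
  | b :: N', x :: v' => if b then (match x with _.+2 => false | _ => nbr1 N' v' end) else nbr1 N' v'
  | _, _ => true end.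
Inductive cmpr := Fit | Under | Over.
Fixpoint nbr2 (N : seq bool) (p v : seq nat) : cmpr := match N, p, v with
  | b :: N', y :: p', x :: v' => if b then
       (if x <= y then Under else if eqn x y.+1 then nbr2 N' p' v' else Over)
       else nbr2 N' p' v'
  | _, _, _ => Fit end.
Fixpoint incs (p v : seq nat) (acc : seq bool) : seq bool := match p, v, acc with
  | x :: p', y :: v', b :: acc' => (if b then eqn y x.+1 else false) :: incs p' v' acc'
  | _, _, _ => [::] end.
Fixpoint eqbs (s t : seq bool) : bool := match s, t with
  | [::], [::] => true | x :: s', y :: t' => if eqb x y then eqbs s' t' else false | _, _ => false end.
Section Search.
Variable N : seq bool.
(** Words are represented by their prefix counts throughout. [al] records the old letters that have
    alternated with the new one so far; a non-neighbour may stop doing so at any insertion, and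
    therefore equality with [N] is tested only at the end. *)
Fixpoint insn (r c : nat) (p : seq nat) (al : seq bool) (V : seq (seq nat)) : seq (seq (seq nat)) :=
  match r with
  | 0 => if eqbs al N then [:: map (cons c) V] else [::]
  | r'.+1 => (fix go (V : seq (seq nat)) : seq (seq (seq nat)) := match V with
     | [::] => [::]
     | v :: V' => match nbr2 N p v with
        | Over => [::]
        | Under => map (cons (c :: v)) (go V')
        | Fit => map (cons (c :: v)) (insn r' c.+1 v (incs p v al) V ++ go V') end end) V
  end.
Fixpoint ins1st (k : nat) (V : seq (seq nat)) : seq (seq (seq nat)) := match V with
  | [::] => [::]
  | v :: V' => if nbr1 N v then
      map (cons (0 :: v)) (insn k 1 v (map (fun x => x <= 1) v) V ++ ins1st k V') else [::] end.
End Search.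
(** By rotation the oldest letter may be assumed to come first, so nothing is inserted before the
    head of [V]. Reaching the empty list of rows means that a representing word was found. *)
Fixpoint srch (k : nat) (rows : seq (seq bool)) (V : seq (seq nat)) : bool := match rows with
  | [::] => false
  | N :: rows' => match V with [::] => true | v0 :: V' =>
      all (fun W => srch k rows' ((0 :: v0) :: W)) (ins1st N k.-1 V') end end.
Definition norep (k : nat) (g : code) : bool := match rev g with
  | [::] => false
  | _ :: rows => srch k rows (map (fun x => [:: x]) (iota 0 k.+1)) end.

Definition bsucc (b : N) : N := match b with N0 => Npos xH | Npos p => Npos (Pos.succ p) end.
(** The slot [c0] counts the disconnected graphs; they are needed for the total that is compared
    with Burnside's sum. *)
Inductive tally := Tal (c0 c1 c2 c3 c4 c5 : N).
Definition tally_add (t : tally) (k : nat) : tally := let: Tal c0 c1 c2 c3 c4 c5 := t in match k with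
  | 0 => Tal (bsucc c0) c1 c2 c3 c4 c5 | 1 => Tal c0 (bsucc c1) c2 c3 c4 c5
  | 2 => Tal c0 c1 (bsucc c2) c3 c4 c5 | 3 => Tal c0 c1 c2 (bsucc c3) c4 c5
  | 4 => Tal c0 c1 c2 c3 (bsucc c4) c5 | _ => Tal c0 c1 c2 c3 c4 (bsucc c5) end.
Definition stat_num (st : stat) : nat := match st with
  S1 => 1 | S2 _ _ _ => 2 | S3 _ _ _ _ _ => 3 | S4 _ _ _ _ => 4 | SN _ => 5 end.
Fixpoint tally_tree (cs : seq (seq bool)) (t : tree) (N : seq bool) (acc : tally) : tally := match t with
  | Node a b => tally_tree cs a (false :: N) (tally_tree cs b (true :: N) acc)
  | Kept s => tally_add acc (if all (meets N) cs then stat_num s else 0)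
  | _ => acc end.
Definition tally_recs (n : nat) (rs : seq hrec) : tally :=
  foldr (fun r acc => tally_tree (comps (getcode n r)) (htree r) [::] acc) (Tal N0 N0 N0 N0 N0 N0) rs.

(** * Alternation in words *)

Section Alternation.
Variable T : eqType.
Implicit Types (w : seq T) (x y z : T).

(* [w] restricted to {x, y} alternates, its first letter, if any, being x *)
Fixpoint altf x y w : bool := match w with
  | [::] => true
  | z :: w' => if z == x then altf y x w' else (z != y) && altf x y w' end.
Definition alt x y w : bool := altf x y w || altf y x w.

Lemma altC x y w : alt x y w = alt y x w.
Proof. by rewrite /alt orbC. Qed.

Lemma altf_filter (p : pred T) x y w : p x -> p y -> altf x y (filter p w) = altf x y w.
Proof.
elim: w x y => //= z w IH x y px py.
case: eqP => [->|nx]; first by rewrite px /= eqxx IH.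
have [pz|npz] := boolP (p z); first by rewrite /= (introF eqP nx) IH.
rewrite IH //; case: eqP => // zy; by rewrite zy py in npz.
Qed.

Lemma altf_bounds x y w : x != y -> altf x y w ->
  count_mem y w <= count_mem x w <= (count_mem y w).+1.
Proof.
elim: w x y => //= z w IH x y xy.
case: eqP => [->|nx] /=.
  rewrite (negbTE xy) add0n add1n => /IH; rewrite eq_sym => /(_ xy); lia.
by case: (z == y) => //= /IH ->.
Qed.

Lemma altf_rcons x y w z : x != y -> altf x y (rcons w z) =
  altf x y w && (if z == x then count_mem x w == count_mem y w else
                 if z == y then count_mem x w == (count_mem y w).+1 else true).
Proof.
elim: w x y => [|t w IH] x y xy /=.
  by case: (z == x) => //=; case: (z == y).
have yx : y != x by rewrite eq_sym.
case: (eqVneq t x) => [->|tx] /=.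
  rewrite IH // (negbTE xy); congr (_ && _).
  case: (eqVneq z x) => [->|zx]; first by rewrite (negbTE xy); lia.
  by case: (eqVneq z y) => // _; lia.
by case: (eqVneq t y) => //= ty; rewrite IH // !add0n.
Qed.

Definition leads x y w := forall p, count_mem y (take p w) <= count_mem x (take p w) <= (count_mem y (take p w)).+1.

Lemma leads_rcons x y w z : leads x y (rcons w z) -> leads x y w.
Proof.
move=> L p; have [le|/ltnW le] := leqP p (size w).
  by have := L p; rewrite -cats1 takel_cat.
by have := L (size w); rewrite (take_oversize le) -cats1 takel_cat // take_size.
Qed.

(** Alternation becomes a pair of inequalities between prefix counts, and such inequalities can be
    chained along directed paths. *)
Lemma altfP x y w : x != y -> altf x y w <-> leads x y w.
Proof.
move=> xy; split.
  elim/last_ind: w => [_ p|w z IH]; first by rewrite take_oversize.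
  move=> A p; have B := A; move: A; rewrite altf_rcons // => /andP[/IH L _].
  have [le|/ltnW le] := leqP p (size w).
    by rewrite -cats1 takel_cat.
  have [le'|lt] := leqP (size w).+1 p.
    by rewrite take_oversize ?size_rcons //; apply: altf_bounds.
  have -> : p = size w by lia.
  by have := L (size w); rewrite -cats1 takel_cat // take_size.
elim/last_ind: w => // w z IH L; rewrite altf_rcons // IH /=; last exact: leads_rcons L.
have := leads_rcons L (size w); rewrite take_size => B.
have := L (size w).+1; rewrite take_oversize ?size_rcons // -cats1 !count_cat /= !addn0.
case: (eqVneq z x) => [->|zx]; first by rewrite (negbTE xy) /=; lia.
by case: (eqVneq z y) => //= _; lia.
Qed.

(* the numbers of u's before the occurrences of x, increased by c *)
Fixpoint bef c x u w : seq nat := match w with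
  | [::] => [::]
  | z :: w' => if z == x then c :: bef c x u w' else bef (c + (z == u)) x u w' end.

Lemma size_bef c x u w : size (bef c x u w) = count_mem x w.
Proof. by elim: w c => //= z w IH c; case: eqP => /= _; rewrite ?IH. Qed.

Lemma bef_ge c x u w n : n \in bef c x u w -> c <= n.
Proof.
elim: w c => //= z w IH c; case: eqP => _; last by move=> /IH; lia.
by rewrite inE => /predU1P[->|/IH].
Qed.

(** The counts before the [x]'s fix the pattern up to the last [x]; the bound on the number of [u]'s
    then allows at most one more [u] after it. *)
Lemma altf_bef c x u w : x != u ->
  altf x u w = (bef c x u w == iota c (count_mem x w)) && (count_mem u w <= count_mem x w) /\
  altf u x w = (bef c x u w == iota c.+1 (count_mem x w)) && (count_mem u w <= (count_mem x w).+1).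
Proof.
move=> xu; elim: w c => // z w IH c /=.
case: (eqVneq z x) => [->|zx] /=.
  rewrite (negbTE xu) /= !add0n !add1n /= !eqseq_cons eqxx /=.
  have [_ <-] := IH c; split=> //.
  by rewrite eqn_leq ltnn andbF.
case: (eqVneq z u) => [zu|zu] /=; rewrite ?add0n ?addn0 //.
rewrite add1n addn1; have [<- _] := IH c.+1; split=> //.
apply/esym/negP => /andP[/eqP E le].
have cw : 0 < count_mem x w by lia.
have : c \in bef c.+1 x u w by rewrite E mem_iota; lia.
by move/bef_ge; rewrite ltnn.
Qed.

Lemma alt_bef k x u w : x != u -> count_mem x w = k -> count_mem u w = k ->
  alt x u w = (bef 0 x u w == iota 0 k) || (bef 0 x u w == iota 1 k).
Proof.
move=> xu cx cu; have [A B] := altf_bef 0 w xu.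
by rewrite /alt A B cx cu leqnn leqnSn !andbT.
Qed.

Lemma alt_rot1 x y z w : x != y -> count_mem x (z :: w) = count_mem y (z :: w) ->
  alt x y (rcons w z) = alt x y (z :: w).
Proof.
move=> xy; have yx : y != x by rewrite eq_sym.
rewrite /alt !altf_rcons //=.
case: (eqVneq z x) => [->|zx].
  rewrite (negbTE xy) /= orbF add0n add1n => E.
  rewrite -E eqxx andbT; have -> : (count_mem x w == (count_mem x w).+1) = false by lia.
  by rewrite andbF.
case: (eqVneq z y) => [_|zy] /=; last by rewrite !andbT.
rewrite add0n add1n => ->.
rewrite eqxx andbT; have -> : (count_mem y w == (count_mem y w).+1) = false by lia.
by rewrite andbF orbF.
Qed.

Lemma alt_rot n x y w : x != y -> count_mem x w = count_mem y w ->
  alt x y (rot n w) = alt x y w.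
Proof.
move=> xy; elim: n w => [|n IH] w E; first by rewrite rot0.
have [lt|ge] := ltnP n (size w); last by rewrite rot_oversize // ltnW.
rewrite -addn1 rotD ?addn1 // -[rot 1 _]/(rot 1 w).
have Ec a : count_mem a (rot 1 w) = count_mem a w by apply/seq.permP; rewrite perm_rot.
rewrite IH ?Ec //.
case: w E {lt Ec} => // z w E; rewrite rot1_cons; exact: alt_rot1.
Qed.

End Alternation.

Lemma altf_map (T U : eqType) (f : T -> U) (D : pred T) x y w :
  {in D &, injective f} -> all D w -> D x -> D y ->
  altf (f x) (f y) (map f w) = altf x y w.
Proof.
move=> inj; elim: w x y => //= z w IH x y /andP[Dz Dw] Dx Dy.
have E a b : D a -> D b -> (f a == f b) = (a == b).
  by move=> Da Db; apply/eqP/eqP => [/inj->|->].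
by rewrite !E // !IH.
Qed.

(** * Prepending a part of the initial permutation of a word *)

Section Initial.
Variable T : eqType.
Implicit Types (w : seq T) (x y : T) (O : pred T).

Fixpoint firsts w : seq T := match w with
  | [::] => [::] | x :: w' => x :: [seq y <- firsts w' | y != x] end.

Lemma mem_firsts w : firsts w =i w.
Proof.
elim: w => // x w IH y /=; rewrite !inE mem_filter IH.
by case: (eqVneq y x).
Qed.
Lemma firsts_uniq w : uniq (firsts w).
Proof. by elim: w => //= x w IH; rewrite mem_filter eqxx filter_uniq. Qed.
Lemma filter_firsts (p : pred T) w : filter p (firsts w) = firsts (filter p w).
Proof.
elim: w => //= x w IH.
have C : [seq y <- [seq y <- firsts w | y != x] | p y] = [seq y <- firsts [seq y <- w | p y] | y != x].
  by rewrite -filter_predI -IH -filter_predI; apply: eq_filter => y /=; rewrite andbC.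
case: (boolP (p x)) => px /=; first by rewrite C.
rewrite C -IH; apply/all_filterP/allP => y; rewrite mem_filter => /andP[py _].
by apply: contraNneq px => <-.
Qed.
Lemma firsts_nseq b n : firsts (nseq n.+1 b) = [:: b].
Proof.
elim: n => // n IH; rewrite -[LHS]/(b :: [seq y <- firsts (nseq n.+1 b) | y != b]).
by rewrite IH /= eqxx.
Qed.

Definition prep (O : pred T) w := [seq x <- firsts w | O x] ++ w.

Lemma count_prep O w x : x \in w -> count_mem x (prep O w) = O x + count_mem x w.
Proof.
move=> xw; rewrite count_cat; congr (_ + _).
rewrite count_uniq_mem ?filter_uniq ?firsts_uniq // mem_filter mem_firsts xw andbT.
by [].
Qed.

(** If both letters are prepended, they come in the order of their first occurrences and continue
    the pattern to the left. If only one is, it is the rarer one, so an alternating pattern starts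
    with the other letter and is again continued. A pattern that does not alternate never gains
    alternation. *)
Lemma alt_prep O w x y : x != y -> x \in w -> y \in w ->
  (O x -> ~~ O y -> count_mem x w < count_mem y w) ->
  (O y -> ~~ O x -> count_mem y w < count_mem x w) ->
  alt x y (prep O w) = alt x y w.
Proof.
move=> xy xw yw Hx Hy.
have yx : y != x by rewrite eq_sym.
pose p : pred T := pred2 x y.
have px : p x by rewrite /p /= eqxx.
have py : p y by rewrite /p /= eqxx orbT.
rewrite /alt -(altf_filter w px py) -(altf_filter w py px).
rewrite -(altf_filter (prep O w) px py) -(altf_filter (prep O w) py px).
rewrite filter_cat -filter_predI (eq_filter (a2 := predI O p)); last by move=> z /=; rewrite andbC.
rewrite filter_predI filter_firsts.
have up : all p [seq z <- w | p z] by apply: filter_all.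
have xu : x \in [seq z <- w | p z] by rewrite mem_filter px.
have yu : y \in [seq z <- w | p z] by rewrite mem_filter py.
have cu z : p z -> count_mem z [seq z <- w | p z] = count_mem z w.
  by move=> pz; rewrite count_filter; apply: eq_count => t /=; case: eqP => // ->.
move: (cu x px) (cu y py) up xu yu; move: [seq z <- w | p z] => u.
move=> cx cy up xu yu; rewrite -cx -cy in Hx Hy; clear xw yw cu cx cy.
(* Here [a] is whichever of the two letters occurs first, so the initial permutation of the
   restricted word is [a b]. *)
have one a b v : a != b -> pred2 a b =1 p -> all p v -> b \in v ->
  (O a -> ~~ O b -> count_mem a (a :: v) < count_mem b (a :: v)) ->
  (O b -> ~~ O a -> count_mem b (a :: v) < count_mem a (a :: v)) ->
  alt a b ([seq z <- firsts (a :: v) | O z] ++ (a :: v)) = alt a b (a :: v).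
  move=> ab pE pv bv Ha Hb.
  have -> : firsts (a :: v) = [:: a; b].
    rewrite /= filter_firsts; congr (_ :: _).
    have -> : [seq y <- v | y != a] = nseq (count_mem b v) b.
      rewrite -(@eq_in_filter _ (pred1 b)); last first.
        move=> z /(allP pv); rewrite -pE /=; case: (eqVneq z a) => [->|_] /=; first by rewrite (negbTE ab).
        by move=> ->.
      rewrite -size_filter; apply/all_pred1P; exact: filter_all.
    have : 0 < count_mem b v by rewrite -has_count has_pred1.
    by case: (count_mem b v) => // m _; apply: firsts_nseq.
  have ba : b != a by rewrite eq_sym.
  have nba : altf b a (a :: v) = false by rewrite /= (negbTE ab) eqxx.
  rewrite /= in Ha Hb *; rewrite /alt.
  case: (boolP (O a)) Ha Hb => Oa; case: (boolP (O b)) => Ob Ha Hb //=;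
    rewrite ?eqxx ?(negbTE ab) ?(negbTE ba) ?eqxx /= ?orbF ?(negbTE ab) ?(negbTE ba) ?eqxx /=.
  - by [].
  - apply/esym/negP => /(altf_bounds ba).
    have := Ha isT isT; rewrite eqxx (negbTE ab) !add0n !add1n => lt /andP[_].
    by rewrite leqNgt lt.
  by [].
rewrite -![altf x y _ || altf y x _]/(alt x y _).
case: u up xu yu Hx Hy => [//|a v]; rewrite [all _ _]/= => /andP[pa pv] xu yu Hx Hy.
case/orP: (pa) => /eqP Ea; subst a.
- by apply: one Hx Hy => //; rewrite inE (negbTE yx) in yu.
- rewrite altC [RHS]altC; apply: one Hy Hx => //.
  + by move=> z /=; rewrite /p /= orbC.
  + by rewrite inE (negbTE xy) in xu.
Qed.
End Initial.

(** * Coded graphs and their words *)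

Fixpoint wf (g : code) : bool := match g with [::] => true | N :: H => (size N == size H) && wf H end.
Definition cadj g i j := isadj (ent (mat g) i j).

Lemma size_zipc cs m : size cs = size m -> size (zip_cells cs m) = size m.
Proof. by elim: cs m => [|c cs IH] [|r m] //= [/IH->]. Qed.
Lemma nth_zipc cs m i : size cs = size m -> i < size m ->
  nth [::] (zip_cells cs m) i = nth Self cs i :: nth [::] m i.
Proof. by elim: cs m i => [|c cs IH] [|r m] // [|i] //= [E] lt; rewrite IH. Qed.

Lemma size_mat g : wf g -> size (mat g) = size g.
Proof. by elim: g => //= N H IH /andP[/eqP sN /IH E]; rewrite size_zipc ?size_map E. Qed.

Lemma ent0S N H j : ent (mat (N :: H)) 0 j.+1 = nth Self (map cell_of N) j.
Proof. by []. Qed.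
Lemma entS0 N H i : wf (N :: H) -> i < size H -> ent (mat (N :: H)) i.+1 0 = nth Self (map cell_of N) i.
Proof.
by case/andP => /eqP sN wH lt; rewrite /ent /= nth_zipc ?size_map ?size_mat.
Qed.
Lemma entSS N H i j : wf (N :: H) -> i < size H -> ent (mat (N :: H)) i.+1 j.+1 = ent (mat H) i j.
Proof.
by case/andP => /eqP sN wH lt; rewrite /ent /= nth_zipc ?size_map ?size_mat.
Qed.

Lemma nth_cl N j : j < size N -> nth Self (map cell_of N) j = cell_of (nth false N j).
Proof. by move=> lt; rewrite (nth_map false). Qed.

Lemma size_row g i : wf g -> i < size g -> size (nth [::] (mat g) i) = size g.
Proof.
elim: g i => // N H IH [|i] /andP[/eqP sN wH] lt; first by rewrite /= size_map sN.
by rewrite /= nth_zipc ?size_map ?size_mat //= IH.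
Qed.

Lemma ent_sym g i j : wf g -> i < size g -> j < size g -> ent (mat g) i j = ent (mat g) j i.
Proof.
elim: g i j => // N H IH [|i] [|j] W li lj //.
- by rewrite ent0S entS0.
- by rewrite entS0 // ent0S.
by rewrite !entSS // IH //; case/andP: W.
Qed.

Lemma ent_self g i j : wf g -> i < size g -> j < size g -> (ent (mat g) i j = Self) <-> i = j.
Proof.
elim: g i j => // N H IH [|i] [|j] W li lj //.
- by rewrite ent0S nth_cl; [case: (nth _ _ _)|case/andP: W => /eqP->].
- by rewrite entS0 // nth_cl; [case: (nth _ _ _)|case/andP: W => /eqP->].
rewrite entSS // IH //; last by case/andP: W.
by split=> [->|[]].
Qed.

Lemma adj_sym g i j : wf g -> i < size g -> j < size g -> cadj g i j = cadj g j i.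
Proof. by move=> *; rewrite /cadj ent_sym. Qed.
Lemma adj_irr g i : wf g -> i < size g -> cadj g i i = false.
Proof. by move=> W l; rewrite /cadj; have /(_ erefl) -> := proj2 (ent_self W l l). Qed.
Lemma adj0S N H j : wf (N :: H) -> j < size H -> cadj (N :: H) 0 j.+1 = nth false N j.
Proof.
by case/andP => /eqP sN wH lt; rewrite /cadj ent0S nth_cl ?sN //; case: (nth _ _ _).
Qed.
Lemma adjS0 N H j : wf (N :: H) -> j < size H -> cadj (N :: H) j.+1 0 = nth false N j.
Proof. by move=> W lt; rewrite adj_sym // adj0S. Qed.
Lemma adjSS N H i j : wf (N :: H) -> i < size H -> cadj (N :: H) i.+1 j.+1 = cadj H i j.
Proof. by move=> W lt; rewrite /cadj entSS. Qed.

Definition embeds (p g : code) (f : seq nat) :=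
  size f = size p /\ (forall i, i < size p -> nth 0 f i < size g) /\
  (forall i j, i < size p -> j < size p -> ent (mat p) i j = ent (mat g) (nth 0 f i) (nth 0 f j)).

Lemma rowchkP r f row : rowchk r f row -> size f = size r /\
  forall j, j < size r -> nth Self row (nth 0 f j) = cell_of (nth false r j).
Proof.
elim: r f => [|b r IH] [|y f] //=.
case E: (nth Self row y) => //; case: b => // /IH[-> H]; split=> // [[|j]] //= lt; exact: H.
Qed.

Lemma embchkP p f g : wf p -> wf g -> embchk p f (mat g) -> embeds p g f.
Proof.
move=> + wg; elim: p f => [|r p IH] [|x f] // W.
case/andP: (W) => /eqP sr wp /=.
case Ex: (nth [::] (mat g) x) => [//|c0 row0]; set row := c0 :: row0 in Ex *.
case: ifP => // /rowchkP[sf Hr] /(IH _ wp)[sf' [lf Hf]].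
have lx : x < size g.
  by rewrite -size_mat // ltnNge; apply/negP => le; rewrite nth_default in Ex.
split; [by rewrite /= sf sr | split].
  by case=> // i; apply: lf.
case=> [|i] [|j] li lj.
- by rewrite /=; apply/esym/ent_self.
- by rewrite ent0S nth_cl ?sr //= /ent Ex Hr ?sr.
- rewrite entS0 // nth_cl ?sr //= ent_sym ?lf // /ent Ex Hr ?sr //.
by rewrite entSS // Hf.
Qed.

Section Emb.
Variables (p g : code) (f : seq nat).
Hypotheses (wp : wf p) (wg : wf g) (E : embeds p g f).

Lemma emb_inj i j : i < size p -> j < size p -> nth 0 f i = nth 0 f j -> i = j.
Proof.
case: E => _ [lf Hf] li lj Eij; apply/(ent_self wp li lj).
by rewrite Hf // Eij; apply/ent_self; rewrite ?lf.
Qed.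
Lemma emb_uniq : uniq f.
Proof.
case: E => sf _; apply/(uniqP 0) => i j; rewrite !inE sf; exact: emb_inj.
Qed.
Lemma emb_adj i j : i < size p -> j < size p -> cadj p i j = cadj g (nth 0 f i) (nth 0 f j).
Proof. by case: E => _ [_ Hf] li lj; rewrite /cadj Hf. Qed.
End Emb.

Definition reps g w := forall i j, i < size g -> j < size g -> i != j -> alt i j w = cadj g i j.
(** Letters that are not vertices may occur in [w]; they do not affect the conditions. *)
Definition kword k g w := (forall i, i < size g -> count_mem i w = k) /\ reps g w.
Definition krep k g := exists w, kword k g w.
Definition wrep g := exists2 w, (forall i, i < size g -> i \in w) & reps g w.

Lemma krep_wrep k g : 0 < k -> krep k g -> wrep g.
Proof.
move=> k0 [w [cw Rw]]; exists w => // i /cw ci.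
by rewrite -has_pred1 has_count ci.
Qed.

Section EmbRep.
Variables (p g : code) (f : seq nat).
Hypotheses (wp : wf p) (wg : wf g) (E : embeds p g f).
Let D : pred nat := [in f].
Definition pullw (w : seq nat) := [seq index x f | x <- w & D x].

Lemma pull_count w i : i < size p -> count_mem i (pullw w) = count_mem (nth 0 f i) w.
Proof.
move=> li; case: (E) => sf _; rewrite count_map count_filter; apply: eq_count => x /=.
apply/andP/eqP => [[/eqP <- xf]|->]; first by rewrite nth_index.
by rewrite index_uniq ?(emb_uniq wp wg E) ?sf //; split; rewrite ?eqxx // /D /= mem_nth ?sf.
Qed.
Lemma pull_alt w i j : i < size p -> j < size p ->
  alt i j (pullw w) = alt (nth 0 f i) (nth 0 f j) w.
Proof.
move=> li lj; case: (E) => sf _.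
have U := emb_uniq wp wg E.
have Di k : k < size p -> D (nth 0 f k) by move=> lk; rewrite /D /= mem_nth ?sf.
have Ii k : k < size p -> index (nth 0 f k) f = k by move=> lk; rewrite index_uniq ?sf.
rewrite /alt -[in LHS](Ii i li) -[in LHS](Ii j lj) /pullw.
have inj : {in D &, injective (fun x => index x f)}.
  by move=> x y Dx Dy /(congr1 (nth 0 f)); rewrite !nth_index.
by rewrite !(altf_map inj) ?filter_all ?Di // !altf_filter ?Di.
Qed.
Lemma pull_reps w : reps g w -> reps p (pullw w).
Proof.
move=> R i j li lj ij; rewrite pull_alt // (emb_adj E) //; case: (E) => _ [lf _].
apply: R; rewrite ?lf //; apply: contra ij => /eqP e; exact/eqP/(emb_inj wp wg E).
Qed.
Lemma emb_krep k : krep k g -> krep k p.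
Proof.
case=> w [cw Rw]; exists (pullw w); split; last exact: pull_reps.
by move=> i li; rewrite pull_count // cw //; case: E => _ [lf _]; apply: lf.
Qed.
Lemma emb_wrep : wrep g -> wrep p.
Proof.
case=> w cw Rw; exists (pullw w); last exact: pull_reps.
move=> i li; rewrite -has_pred1 has_count pull_count // -has_count has_pred1 cw //.
by case: E => _ [lf _]; apply: lf.
Qed.
End EmbRep.

Definition rowspec k (row : seq (seq nat) -> seq cell -> bool) := forall os cs, row os cs ->
  size os = k /\ forall u, u < size cs ->
  ceq (nth Self cs u) (let s := [seq nth 0 v u | v <- os] in (s == iota 0 k) || (s == iota 1 k)).

Lemma row2P : rowspec 2 row2.
Proof.
move=> [|a [|b [|]]] // cs H; split=> // u; rewrite /row2 in H.
elim: cs a b u H => // c cs IH [|x a] [|y b] // [|u] //=; case: ifP => // Hc H lt.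
  by apply: etrans Hc; congr ceq; case: x => [|[|x]]; case: y => [|[|[|y]]].
exact: IH.
Qed.
Lemma row3P : rowspec 3 row3.
Proof.
move=> [|a [|b [|d [|]]]] // cs H; split=> // u; rewrite /row3 in H.
elim: cs a b d u H => // c cs IH [|x a] [|y b] [|z d] // [|u] //=; case: ifP => // Hc H lt.
  by apply: etrans Hc; congr ceq; case: x => [|[|x]]; case: y => [|[|[|y]]]; case: z => [|[|[|[|z]]]].
exact: IH.
Qed.
Lemma eqsnE s t : eqsn s t = (s == t).
Proof. by elim: s t => [|x s IH] [|y t] //=; rewrite eqseq_cons -IH eqnE; case: eqP. Qed.
Lemma rowkP k : rowspec k (rowk k).
Proof.
move=> os cs; rewrite /rowk eqnE; case: eqP => // so H; split=> // u lt.
have K : forall u0, altk k os u0 cs -> ceq (nth Self cs u)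
  (let s := [seq nth 0 v (u0 + u) | v <- os] in (s == iota 0 k) || (s == iota 1 k)).
  clear H; elim: cs u lt => // c cs IH [|u] lt u0 /=; case: ifP => // Hc H; first by rewrite addn0 -!eqsnE.
  by rewrite -addSnnS; apply: IH.
exact: K 0 H.
Qed.

Lemma nth_upd A x (v : A) acc y : nth [::] (upd x v acc) y =
  if (y == x) && (y < size acc) then v :: nth [::] acc y else nth [::] acc y.
Proof.
elim: acc x y => [|r acc IH] [|x] [|y] //=; rewrite ?andbF //.
Qed.
Lemma size_upd A x (v : A) acc : size (upd x v acc) = size acc.
Proof. by elim: acc x => [|r acc IH] [|x] //=; rewrite IH. Qed.
Lemma size_occs w vs acc : size (occs w vs acc) = size acc.
Proof. by elim: w vs => [|x w IH] [|v vs] //=; rewrite size_upd IH. Qed.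

Lemma occsP w v acc x u : x != u -> x < size acc -> (forall y, nth [::] acc y = [::]) ->
  [seq nth 0 v' u | v' <- nth [::] (occs w (vecs v w) acc) x] = bef (nth 0 v u) x u w.
Proof.
move=> xu lx Ha; elim: w v => [|z w IH] v /=; first by rewrite Ha.
rewrite nth_upd size_occs lx andbT [x == z]eq_sym; case: eqP => [->|nx] /=.
  by rewrite IH nth_incr_nth (negbTE xu) add0n.
by rewrite IH nth_incr_nth addnC.
Qed.

Lemma rowsP row os m : rows row os m -> size m <= size os /\ forall x, x < size m -> row (nth [::] os x) (nth [::] m x).
Proof.
elim: m os => [|cs m IH] [|o os] //=.
by case: ifP => // Ho /IH[le H]; split=> // [[|x]] //; apply: H.
Qed.

Lemma size_occs_count w v acc x : x < size acc -> (forall y, nth [::] acc y = [::]) ->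
  size (nth [::] (occs w (vecs v w) acc) x) = count_mem x w.
Proof.
move=> lx Ha; elim: w v => [|z w IH] v /=; first by rewrite Ha.
rewrite nth_upd size_occs lx andbT [x == z]eq_sym; case: eqP => [->|nx] /=; by rewrite IH.
Qed.

Lemma ceqE c b : c <> Self -> ceq c b -> b = isadj c.
Proof. by case: c => //; case: b. Qed.

Lemma wchkP k row g w : wf g -> rowspec k row -> wchk row (mat g) w -> kword k g w.
Proof.
move=> wg Hrow /rowsP[_]; rewrite size_mat // => H.
set acc := [seq [::] | _ <- mat g] in H.
have sa : size acc = size g by rewrite size_map size_mat.
have Ha y : nth [::] acc y = [::].
  by have [lt|ge] := ltnP y (size (mat g)); [rewrite (nth_map [::])|rewrite nth_default ?size_map].
have C i : i < size g -> count_mem i w = k.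
  by move=> li; have [<- _] := Hrow _ _ (H i li); rewrite size_occs_count ?sa.
split=> // i j li lj ij.
have [_ /(_ j)] := Hrow _ _ (H i li); rewrite size_row // => /(_ lj) /=.
rewrite occsP ?sa //.
have -> : nth 0 (zv (mat g)) j = 0 by rewrite /zv (nth_map [::]) ?size_mat.
rewrite -(alt_bef ij (C i li) (C j lj)).
move/ceqE => -> //; rewrite -/(ent (mat g) i j) ent_self //; exact/eqP.
Qed.

(** The new letter is 0 and old letters move up by one, matching the vertex numbers of [N :: H].
    Each entry of [ds] is the number of old letters since the previous insertion. *)
Fixpoint insw (w ds : seq nat) : seq nat := match ds with
  | [::] => map succn w | d :: ds' => map succn (take d w) ++ 0 :: insw (drop d w) ds' end.

Lemma filter_insw w ds : [seq x <- insw w ds | x != 0] = map succn w.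
Proof.
have F s : [seq x <- map succn s | x != 0] = map succn s.
  by apply/all_filterP/allP => x /mapP[y _ ->].
elim: ds w => [|d ds IH] w /=; first exact: F.
by rewrite filter_cat F /= IH -map_cat cat_take_drop.
Qed.
Lemma count_insw0 w ds : count_mem 0 (insw w ds) = size ds.
Proof.
have F s : count_mem 0 (map succn s) = 0.
  by elim: s.
elim: ds w => [|d ds IH] w /=; first exact: F.
by rewrite count_cat F /= IH.
Qed.
Lemma count_inswS w ds u : count_mem u.+1 (insw w ds) = count_mem u w.
Proof.
transitivity (count_mem u.+1 [seq x <- insw w ds | x != 0]).
  by rewrite count_filter; apply: eq_count => x /=; case: eqP => // ->.
by rewrite filter_insw count_map; apply: eq_count => x /=.
Qed.
Lemma alt_inswS w ds u v : alt u.+1 v.+1 (insw w ds) = alt u v w.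
Proof.
rewrite /alt -![altf _ _ (insw _ _)](altf_filter (p := fun x => x != 0)) // filter_insw.
have inj : {in predT &, injective succn} by move=> x y _ _ [].
by rewrite !(altf_map inj) ?all_predT.
Qed.

Fixpoint cuts c u (w ds : seq nat) : seq nat := match ds with
  | [::] => [::] | d :: ds' => let c' := c + count_mem u (take d w) in c' :: cuts c' u (drop d w) ds' end.

Lemma bef_insw w ds c u : bef c 0 u.+1 (insw w ds) = cuts c u w ds.
Proof.
elim: ds w c => [|d ds IH] w c /=.
  by elim: w c => //= x w IH c; rewrite IH.
rewrite -IH; elim: (take d w) c => [|x s IHs] c /=; first by rewrite addn0.
by rewrite IHs addnA.
Qed.

Lemma drop_vecs v w d : drop d (vecs v w) =
  if d <= size w then vecs (foldl incr_nth v (take d w)) (drop d w) else [::].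
Proof.
elim: w v d => [|x w IH] v [|d] //=; exact: IH.
Qed.
Lemma nth_foldl_incr v s u : nth 0 (foldl incr_nth v s) u = nth 0 v u + count_mem u s.
Proof.
by elim: s v => [|x s IH] v /=; rewrite ?addn0 // IH nth_incr_nth -addnA addnCA.
Qed.

Lemma cutv_cuts v w ds u : size (cutv (vecs v w) ds) = size ds ->
  [seq nth 0 a u | a <- cutv (vecs v w) ds] = cuts (nth 0 v u) u w ds.
Proof.
elim: ds v w => // d ds IH v w /=; rewrite drop_vecs; case: ifP => // le.
have [h E] : exists t, vecs (foldl incr_nth v (take d w)) (drop d w) = foldl incr_nth v (take d w) :: t.
  by case: (drop d w) => [|x s]; eexists.
rewrite E -E /= => -[/IH->]; by rewrite nth_foldl_incr.
Qed.

Lemma kword_ins k N H w ds : wf (N :: H) -> kword k H w -> size ds = k ->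
  (forall u, u < size H -> (cuts 0 u w ds == iota 0 k) || (cuts 0 u w ds == iota 1 k) = nth false N u) ->
  kword k (N :: H) (insw w ds).
Proof.
move=> W [cw Rw] sd Hd.
have C i : i < size (N :: H) -> count_mem i (insw w ds) = k.
  by case: i => [|i] li; [rewrite count_insw0|rewrite count_inswS cw].
have A u : u < size H -> alt 0 u.+1 (insw w ds) = nth false N u.
  by move=> lu; rewrite (alt_bef (k := k)) ?C // bef_insw Hd.
split=> // -[|i] [|j] li lj // ij.
- by rewrite A // adj0S.
- by rewrite altC A // adjS0.
by rewrite alt_inswS adjSS // Rw.
Qed.

Lemma cutvP k row N H w ds : wf (N :: H) -> kword k H w -> size ds = k -> rowspec k row ->
  row (cutv (vecs (zv (mat H)) w) ds) (map cell_of N) -> krep k (N :: H).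
Proof.
move=> W Kw sd Hrow /Hrow[sc Hr]; exists (insw w ds).
case/andP: (W) => /eqP sN wH.
apply: kword_ins => // u lu.
have := Hr u; rewrite size_map sN => /(_ lu); rewrite nth_cl ?sN //= cutv_cuts ?sc //.
have -> : nth 0 (zv (mat H)) u = 0 by rewrite /zv (nth_map [::]) ?size_mat.
by move/ceqE => ->; case: (nth _ _ _).
Qed.

Lemma kword_rot k g w n : kword k g w -> kword k g (rot n w).
Proof.
case=> cw Rw; split=> [i li|i j li lj ij].
  by rewrite -(cw i li); apply/seq.permP; rewrite perm_rot.
by rewrite alt_rot ?cw // Rw.
Qed.

Lemma kword_head k g w i : kword k g w -> 0 < k -> i < size g ->
  exists2 w', kword k g w' & head 0 w' = i /\ w' != [::].
Proof.
move=> K k0 li; exists (rot (index i w) w); first exact: kword_rot.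
have iw : i \in w by rewrite -has_pred1 has_count; case: K => -> .
by rewrite rot_index.
Qed.

(** Prepending the whole initial permutation adds one occurrence of each letter and preserves
    alternation. *)
Lemma krepS k g : 0 < k -> krep k g -> krep k.+1 g.
Proof.
move=> k0 [w [cw Rw]]; exists (prep predT w).
have iw i : i < size g -> i \in w by move=> li; rewrite -has_pred1 has_count cw.
split=> [i li|i j li lj ij]; first by rewrite count_prep ?iw ?cw.
by rewrite alt_prep ?iw // Rw.
Qed.
Lemma krep_le j k g : 0 < j -> j <= k -> krep j g -> krep k g.
Proof.
move=> j0 /subnKC <-; elim: (k - j) => [|m IH] K; first by rewrite addn0.
by rewrite addnS; apply: krepS; [lia | apply: IH].
Qed.

(* As long as the letter counts differ, the letters with fewer than K occurrences are prepended. *)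
Lemma wrep_krep g : wrep g -> exists2 k, 0 < k & krep k g.
Proof.
case=> w iw Rw; set K := (size w).+1.
(* [K] exceeds all letter counts of [w], and [K - (K - j)] is the minimum of [j] and [K]: each round
   lifts the lower bound by one until all counts equal [K]. *)
suff H j : exists w, [/\ forall i, i < size g -> i \in w, reps g w,
    forall i, i < size g -> count_mem i w <= K & forall i, i < size g -> K - (K - j) <= count_mem i w].
  have [v [_ Rv le ge]] := H K; exists K => //; exists v; split=> // i li.
  by have := le i li; have := ge i li; lia.
elim: j => [|j [v [iv Rv le ge]]].
  by exists w; split=> // i li; [rewrite (leq_trans (count_size _ _)) // leqnSn | lia].
exists (prep (fun x => count_mem x v < K) v); split=> [i li|i j' li lj ij|i li|i li].
- by rewrite mem_cat iv ?orbT.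
- by rewrite alt_prep ?iv ?Rv // => lt /negP ge'; move: (le i li) (le j' lj); lia.
- rewrite count_prep ?iv //; have := le i li; case: ltnP => /=; lia.
- rewrite count_prep ?iv //; have := le i li; have := ge i li; case: ltnP => /=; lia.
Qed.

(** * Refutations of word-representability *)

Section RefuteSound.
Variables (g : code) (w : seq nat) (k : nat).
Hypotheses (wg : wf g) (Kw : kword k g w) (k0 : 0 < k).
Hypotheses (w0 : w != [::]) (hw : head 0 w = (size g).-1).
Let m := mat g.

Definition above i j := forall p, count_mem j (take p w) <= count_mem i (take p w).
Definition arcok i j := [/\ i < size g, j < size g, cadj g i j & leads i j w].
Definition Aok A := forall i j, arc A i j -> arcok i j.

Lemma ent_in i j : ent m i j <> Self -> i < size g /\ j < size g.
Proof.
move=> E; have li : i < size g.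
  rewrite ltnNge; apply/negP => le; apply: E; rewrite /ent [nth [::] m i]nth_default ?nth_nil //.
  by rewrite size_mat.
split=> //; rewrite ltnNge; apply/negP => le; apply: E.
by rewrite /ent nth_default // size_row.
Qed.

Lemma adj_neq i j : i < size g -> cadj g i j -> i != j.
Proof. by move=> li; apply: contraTneq => <-; rewrite adj_irr. Qed.

Lemma nth_seti A (x0 : A) s i f j : nth x0 (seti s i f) j = if (i == j) && (i < size s) then f (nth x0 s j) else nth x0 s j.
Proof. by elim: s i j => [|x s IH] [|i] [|j] //=; rewrite ?andbF // IH eqSS ltnS. Qed.

Lemma setarcP A i j x y : arc (setarc A i j) x y -> (x = i /\ y = j) \/ arc A x y.
Proof.
rewrite /arc /setarc nth_seti; case: andP => [[/eqP <- _]|_]; last by right.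
by rewrite nth_seti; case: andP => [[/eqP <- _]|_]; [left|right].
Qed.

Lemma Aok_set A i j : Aok A -> arcok i j -> Aok (setarc A i j).
Proof. by move=> HA Hij x y /setarcP[[-> ->]//|/HA]. Qed.

Lemma above_trans j i l : above i j -> above j l -> above i l.
Proof. by move=> H1 H2 p; apply: leq_trans (H2 p) (H1 p). Qed.

Lemma dpath_above A x p : Aok A -> dpath A x p -> above x (last x p).
Proof.
move=> HA; elim: p x => [|y p IH] x /=; first by move=> _ q.
case: ifP => // /HA[_ _ _ L] /IH; apply: above_trans.
by move=> q; case/andP: (L q).
Qed.

Lemma dpath_cat A x p q : dpath A x (p ++ q) -> dpath A x p /\ dpath A (last x p) q.
Proof. by elim: p x => //= y p IH x; case: ifP => // _ /IH. Qed.

(** The two counts would agree on all prefixes, yet the first occurrence of [i] raises only the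
    count of [i]. *)
Lemma above_eq_false i j : i < size g -> i != j -> above i j -> above j i -> False.
Proof.
move=> li ij H1 H2.
have iw : i \in w by rewrite -has_pred1 has_count; case: Kw => ->.
have := H1 (index i w).+1; have := H2 (index i w).+1.
have := H1 (index i w); have := H2 (index i w).
rewrite (take_nth 0) ?index_mem // nth_index // -!cats1 !count_cat /= eqxx (negbTE ij); lia.
Qed.

(** Prefix counts decrease weakly along directed paths. On a cycle they would all coincide. In the
    case [Sht] the closing arc says that the count of the first vertex exceeds that of the last by
    at most one; the counts of [x] and [y] lie in between, so [x] and [y] alternate although they
    are not adjacent. *)
Lemma refchk_sound t A : Aok A -> refchk m t A -> False.
Proof.
elim: t A => [i j t1 IH1 t2 IH2|p|p x q y r] A HA /=.
- case E: (ent m (digit_val i) (digit_val j)) => //; case: ifP => // R1 R2.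
  have [li lj] : digit_val i < size g /\ digit_val j < size g by apply: ent_in; rewrite E.
  have a1 : cadj g (digit_val i) (digit_val j) by rewrite /cadj E.
  have ij := adj_neq li a1.
  case: Kw => _ /(_ _ _ li lj ij); rewrite a1 => /orP[]/altfP L.
    apply: IH1 R1; apply: Aok_set => //; split=> //; exact: L.
  apply: IH2 R2; apply: Aok_set => //; split=> //; first by rewrite adj_sym.
  by apply: L; rewrite eq_sym.
- case: (digits_val p) => // x s; case: ifP => // P /HA[ll lx al L].
  case: s P ll al L => [|z s] P ll al L; first by rewrite adj_irr in al.
  move: (P) => /=; case: ifP => // /HA[_ lz az Lz] P'.
  apply: (@above_eq_false x z) => //; first exact: adj_neq.
    by move=> u; case/andP: (Lz u).
  apply: above_trans (dpath_above HA P') _.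
  by move=> u; case/andP: (L u).
- set F := _ ++ _.
  case EF: F => [//|s p']; case: ifP => // P; case: ifP => // /HA[ls ll al L].
  case En: (ent m (digit_val x) (digit_val y)) => // _.
  have [lx ly] : digit_val x < size g /\ digit_val y < size g by apply: ent_in; rewrite En.
  have xy : digit_val x != digit_val y.
    by apply/eqP => /(ent_self wg lx ly); rewrite -/m En.
  have [Ax Q] : above s (digit_val x) /\ dpath A (digit_val x) (digits_val q ++ digit_val y :: digits_val r).
    case Ep: (digits_val p) EF => [|s' p1]; rewrite /F Ep /= => -[Es Ep']; subst.
      by split.
    have [P1 P2] := dpath_cat P; split; last by move: P2 => /=; case: ifP.
    apply: above_trans (dpath_above HA P1) _.
    by move: P2 => /=; case: ifP => // /HA[_ _ _ L2] _ u; case/andP: (L2 u).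
  have [Axy R] : above (digit_val x) (digit_val y) /\ dpath A (digit_val y) (digits_val r).
    have [P1 P2] := dpath_cat Q; split; last by move: P2 => /=; case: ifP.
    apply: above_trans (dpath_above HA P1) _.
    by move: P2 => /=; case: ifP => // /HA[_ _ _ L2] _ u; case/andP: (L2 u).
  have Al := dpath_above HA R.
  have El : last s p' = last (digit_val y) (digits_val r).
    have : last 0 F = last s p' by rewrite EF.
    by rewrite /F last_cat /= last_cat /=.
  case: Kw => _ /(_ _ _ lx ly xy); rewrite /cadj -/m En /= => /negbT/negP; apply.
  apply/orP; left; apply/altfP => // u.
  have := Ax u; have := Axy u; have := Al u; case/andP: (L u); rewrite El.
  by move=> _ b c d e; rewrite d /= (leq_trans e) // (leq_trans b) // ltnS.
Qed.

Lemma start_ok : 0 < size g -> Aok (start m).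
Proof.
move=> g0 i j; rewrite /arc /start nth_rcons size_map size_behead size_mat //.
case: ltnP => [lt|ge].
  rewrite (nth_map [::]) ?size_behead ?size_mat //.
  have [lt'|ge'] := ltnP j (size (nth [::] (behead m) i)).
    by rewrite (nth_map Self).
  by rewrite nth_default ?size_map.
case: eqP => [->|_]; last by rewrite nth_nil.
rewrite -nth_last size_mat // => a.
have E : isadj (ent m (size g).-1 j).
  have [lt|ge'] := ltnP j (size (nth [::] m (size g).-1)); first by rewrite (nth_map Self) in a.
  by rewrite nth_default ?size_map in a.
have ls : (size g).-1 < size g by lia.
have [_ lj] : (size g).-1 < size g /\ j < size g by apply: ent_in => E'; rewrite E' in E.
have sj : (size g).-1 != j by apply: adj_neq.
split=> //; apply/altfP => //.
case: Kw => _ /(_ _ _ ls lj sj); rewrite [cadj _ _ _]E => /orP[//|].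
case: (w) w0 hw => // x w' _ /= ->.
by rewrite (negbTE sj) eqxx.
Qed.
End RefuteSound.

Lemma refutesP g t : wf g -> 0 < size g -> refutes g t -> ~ wrep g.
Proof.
move=> wg g0 R /wrep_krep[k k0 [w K]].
have ls : (size g).-1 < size g by lia.
have [w' K' [hw w0]] := kword_head K k0 ls.
exact: (refchk_sound wg K' k0 w0 hw (start_ok wg K' k0 w0 hw g0) R).
Qed.

(** * Soundness of the certificates *)

Lemma completeP g : wf g -> all (all id) g <->
  (forall i j, i < size g -> j < size g -> i != j -> cadj g i j).
Proof.
elim: g => [|N H IH] W; first by split.
have /andP[/eqP sN wH] := W; split=> /=.
  case/andP => aN aH; have {}aH := proj1 (IH wH) aH; have {}aN := elimT (all_nthP false) aN.
  move=> [|i] [|j] li lj // ij.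
  - by rewrite adj0S // aN ?sN.
  - by rewrite adjS0 // aN ?sN.
  - by rewrite adjSS // aH.
move=> A; apply/andP; split.
  by apply/(all_nthP false) => i; rewrite sN => li; rewrite -(adj0S W) // A.
by apply/(IH wH) => i j li lj ij; rewrite -(adjSS j W) // A.
Qed.

Lemma bef_le c (x u : nat) w n : n \in bef c x u w -> n <= c + count_mem u w.
Proof.
elim: w c => //= z w IH c; case: (eqVneq z x) => _; last by move=> /IH; rewrite addnA.
by rewrite inE => /predU1P[->|/IH]; lia.
Qed.

Lemma kword1_alt g w i j : kword 1 g w -> i < size g -> j < size g -> i != j -> alt i j w.
Proof.
case=> cw _ li lj ij; rewrite (alt_bef ij (cw i li) (cw j lj)).
have := size_bef 0 i j w; rewrite cw //.
have := @bef_le 0 i j w; rewrite cw //.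
case: (bef _ _ _ _) => [|c [|]] //= /(_ c); rewrite inE eqxx => /(_ isT).
by case: c => [|[|]].
Qed.

Lemma krep1P g : wf g -> krep 1 g <-> all (all id) g.
Proof.
move=> W; split=> [[w K]|/(completeP W) A].
  by apply/(completeP W) => i j li lj ij; case: (K) => _ <- //; apply: kword1_alt K _ _ _.
have C i : i < size g -> count_mem i (iota 0 (size g)) = 1.
  by move=> li; rewrite count_uniq_mem ?iota_uniq // mem_iota li.
exists (iota 0 (size g)); split=> // i j li lj ij; rewrite A //.
have := size_bef 0 i j (iota 0 (size g)); rewrite C //.
have := @bef_le 0 i j (iota 0 (size g)); rewrite C //.
rewrite (alt_bef ij (C i li) (C j lj)).
case: (bef _ _ _ _) => [|c [|]] //= /(_ c); rewrite inE eqxx => /(_ isT).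
by case: c => [|[|]].
Qed.

Lemma embeds_tail N H : wf (N :: H) -> embeds H (N :: H) (iota 1 (size H)).
Proof.
move=> W; split; [by rewrite size_iota | split=> [i li|i j li lj]].
  by rewrite nth_iota.
by rewrite !nth_iota // entSS.
Qed.

(** Excluding the next smaller number suffices, by [krep_le]. *)
Definition stat_ok g s : Prop := match s with
  | S1 => krep 1 g
  | S2 _ _ _ => krep 2 g /\ ~ krep 1 g
  | S3 _ _ _ _ _ => krep 3 g /\ ~ krep 2 g
  | S4 _ _ _ _ => krep 4 g /\ ~ krep 3 g
  | SN _ => ~ wrep g end.

Definition obs_ok (P : code -> Prop) (obs : seq (seq code)) := forall a b, nth2 [::] obs a b <> [::] ->
  wf (nth2 [::] obs a b) /\ ~ P (nth2 [::] obs a b).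

Section Sound.
Variables (obsw obsc obs3 : seq (seq code)).
Hypotheses (okw : obs_ok wrep obsw) (okc : obs_ok (krep 2) obsc) (ok3 : obs_ok (krep 3) obs3).

Lemma embobP P obs a b f g : obs_ok P obs ->
  (forall p g f, wf p -> wf g -> embeds p g f -> P g -> P p) ->
  wf g -> emb_obs obs a b f (mat g) -> ~ P g.
Proof.
move=> ok mono wg; rewrite /emb_obs; have := ok a b.
case: (nth2 _ _ _ _) => [//|r p] /(_ ltac:(by [])) [wp nP] /(embchkP wp wg) E Pg.
exact/nP/(mono _ _ _ wp wg E).
Qed.
Lemma mono_wrep p g f : wf p -> wf g -> embeds p g f -> wrep g -> wrep p.
Proof. exact: emb_wrep. Qed.
Lemma mono_krep k p g f : wf p -> wf g -> embeds p g f -> krep k g -> krep k p.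
Proof. by move=> wp wg E; apply: (emb_krep wp wg E). Qed.

Section Rec.
Variables (H : code) (w2 w3 : seq (seq nat)) (inw inc : bool).
Let m := mat H.
Hypotheses (wH : wf H) (iw : inw -> ~ wrep H) (ic : inc -> ~ krep 2 H).
Hypotheses (K2 : all (wchk row2 m) w2) (K3 : all (wchk row3 m) w3).

Lemma schkP s N : size N = size H ->
  chk_stat obsw obsc obs3 m inw inc (all (all id) H) (map (vecs (zv m)) w2) (map (vecs (zv m)) w3) s N ->
  stat_ok (N :: H) s.
Proof.
move=> sN; have W : wf (N :: H) by rewrite /= sN eqxx.
have mE : ext_mat (map cell_of N) m = mat (N :: H) by [].
have T := embeds_tail W.
have n1 : ~~ (if all (all id) H then all id N else false) -> ~ krep 1 (N :: H).
  by move=> h /(krep1P W) /andP[aN aH]; case/negP: h; case: ifP => // nH; rewrite -nH.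
have NC c : chk_ncert obsc inc c (mat (N :: H)) -> ~ krep 2 (N :: H).
  case: c => [/ic nH /(mono_krep wH W T)//|a b f].
  by apply: embobP => //; apply: mono_krep.
have CV k row ws i ds : rowspec k row -> all (wchk row m) ws -> size ds = k -> 0 < k ->
    row (cutv (nth [::] (map (vecs (zv m)) ws) i) ds) (map cell_of N) -> krep k (N :: H).
  move=> sp A sd k0; have [lt|ge] := ltnP i (size ws); last first.
    (* A word index out of range gives an empty list of cuts, which [rowspec] rejects because [k] is
       positive. *)
    rewrite nth_default ?size_map // => /sp[]; case: (ds) sd k0 => [<-|d ds' <-] //=.
  rewrite (nth_map [::]) //; apply: cutvP => //.
  by apply: wchkP wH sp _; apply: (elimT (all_nthP [::]) A).
case: s => [|w i j|c w i j k|a b f w|c] /=.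
- by case: ifP => // aN aH; apply/krep1P => //=; rewrite aN aH.
- case: ifP => // R nf; split; last exact: n1.
  exact: (CV 2 row2 w2 (digit_val w) [:: digit_val i; digit_val j] row2P K2 _ _ R).
- case: ifP => // R nf; split; last exact: NC nf.
  exact: (CV 3 row3 w3 (digit_val w) [:: digit_val i; digit_val j; digit_val k] row3P K3 _ _ R).
- rewrite mE; case: ifP => // R nf; split.
    exists (digits_val w); exact: (wchkP W (@rowkP 4) R).
  by apply: embobP nf => //; apply: mono_krep.
rewrite mE; case: c => [/iw nH /(mono_wrep wH W T)//|a b f].
by apply: embobP => //; apply: mono_wrep.
Qed.
End Rec.
End Sound.

(** * The minimality order and its change under adding a vertex *)

Definition gdeg g i := deg (nth [::] (mat g) i).
Definition gsum g i := sumr (nth [::] (mat g) i) (map deg (mat g)).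
Definition lower g i j := gdeg g i < gdeg g j \/ gdeg g i <= gdeg g j /\ gsum g i < gsum g j.

Lemma deg_cl N : deg (map cell_of N) = count id N.
Proof. by rewrite /deg count_map; apply: eq_count => -[]. Qed.

Lemma gdeg0 N H : gdeg (N :: H) 0 = count id N.
Proof. by rewrite /gdeg /= -deg_cl. Qed.

Lemma gdegS N H u : wf (N :: H) -> u < size H ->
  gdeg (N :: H) u.+1 = gdeg H u + nth false N u.
Proof.
case/andP => /eqP sN wH lt; rewrite /gdeg /= nth_zipc ?size_map ?size_mat //= (nth_map false) ?sN //.
by rewrite addnC; case: (nth false N u).
Qed.

Lemma map_deg_zipc N m : size N = size m ->
  map deg (zip_cells (map cell_of N) m) = [seq x.1 + nat_of_bool x.2 | x <- zip (map deg m) N].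
Proof. by elim: N m => [|b N IH] [|r m] //= [/IH->]; congr cons; case: b; rewrite /= addnC. Qed.

Lemma sumr_cl N ds : sumr (map cell_of N) [seq x.1 + nat_of_bool x.2 | x <- zip ds N] = sumr (map cell_of N) (map succn ds).
Proof. by elim: N ds => [|b N IH] [|d ds] //=; case: b; rewrite /= ?IH // addn1. Qed.

Lemma sumr_zip r ds N : sumr r [seq x.1 + nat_of_bool x.2 | x <- zip ds N] =
  sumr (take (size N) r) ds + inter (take (size ds) r) N.
Proof.
elim: r ds N => [|c r IH] [|d ds] [|b N] //=; try by case: c; rewrite ?sumr0.
by case: c; case: b => /=; rewrite IH //; lia.
Qed.

Lemma gsum0 N H : wf (N :: H) -> gsum (N :: H) 0 = sumr (map cell_of N) (map succn (map deg (mat H))).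
Proof.
by case/andP => /eqP sN wH; rewrite /gsum /= map_deg_zipc ?size_mat // sumr_cl.
Qed.

(** Each common neighbour of [u] and the new vertex has its degree raised by one, and the degree of
    the new vertex is added if it is adjacent to [u]. *)
Lemma gsumS N H u : wf (N :: H) -> u < size H ->
  gsum (N :: H) u.+1 = gsum H u + inter (nth [::] (mat H) u) N + (if nth false N u then count id N else 0).
Proof.
case/andP => /eqP sN wH lt; rewrite /gsum /= map_deg_zipc ?size_mat // nth_zipc ?size_map ?size_mat //=.
rewrite (nth_map false) ?sN // sumr_zip ?size_map ?size_mat // sN take_oversize ?size_row //.
by rewrite deg_cl; case: (nth false N u) => /=; lia.
Qed.

Fixpoint allp A (P : A -> Prop) (s : seq A) : Prop := match s with
  | [::] => True | x :: s' => P x /\ allp P s' end.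

Definition stop t := match t with Iso _ _ _ _ _ | Kept _ => true | _ => false end.
Definition iskept t := match t with Kept _ => true | _ => false end.

Definition kept_ok n (x : code * stat) := [/\ wf x.1, size x.1 = n & stat_ok x.1 x.2].

Section Sound.
Variables (obsw obsc obs3 : seq (seq code)).
Hypotheses (okw : obs_ok wrep obsw) (okc : obs_ok (krep 2) obsc) (ok3 : obs_ok (krep 3) obs3).
Variables (n : nat) (rec : digit -> digit -> digit -> hrec).
Variable KP : code -> Prop.
Hypothesis KPrec : forall a b d N, keptat (htree (rec a b d)) N -> size N <= n ->
  KP (N :: getcode n (rec a b d)).
Hypothesis KPwf : forall g, KP g -> wf g /\ size g = n.+1.

Section Rec.
Variables (H : code) (auts : seq (seq digits)) (inw inc : bool) (w2 w3 : seq (seq nat)) (T : tree).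
Let m := mat H.
Let degs := map deg m.
Let sums := map (fun row => sumr row degs) m.
Hypotheses (wH : wf H) (sH : size H = n) (iw : inw -> ~ wrep H) (ic : inc -> ~ krep 2 H).
Hypotheses (K2 : all (wchk row2 m) w2) (K3 : all (wchk row3 m) w3).
Hypothesis Ka : all (all (fun s => embchk H (digits_val s) m)) auts.

Let check := chk obsw obsc obs3 n rec m degs sums auts inw inc (all (all id) H)
  (map (vecs (zv m)) w2) (map (vecs (zv m)) w3) T.

(** What a leaf asserts about the extension by a complete neighbourhood [N]. The predicate [KP] is
    later instantiated with membership in the list of kept graphs. *)
Definition leaf_ok (t : tree) (N : seq bool) : Prop := match t with
  | Node _ _ => False
  | Prune _ | Wit _ => exists2 u, u < n & lower (N :: H) u.+1 0
  | Aut a b => exists2 f, embeds H H f & stop (look T (rev (map (nth false N) f)))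
  | Iso _ _ _ _ _ => exists f g, KP g /\ embeds g (N :: H) f
  | Kept s => stat_ok (N :: H) s
  end.

(** [take] could return fewer bits than wanted. A [Kept] leaf passes the check only at full depth,
    and this forces the length. *)
Lemma keptat_size t ds N dn c S bs : check t ds N dn c S -> iskept (look t bs) -> size ds <= size bs.
Proof.
elim: t ds N dn c S bs => [a IHa b IHb|j|u|a b|a b d N' f|s] ds N dn c S bs /=; try by case: bs.
  case: ds => // d ds; case: ifP => // Ca Cb; case: bs => [|[] bs] //=; rewrite ltnS.
    exact: IHb Cb.
  exact: IHa Ca.
by case: ds.
Qed.

(** [N] and [dn] belong to the decided, older vertices, while [pre] is an arbitrary choice for the
    younger ones; the four equations are the invariant of the accumulators of [chk]. *)
Lemma chk_leaf t ds N dn c S pre : check t ds N dn c S ->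
  degs = catrev ds dn -> size N = size dn -> c = count id N -> S = sumr (map cell_of N) (map succn dn) ->
  size pre = size ds -> leaf_ok (look t (rev pre)) (pre ++ N).
Proof.
elim: t ds N dn c S pre => [a IHa b IHb|j|u|a b|a b d N' f|s] ds N dn c S pre; rewrite /check /= => + Ed sN Ec ES.
- case: ds Ed => // d ds Ed; case: ifP => // Ca Cb; case/lastP: pre => // pre x; rewrite size_rcons => -[sp].
  rewrite rev_rcons /= cat_rcons; case: x.
    by apply: IHb Cb _ _ _ _ _; rewrite //= ?sN ?Ec ?ES //= add1n.
  by apply: IHa Ca _ _ _ _ _; rewrite //= ?sN ?Ec ?ES //= add1n.
- move=> C sp.
  have {}C : leaf_ok (Prune j) (pre ++ N).
    rewrite /= catrevE in Ed.
    have sd : size degs = n by rewrite size_map size_mat.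
    have sE : size (pre ++ N) = size H by rewrite size_cat sp sN sH -sd Ed size_cat size_rev.
    have W : wf ((pre ++ N) :: H) by rewrite /= sE eqxx.
    (* The default [c] in the test makes an index out of range fail. *)
    have lj : digit_val j < size dn by rewrite ltnNge; apply/negP => le; move: C; rewrite nth_default //; lia.
    have lu : size ds + digit_val j < n by rewrite -sd Ed size_cat size_rev ltn_add2l.
    exists (size ds + digit_val j) => //; left; rewrite gdeg0 gdegS ?sH //.
    have -> : gdeg H (size ds + digit_val j) = nth c dn (digit_val j).
      rewrite /gdeg -(nth_map [::] c) ?size_mat ?sH // -/degs Ed nth_cat size_rev.
      by rewrite ltnNge leq_addr /= addKn.
    rewrite nth_cat sp [_ + _ < size ds]ltnNge leq_addr /= addKn.
    (* The degree of vertex [j] is already final, while that of the new vertex can only grow with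
       the remaining bits. *)
    by apply: leq_trans C _; rewrite count_cat Ec leq_addl.
  by case: (rev pre).
- case: ds Ed => // Ed C /size0nil ->; rewrite /= in Ed *.
  have sd : size degs = n by rewrite size_map size_mat.
  have sE : size N = size H by rewrite sN -Ed sd.
  have W : wf (N :: H) by rewrite /= sE eqxx.
  move: C; case: ifP => // C1 C2.
  (* Here the default [c.+1] excludes an index out of range. *)
  have lu : digit_val u < n.
    by rewrite ltnNge; apply/negP => le; move: C1; rewrite nth_default ?sd //; lia.
  exists (digit_val u) => //; right; rewrite gdeg0 gdegS ?sH // gsum0 // gsumS ?sH //.
  have e1 : nth c.+1 degs (digit_val u) = gdeg H (digit_val u) by rewrite /gdeg -(nth_map [::] c.+1) ?size_mat ?sH.
  have e2 : nth 0 sums (digit_val u) = gsum H (digit_val u) by rewrite (nth_map [::]) ?size_mat ?sH.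
  by rewrite -/m -/degs Ed -ES -Ec -e1 -e2.
- case: ds Ed => // Ed + /size0nil ->; rewrite /= in Ed *; rewrite /nth2.
  case E: (nth _ _ _) => [//|x l] C.
  exists (digits_val (DC x l)); last exact: C.
  have sd : size degs = n by rewrite size_map size_mat.
  have sE : size N = size H by rewrite sN -Ed sd.
  apply: embchkP => //; rewrite -E.
  have la : digit_val a < size auts.
    by rewrite ltnNge; apply/negP => le; move: E; rewrite [nth [::] _ _]nth_default // nth_nil.
  have lb : digit_val b < size (nth [::] auts (digit_val a)).
    by rewrite ltnNge; apply/negP => le; move: E; rewrite nth_default.
  exact: (all_nthP DN (all_nthP [::] Ka _ la) _ lb).
- case: ds Ed => // Ed + /size0nil ->; rewrite /= in Ed *.
  have sd : size degs = n by rewrite size_map size_mat.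
  have sE : size N = size H by rewrite sN -Ed sd.
  case: ifP => // Kr E.
  exists (digits_val f), (take n (bits N') :: getcode n (rec a b d)).
  have KG : KP (take n (bits N') :: getcode n (rec a b d)).
    by apply: KPrec Kr _; rewrite size_take_min geq_minl.
  split=> //; have W : wf (N :: H) by rewrite /= sE eqxx.
  by have [WK _] := KPwf KG; apply: (embchkP WK W E).
case: ds Ed => // Ed + /size0nil ->; rewrite /= in Ed *.
have sd : size degs = n by rewrite size_map size_mat.
have sE : size N = size H by rewrite sN -Ed sd.
exact: schkP.
Qed.

End Rec.

Lemma keptl_acc H t N acc x : x \in map fst acc -> x \in map fst (keptl H t N acc).
Proof.
by elim: t N acc => //= [a IHa b IHb|s] N acc xa; [apply/IHa/IHb | rewrite inE xa orbT].
Qed.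

Section Keptl.
Variables (H : code) (auts : seq (seq digits)) (inw inc : bool) (w2 w3 : seq (seq nat)) (T : tree).
Variables (m : seq (seq cell)) (degs sums : seq nat) (full : bool) (v2 v3 : seq (seq (seq nat))).
Let check := chk obsw obsc obs3 n rec m degs sums auts inw inc full v2 v3 T.

Lemma keptl_mem t ds N dn c S acc pre : check t ds N dn c S -> size pre = size ds ->
  iskept (look t (rev pre)) -> (pre ++ N) :: H \in map fst (keptl H t N acc).
Proof.
elim: t ds N dn c S acc pre => [a IHa b IHb|j|u|a b|a b d N' f|s] ds N dn c S acc pre; rewrite /check /=; try by case: (rev pre).
  case: ds => // d ds; case: ifP => // Ca Cb; case/lastP: pre => // pre x; rewrite size_rcons => -[sp].
  rewrite rev_rcons /= cat_rcons; case: x => K.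
    by apply/keptl_acc/(IHb _ _ _ _ _ _ _ Cb).
  by apply: (IHa _ _ _ _ _ _ _ Ca).
by case: ds => // _ /size0nil ->; rewrite inE eqxx.
Qed.

Lemma keptl_all P t ds N dn c S acc : check t ds N dn c S -> allp P acc ->
  (forall pre s, size pre = size ds -> look t (rev pre) = Kept s -> P ((pre ++ N) :: H, s)) ->
  allp P (keptl H t N acc).
Proof.
elim: t ds N dn c S acc => [a IHa b IHb|j|u|a b|a b d N' f|s] ds N dn c S acc; rewrite /check //=.
  case: ds => // d ds; case: ifP => // Ca Cb Pa Q.
  apply: IHa Ca _ _ => [|pre s sp E].
    apply: IHb Cb _ _ => // pre s sp E; rewrite -cat_rcons; apply: Q; first by rewrite size_rcons sp.
    by rewrite rev_rcons.
  rewrite -cat_rcons; apply: Q; first by rewrite size_rcons sp.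
  by rewrite rev_rcons.
by case: ds => // _ Pa Q; split=> //; apply: (Q [::]).
Qed.
End Keptl.
End Sound.

Lemma allp_nth A (P : A -> Prop) x0 s i : P x0 -> allp P s -> P (nth x0 s i).
Proof. by move=> P0; elim: s i => [|x s IH] [|i] //= [Px Ps] //; apply: IH. Qed.
Lemma allp_cat A (P : A -> Prop) s1 s2 : allp P (s1 ++ s2) <-> allp P s1 /\ allp P s2.
Proof. by elim: s1 => //= [|x s1 ->]; tauto. Qed.
Lemma allp_flatten A (P : A -> Prop) ss : allp P (flatten ss) <-> allp (allp P) ss.
Proof. by elim: ss => //= s ss IH; rewrite allp_cat; tauto. Qed.
Lemma allp_all A (p : pred A) s : all p s <-> allp p s.
Proof. by elim: s => //= x s <-; split=> /andP. Qed.
Lemma allp_impl A (P Q : A -> Prop) s : (forall x, P x -> Q x) -> allp P s -> allp Q s.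
Proof. by move=> PQ; elim: s => //= x s IH [/PQ Qx /IH]. Qed.
Lemma allp_and A (P Q : A -> Prop) s : allp P s -> allp Q s -> allp (fun x => P x /\ Q x) s.
Proof. by elim: s => //= x s IH [Px Ps] [Qx Qs]; split=> //; apply: IH. Qed.

Section Level.
Variables (obsw obsc obs3 : seq (seq code)).
Hypotheses (okw : obs_ok wrep obsw) (okc : obs_ok (krep 2) obsc) (ok3 : obs_ok (krep 3) obs3).
Variables (n : nat) (rs : seq (seq (seq hrec))).
Definition recs_at := fun a b d => nth norec (nth [::] (nth [::] rs (digit_val a)) (digit_val b)) (digit_val d).
Let L := flatten (flatten rs).
Let K := kept n rs.
Hypothesis ck : all (all (all (chkrec obsw obsc obs3 n recs_at))) rs.
Definition good_code g := wf g && (size g == n).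
Hypothesis gL : all good_code (map (getcode n) L).

Let recok r := chkrec obsw obsc obs3 n recs_at r /\ wf (getcode n r) /\ size (getcode n r) = n.
Lemma recokL : allp recok L.
Proof.
apply: allp_and.
  rewrite /L !allp_flatten; apply: allp_impl ((allp_all _ _).1 ck) => s /allp_all.
  by apply: allp_impl => {}s /allp_all.
by move: gL; rewrite all_map allp_all; apply: allp_impl => r /= /andP[-> /eqP].
Qed.

(** Indices outside the table yield [norec], whose tree is a single [Prune] and hence keeps
    nothing. *)
Lemma recs_atP (P : hrec -> Prop) : P norec -> allp P L -> forall a b d, P (recs_at a b d).
Proof.
rewrite /L !allp_flatten => P0 PL a b d; apply: allp_nth => //.
by apply: (@allp_nth _ (allp P)) => //; apply: (@allp_nth _ (allp (allp P))).
Qed.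

Lemma chkrec_chk r : recok r -> let H := getcode n r in let m := mat H in
  exists w2 w3, [/\ isC (hnw r) -> ~ wrep H, isC (hnc r) -> ~ krep 2 H,
    all (wchk row2 m) w2, all (wchk row3 m) w3 & all (all (fun s => embchk H (digits_val s) m)) (hauts r) /\
    let degs := map deg m in
    chk obsw obsc obs3 n recs_at m degs (map (fun row => sumr row degs) m) (hauts r) (isC (hnw r)) (isC (hnc r))
      (all (all id) H) (map (vecs (zv m)) w2) (map (vecs (zv m)) w3) (htree r) (htree r) (rev degs) [::] [::] 0 0].
Proof.
case=> + [wH _] H m; rewrite /chkrec -/H -/m.
case: ifP => // Ka; case: ifP => // Ow; case: ifP => // Oc; case: ifP => // K2; case: ifP => // K3 C.
exists (map digits_val (hw2 r)), (map digits_val (hw3 r)); split=> //.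
- case: (hnw r) Ow => // a b f E _; apply: embobP E => //; exact: mono_wrep.
- case: (hnc r) Oc => // a b f E _; apply: embobP E => //; exact: mono_krep.
Qed.

Lemma kept_mem : allp (fun r => forall N, keptat (htree r) N -> size N <= n ->
  [/\ N :: getcode n r \in map fst K, wf (N :: getcode n r) & size (N :: getcode n r) = n.+1]) L.
Proof.
rewrite /K /kept -/L; elim: L recokL => //= r L' IH [ok okL]; split=> [N kN sN|]; last first.
  apply: allp_impl (IH okL) => r' H N kN sN; have [i w s] := H N kN sN.
  by split=> //; apply: keptl_acc.
have [w2 [w3 [_ _ _ _ [_ C]]]] := chkrec_chk ok.
case: ok => _ [wH sH].
have {}kN : iskept (look (htree r) (rev N)) by move: kN; rewrite /keptat; case: (look _ _).
have sN' : size N = n.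
  apply/eqP; rewrite eqn_leq sN /=; have := keptat_size C kN.
  by rewrite !size_rev size_map size_mat // sH.
split; last by rewrite /= sH.
  rewrite -[N]cats0; apply: keptl_mem C _ kN.
  by rewrite size_rev size_map size_mat ?sH.
by rewrite /= sN' sH eqxx.
Qed.

Definition inK g := [/\ g \in map fst K, wf g & size g = n.+1].
Lemma inK_rec a b d N : keptat (htree (recs_at a b d)) N -> size N <= n -> inK (N :: getcode n (recs_at a b d)).
Proof.
move: N; pattern (recs_at a b d); apply: recs_atP; last exact: kept_mem.
by move=> N; rewrite /keptat /=; case: (rev N).
Qed.

Lemma level_leaf : allp (fun r => wf (getcode n r) /\ (size (getcode n r) = n /\ forall N, size N = n ->
  leaf_ok n inK (getcode n r) (htree r) (look (htree r) (rev N)) N)) L.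
Proof.
apply: allp_impl recokL => r ok; have [w2 [w3 [iw ic K2 K3 [Ka C]]]] := chkrec_chk ok.
case: (ok) => _ [wH sH]; split=> //; split=> // N sN; rewrite -{2}[N]cats0.
apply: (chk_leaf okw okc ok3 inK_rec _ wH sH iw ic K2 K3 Ka C) => //.
- by move=> g [].
- by rewrite catrevE revK cats0.
by rewrite size_rev size_map size_mat ?sH.
Qed.

Lemma level_kept : allp (kept_ok n.+1) K.
Proof.
rewrite /K /kept -/L; elim: L recokL level_leaf => //= r L' IH [ok okL] [[wH [sH lr]] lL].
have [w2 [w3 [_ _ _ _ [_ C]]]] := chkrec_chk ok.
apply: keptl_all C _ _; first exact: IH.
move=> N s sN E; have sN' : size N = n by rewrite sN size_rev size_map size_mat.
have := lr N sN'; rewrite E cats0 => Hs; split=> //=; last by rewrite sH.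
by rewrite sN' sH eqxx.
Qed.
End Level.

(** * Every graph is isomorphic to a kept one *)

Lemma seq_argmin (T : eqType) (f : T -> nat) (s : seq T) : s != [::] ->
  exists2 v, v \in s & forall u, u \in s -> f v <= f u.
Proof.
elim: s => // x [|y s] IH _; first by exists x; rewrite ?mem_head // => u; rewrite inE => /eqP->.
have [//|v vs Hv] := IH; have [le|/ltnW ge] := leqP (f x) (f v).
  exists x; rewrite ?mem_head // => u; rewrite inE => /predU1P[->//|/Hv]; exact: leq_trans.
exists v; first by rewrite inE vs orbT.
by move=> u; rewrite inE => /predU1P[->//|/Hv].
Qed.

Section Models.
Variables (T : eqType) (x0 : T) (e : rel T).
Hypotheses (eS : symmetric e) (eI : irreflexive e).

Definition models s g := size s = size g /\
  forall i j, i < size g -> j < size g -> e (nth x0 s i) (nth x0 s j) = cadj g i j.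

Lemma models_cons v s H : wf H -> models s H -> models (v :: s) (map (e v) s :: H).
Proof.
move=> wH [sz M]; have W : wf (map (e v) s :: H) by rewrite /= size_map sz eqxx.
split=> /=; first by rewrite sz.
move=> [|i] [|j] li lj /=; rewrite ?eI ?adjSS ?adj0S ?adjS0 ?(nth_map x0) ?sz ?M //.
Qed.

Lemma models_emb s p g f : embeds p g f -> models s g -> models (map (nth x0 s) f) p.
Proof.
move=> E [sz M]; have [sf [lf _]] := E; split; first by rewrite size_map.
by move=> i j li lj; rewrite !(nth_map 0) ?sf // (emb_adj E) // M ?lf.
Qed.

(** An embedding is injective, hence bijective between graphs of equal size. *)
Lemma perm_emb s p g f : wf p -> wf g -> embeds p g f -> size p = size g -> size s = size g ->
  perm_eq (map (nth x0 s) f) s.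
Proof.
move=> wp wg E sz sg; have [sf [lf _]] := E; have U := emb_uniq wp wg E.
rewrite -[X in perm_eq _ X](mkseq_nth x0) /mkseq; apply: perm_map.
have S : {subset f <= iota 0 (size s)}.
  by move=> x /(nthP 0)[i li <-]; rewrite mem_iota add0n sg lf -?sf.
have [|_ E'] := uniq_min_size U S; first by rewrite size_iota sg sf sz.
exact: uniq_perm (iota_uniq _ _) E'.
Qed.

Definition mdeg A x := count (e x) A.
Definition msum A x := \sum_(y <- A | e x y) mdeg A y.

Lemma sumrE row ds : size row = size ds ->
  sumr row ds = \sum_(0 <= j < size row | isadj (nth Self row j)) nth 0 ds j.
Proof.
elim: row ds => [|c r IH] [|d ds] //=; first by rewrite big_nil.
move=> [/IH->].
by rewrite [RHS]big_ltn_cond //=; case: c => /=; rewrite big_add1.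
Qed.

Lemma models_gdeg s g A i : wf g -> models s g -> perm_eq s A -> i < size g ->
  gdeg g i = mdeg A (nth x0 s i).
Proof.
move=> wg [sz M] /seq.permP PA li; rewrite /mdeg -PA /gdeg /deg.
rewrite -[X in count isadj X](mkseq_nth Self) -[X in _ = count _ X](mkseq_nth x0) !count_map size_row // sz.
by apply: eq_in_count => j; rewrite mem_iota => /= lj; rewrite M.
Qed.

Lemma models_gsum s g A i : wf g -> models s g -> perm_eq s A -> i < size g ->
  gsum g i = msum A (nth x0 s i).
Proof.
move=> wg Mo PA li; have [sz M] := Mo.
rewrite /msum -(perm_big _ PA) /= (big_nth x0) /gsum sumrE ?size_map ?size_mat ?size_row // sz.
rewrite big_nat_cond [RHS]big_nat_cond; apply: eq_big => [j|j].
  by case: ltnP => //= lj; rewrite M.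
case/andP => /andP[_ lj] _; rewrite (nth_map [::]) ?size_mat // -[deg _]/(gdeg g j).
exact: models_gdeg.
Qed.

(** The statement concerns all vertex sets of size [n] inside one ambient graph, so the induction
    can delete a vertex without changing the type or the relation. *)
Definition covers n (gs : seq code) := forall A, uniq A -> size A = n ->
  exists g s, [/\ g \in gs, perm_eq s A & models s g].

Lemma covers0 : covers 0 [:: [::]].
Proof. by move=> A _ /size0nil ->; exists [::], [::]; split. Qed.

Section Step.
Variables (obsw obsc obs3 : seq (seq code)).
Hypotheses (okw : obs_ok wrep obsw) (okc : obs_ok (krep 2) obsc) (ok3 : obs_ok (krep 3) obs3).
Variables (n : nat) (rs : seq (seq (seq hrec))).
Hypothesis ck : all (all (all (chkrec obsw obsc obs3 n (recs_at rs)))) rs.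
Hypothesis gL : all (good_code n) (map (getcode n) (flatten (flatten rs))).
Hypothesis cov : covers n (map (getcode n) (flatten (flatten rs))).

Lemma allp_map_in A (P : A -> Prop) (f : A -> code) s x : allp P s -> x \in map f s ->
  exists2 r, P r & f r = x.
Proof.
by elim: s => //= y s IH [Py Ps]; rewrite inE => /predU1P[->|/(IH Ps)//]; exists y.
Qed.

Lemma covers_step : covers n.+1 (map fst (kept n rs)).
Proof.
move=> A uA sA; have A0 : A != [::] by case: (A) sA.
have [v1 v1A min1] := seq_argmin (mdeg A) A0.
have F0 : [seq x <- A | mdeg A x == mdeg A v1] != [::].
  by rewrite -has_filter; apply/hasP; exists v1.
have [v] := seq_argmin (msum A) F0; rewrite mem_filter => /andP[/eqP dv vA] min2.
have nolow u : u \in A -> ~ (mdeg A u < mdeg A v \/ mdeg A u <= mdeg A v /\ msum A u < msum A v).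
  move=> uA'; rewrite dv => -[|[le]]; first by rewrite ltnNge min1.
  by rewrite ltnNge min2 // mem_filter uA' andbT eqn_leq le min1.
have [H [s [HL ps Ms]]] : exists g s, [/\ g \in map (getcode n) (flatten (flatten rs)), perm_eq s (rem v A) & models s g].
  by apply: cov; rewrite ?rem_uniq // size_rem // sA.
have pA s1 : perm_eq s1 (rem v A) -> perm_eq (v :: s1) A.
  by move=> p1; apply: perm_trans (_ : perm_eq (v :: rem v A) A); rewrite ?perm_cons // perm_sym perm_to_rem.
have [r [[wH [sH lf]] km] Er] := allp_map_in (allp_and (level_leaf okw okc ok3 ck gL) (kept_mem okw okc ck gL)) HL.
rewrite Er in wH sH lf km.
pose K := map fst (kept n rs).
have lf' s1 : perm_eq s1 (rem v A) -> models s1 H ->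
   leaf_ok n (inK n rs) H (htree r) (look (htree r) (rev (map (e v) s1))) (map (e v) s1).
  by move=> p1 [sz _]; apply: lf; rewrite size_map sz.
(* The claim is made for every labelling [s1] of the remaining vertices: at an [Aut] leaf it is
   applied after relabelling by the automorphism, where [stop] excludes a further [Aut] leaf. *)
have fin s1 : perm_eq s1 (rem v A) -> models s1 H -> stop (look (htree r) (rev (map (e v) s1))) ->
   exists g s, [/\ g \in K, perm_eq s A & models s g].
  move=> p1 M1; have := lf' s1 p1 M1; have Mv := models_cons v wH M1.
  have W : wf (map (e v) s1 :: H) by rewrite /= size_map M1.1 eqxx.
  case E: (look _ _) => [a b|j|u|a b|a b d N f0|st] //=.
    case=> f [g [[gK wg sg] Em]] _.
    exists g, (map (nth x0 (v :: s1)) f); split=> //; last exact: models_emb Em Mv.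
    apply: perm_trans (pA _ p1); apply: perm_emb Em _ _ => //; last by rewrite /= M1.1.
    by rewrite sg /= sH.
  move=> _ _; exists (map (e v) s1 :: H), (v :: s1); split=> //; last exact: pA.
  have [//||] := km (map (e v) s1); last by [].
    by rewrite /keptat E.
  by rewrite size_map M1.1 sH.
have := lf' s ps Ms; have Mv := models_cons v wH Ms.
have W : wf (map (e v) s :: H) by rewrite /= size_map Ms.1 eqxx.
have low u : u < n -> ~ lower (map (e v) s :: H) u.+1 0.
  move=> lu; have lu' : u.+1 < size (map (e v) s :: H) by rewrite /= sH.
  rewrite /lower !(models_gdeg W Mv (pA _ ps)) // !(models_gsum W Mv (pA _ ps)) //=; apply: nolow.
  by rewrite -(perm_mem (pA _ ps)) inE mem_nth ?orbT // Ms.1 sH.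
case E: (look _ _) => [a b|j|j|a b|a b d N' f|s1] //.
- by case=> u lu /(low u lu).
- by case=> u lu /(low u lu).
- case=> f Ef st; have pf := perm_emb wH wH Ef (erefl _) Ms.1.
  apply: (fin (map (nth x0 s) f)).
  + exact: perm_trans pf ps.
  + exact: models_emb Ef Ms.
  congr (stop (look _ (rev _))): st; rewrite -map_comp; apply/eq_in_map => x /(nthP 0)[i li <-] /=.
  have [sf [lff _]] := Ef; rewrite (nth_map x0) // Ms.1; apply: lff; by rewrite -sf.
- by move=> _; apply: (fin s) => //; rewrite E.
- by move=> _; apply: (fin s) => //; rewrite E.
Qed.
End Step.
End Models.

(** * Exhaustive search for uniform words *)

Definition res (w : seq nat) := [seq x.-1 | x <- w & x != 0].
Fixpoint gaps c (w : seq nat) : seq nat := match w with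
  | [::] => [::] | 0 :: w' => c :: gaps 0 w' | x.+1 :: w' => gaps c.+1 w' end.
Fixpoint okds (w ds : seq nat) : bool := match ds with
  | [::] => true | d :: ds' => (d <= size w) && okds (drop d w) ds' end.

(** Every word arises from its restriction by inserting the letter 0. The list [s] holds the letters
    read since the last 0, which [gaps] counts in its accumulator. *)
Lemma insw_gaps s w : insw (s ++ res w) (gaps (size s) w) = map succn s ++ w /\
  okds (s ++ res w) (gaps (size s) w).
Proof.
elim: w s => [|x w IH] s.
  by rewrite /= !cats0.
case: x => [|x] /=.
  rewrite take_size_cat // drop_size_cat // size_cat leq_addr /=.
  by have [] := IH [::]; rewrite /= /res => -> ->.
rewrite -/(res w) -cat_rcons; have := IH (rcons s x).
by rewrite size_rcons map_rcons cat_rcons => -[-> ->].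
Qed.
Lemma insw_res w : insw (res w) (gaps 0 w) = w.
Proof. by have [] := insw_gaps [::] w. Qed.
Lemma okds_res w : okds (res w) (gaps 0 w).
Proof. by have [] := insw_gaps [::] w. Qed.
Lemma size_gaps w : size (gaps 0 w) = count_mem 0 w.
Proof. by rewrite -[in RHS](insw_res w) count_insw0. Qed.

Lemma kword_res k N H w : wf (N :: H) -> kword k (N :: H) w -> kword k H (res w).
Proof.
move=> W [cw Rw]; split=> [i li|i j li lj ij].
  by rewrite -(cw i.+1) // -[in RHS](insw_res w) count_inswS.
by rewrite -(adjSS _ W) // -Rw // -[in RHS](insw_res w) alt_inswS.
Qed.

Fixpoint inc p (cs : seq nat) : bool := match cs with [::] => true | c :: cs' => (c == p.+1) && inc c cs' end.
Lemma iota_inc p cs : (cs == iota p.+1 (size cs)) = inc p cs.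
Proof.
elim: cs p => //= c cs IH p; rewrite eqseq_cons; case: eqP => //= ->; exact: IH.
Qed.
Lemma altinc k cs : size cs = k.+1 -> (cs == iota 0 k.+1) || (cs == iota 1 k.+1) =
  (head 0 cs <= 1) && inc (head 0 cs) (behead cs).
Proof.
case: cs => //= c cs [<-]; rewrite !eqseq_cons.
case: c => [|[|c]] //=; rewrite ?orbF iota_inc //.
Qed.

Lemma eqbsE s t : eqbs s t = (s == t).
Proof. by elim: s t => [|x s IH] [|y t] //=; rewrite eqseq_cons -IH eqbE; case: eqP. Qed.

Lemma nbr2_notover N p v : (forall u, u < size N -> nth false N u -> nth 0 v u <= (nth 0 p u).+1) ->
  size v = size N -> size p = size N -> nbr2 N p v <> Over.
Proof.
elim: N p v => [|b N IH] [|y p] [|x v] //= H [sv] [sp].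
have I : nbr2 N p v <> Over by apply: IH => // u; apply: (H u.+1).
case: b H => // H; case: leqP => // lt; rewrite eqnE; case: eqP => // ne.
by have := H 0 isT isT; rewrite /=; lia.
Qed.
Lemma nbr2_fit N p v : (forall u, u < size N -> nth false N u -> nth 0 v u = (nth 0 p u).+1) ->
  size v = size N -> size p = size N -> nbr2 N p v = Fit.
Proof.
elim: N p v => [|b N IH] [|y p] [|x v] //= H [sv] [sp].
have I : nbr2 N p v = Fit by apply: IH => // u; apply: (H u.+1).
by case: b H => // H; have /= -> := H 0 isT isT; rewrite ltnn eqnE eqxx.
Qed.
Lemma nbr1_ok N v : (forall u, u < size N -> nth false N u -> nth 0 v u <= 1) -> size v = size N -> nbr1 N v.
Proof.
elim: N v => [|b N IH] [|x v] //= H [sv].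
have I : nbr1 N v by apply: IH => // u; apply: (H u.+1).
by case: b H => // H; have := H 0 isT isT; case: x H => [|[|]].
Qed.

Lemma size_incs p v al n : size p = n -> size v = n -> size al = n -> size (incs p v al) = n.
Proof. by elim: n p v al => [|n IH] [|x p] [|y v] [|b al] //= [?] [?] [?]; rewrite IH. Qed.
Lemma nth_incs p v al n u : size p = n -> size v = n -> size al = n -> u < n ->
  nth false (incs p v al) u = nth false al u && (nth 0 v u == (nth 0 p u).+1).
Proof.
elim: n p v al u => [|n IH] [|x p] [|y v] [|b al] //= [|u] [?] [?] [?] lt /=.
  by rewrite eqnE; case: b.
exact: IH.
Qed.

Lemma mem_map_cons (A : eqType) (x : A) s ss : s \in ss -> x :: s \in map (cons x) ss.
Proof. by move=> h; apply/mapP; exists s. Qed.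

Lemma vecs_insw_nil c v w : vecs (c :: v) (insw w [::]) = map (cons c) (vecs v w).
Proof. by elim: w v => //= x w IH v; rewrite IH. Qed.
Lemma vecs_insw_0 c v w ds : vecs (c :: v) (insw w (0 :: ds)) = (c :: v) :: vecs (c.+1 :: v) (insw w ds).
Proof. by rewrite /= take0 drop0. Qed.
Lemma vecs_insw_S c v x w d ds : vecs (c :: v) (insw (x :: w) (d.+1 :: ds)) =
  (c :: v) :: vecs (c :: incr_nth v x) (insw w (d :: ds)).
Proof. by []. Qed.

Section SearchSound.
Variables (N : seq bool).
Let n := size N.

Lemma size_incr (v : seq nat) x : size v = n -> x < n -> size (incr_nth v x) = n.
Proof. by move=> sv lx; rewrite size_incr_nth sv lx. Qed.

(** Adjacency to the new letter splits into the flags collected in [al] and the condition that the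
    remaining cuts go up by one from the last count in [p]. For a neighbour the next cut cannot
    exceed that count by more than one, so the search is never cut off before the right place. The
    outer induction is on the insertions left, the inner one on the remaining word. *)
Lemma insn_complete r c p al v w ds :
  size p = n -> size v = n -> size al = n -> all (gtn n) w ->
  size ds = r -> okds w ds ->
  (forall u, u < n -> nth false N u = nth false al u && inc (nth 0 p u) (cuts (nth 0 v u) u w ds)) ->
  vecs (c :: v) (insw w ds) \in insn N r c p al (vecs v w).
Proof.
elim: r c p al v w ds => [|r IHr] c p al v w ds sp sv sal aw.
  case: ds => // _ _ H; rewrite /= eqbsE.
  have -> : al == N.
    by apply/eqP/(@eq_from_nth _ false) => [//|u]; rewrite sal => lu; rewrite H //= andbT.
  by rewrite inE vecs_insw_nil.
case: ds => // d ds [sd].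
elim: w v d sv aw => [|x w IHw] v d sv aw.
  rewrite /= => /andP[_ ok] H.
  rewrite (nbr2_fit (p := p) (v := v)) //; last first.
    move=> u lu Nu; move: (H u lu); rewrite Nu /= addn0 => /esym/andP[_ /andP[/eqP-> _]] //.
  apply: mem_map_cons; rewrite mem_cat; apply/orP; left.
  apply: IHr => // [|u lu]; first exact: size_incs.
  by rewrite H // (nth_incs sp sv sal lu) /= addn0 andbA.
have nO d' : (forall u, u < n -> nth false N u =
    nth false al u && inc (nth 0 p u) (cuts (nth 0 v u) u (x :: w) (d' :: ds))) -> nbr2 N p v <> Over.
  move=> H; apply: nbr2_notover => // u lu Nu.
  move: (H u lu); rewrite Nu /= => /esym/andP[_ /andP[/eqP<- _]]; exact: leq_addr.
case: d => [|d] ok H.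
  have F : nbr2 N p v = Fit.
    apply: nbr2_fit => // u lu Nu.
    by move: (H u lu); rewrite Nu /= addn0 => /esym/andP[_ /andP[/eqP-> _]].
  rewrite vecs_insw_0 [vecs v _]/= /= F.
  apply: mem_map_cons; rewrite mem_cat; apply/orP; left.
  rewrite -[_ :: vecs _ w]/(vecs v (x :: w)).
  apply: IHr => // [|u lu]; first exact: size_incs.
  by rewrite H // (nth_incs sp sv sal lu) /= addn0 andbA.
rewrite vecs_insw_S.
have lx : x < n by case/andP: aw.
have R : vecs (c :: incr_nth v x) (insw w (d :: ds)) \in insn N r.+1 c p al (vecs (incr_nth v x) w).
  apply: IHw; [exact: size_incr | by case/andP: aw | exact: ok |].
  move=> u lu; rewrite H // /= nth_incr_nth /=.
  by rewrite addnCA addnA.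
have := nO _ H; rewrite /=; case: (nbr2 N p v) => // _.
  by apply: mem_map_cons; rewrite mem_cat; apply/orP; right.
exact: mem_map_cons.
Qed.

Lemma ins1st_complete k v w ds :
  size v = n -> all (gtn n) w -> size ds = k.+1 -> okds w ds ->
  (forall u, u < n -> nth false N u = let cs := cuts (nth 0 v u) u w ds in
    (head 0 cs <= 1) && inc (head 0 cs) (behead cs)) ->
  vecs (0 :: v) (insw w ds) \in ins1st N k (vecs v w).
Proof.
case: ds => // d ds + + [sd].
elim: w v d => [|x w IHw] v d sv aw.
  rewrite /= => /andP[_ ok] H.
  rewrite nbr1_ok //; last by move=> u lu Nu; move: (H u lu); rewrite Nu addn0 => /esym/andP[].
  apply: mem_map_cons; rewrite mem_cat; apply/orP; left.
  apply: insn_complete => //; rewrite ?size_map // => u lu.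
  by rewrite H // addn0 (nth_map 0) ?sv.
have nO d' : (forall u, u < n -> nth false N u = let cs := cuts (nth 0 v u) u (x :: w) (d' :: ds) in
    (head 0 cs <= 1) && inc (head 0 cs) (behead cs)) -> nbr1 N v.
  move=> H; apply: nbr1_ok => // u lu Nu.
  move: (H u lu); rewrite Nu /= => /esym/andP[le _]; exact: leq_trans (leq_addr _ _) le.
case: d => [|d] ok H; rewrite /= (nO _ H).
  apply: mem_map_cons; rewrite mem_cat; apply/orP; left.
  rewrite -[_ :: vecs _ w]/(vecs v (x :: w)).
  apply: (@insn_complete k 1 v _ v (x :: w) ds) => //; rewrite ?size_map // => u lu.
  by rewrite H // /= addn0 (nth_map 0) ?sv.
rewrite -/(insw w (d :: ds)).
have lx : x < n by case/andP: aw.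
apply: mem_map_cons; rewrite mem_cat; apply/orP; right.
apply: (IHw (incr_nth v x) d); [exact: size_incr | by case/andP: aw | exact: ok |].
move=> u lu; rewrite H // /= nth_incr_nth /=.
by rewrite addnCA addnA.
Qed.
End SearchSound.

Definition inrange n (w : seq nat) := all (gtn n) w.
Lemma inrange_res n w : inrange n.+1 w -> inrange n (res w).
Proof.
move/allP => A; apply/allP => x /mapP[y]; rewrite mem_filter => /andP[y0 /A] /= ly ->.
by case: y y0 ly.
Qed.

Lemma head_res x w : head 0 w = x.+1 -> head 0 (res w) = x /\ res w != [::].
Proof. by case: w => //= y w ->. Qed.

Lemma gaps_ge c w d ds : gaps c w = d :: ds -> c <= d.
Proof.
elim: w c => //= x w IH c; case: x => [[->]//|x /IH]; exact: ltnW.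
Qed.

Lemma wf_catrev rows G : wf (catrev rows G) -> wf G.
Proof. by elim: rows G => // M rows IH G /= /IH /andP[]. Qed.

Lemma iter_res k rows G w : wf (catrev rows G) -> kword k (catrev rows G) w ->
  inrange (size (catrev rows G)) w -> size rows <= head 0 w -> w != [::] ->
  let u := iter (size rows) res w in
  [/\ kword k G u, inrange (size G) u, head 0 u = head 0 w - size rows & u != [::]].
Proof.
elim: rows G => [|M rows IH] G W K I hw w0 /=; first by rewrite subn0.
have [K1 I1 h1 n1] := IH (M :: G) W K I (ltnW hw) w0.
have [h2 n2] := @head_res (head 0 w - size (M :: rows)) (iter (size rows) res w) ltac:(rewrite h1 /= in hw *; lia).
split=> //; first exact: kword_res (wf_catrev (rows := rows) W) K1.
exact: inrange_res.
Qed.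

(** A representing word that starts with the oldest letter would survive the search: at each stage
    its restriction to the next larger vertex set arises by insertion and is among the candidates,
    and at the end [srch] returns false. *)
Lemma srchP k rows H w : 0 < k -> wf (catrev rows H) -> kword k (catrev rows H) w ->
  inrange (size (catrev rows H)) w -> size rows <= head 0 w -> w != [::] ->
  srch k rows (vecs (nseq (size H) 0) (iter (size rows) res w)) -> False.
Proof.
move=> k0; elim: rows H => // N rows IH H W K I hw w0.
have [Ku Iu hu nu] := iter_res (rows := rows) (G := N :: H) W K I (ltnW hw) w0.
rewrite [size _]/= iterS; set u := iter _ _ _ in Ku Iu hu nu *.
have Er : srch k rows (vecs (nseq (size H).+1 0) u) -> False.
  exact: IH W K I (ltnW hw) w0.
have WN := wf_catrev (rows := rows) W.
have [h1 n1] := @head_res (head 0 w - size (N :: rows)) u ltac:(rewrite hu /= in hw *; lia).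
case Ew: (res u) n1 h1 => [//|x v] _ _.
have lx : x < size H.
  by have := inrange_res Iu; rewrite Ew => /andP[].
have sN : size N = size H by case/andP: WN => /eqP.
(* The word does not start with the new letter, so the first cut is positive. This matches [srch]
   skipping the head of [V]. *)
have [ds Eds] : exists2 ds, gaps 0 u = ds & exists d ds', ds = d.+1 :: ds'.
  exists (gaps 0 u) => //; case: (Ku) => cu _.
  have : size (gaps 0 u) = k by rewrite size_gaps cu.
  case: (u) hu nu => // y u'; rewrite {1}/head => hy _.
  have -> : gaps 0 (y :: u') = gaps 1 u' by case: y hy => //=; move: hw => /=; lia.
  case Eg: (gaps 1 u') => [|d ds]; first by move=> k00; rewrite -k00 in k0.
  by move=> _; have := gaps_ge Eg; case: d {Eg} => // d _; exists d, ds.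
case=> d [ds' Eds']; subst ds.
have Ei := insw_res u; have Eo := okds_res u; have Es := size_gaps u.
case: Ku => cu Ru; rewrite Ew Eds' (cu 0) // in Ei Eo Es.
rewrite [vecs _ _]/= [srch _ _ _]/= => /allP A; apply: Er.
change (srch k rows (vecs (0 :: nseq (size H) 0) u)); rewrite -Ei vecs_insw_S.
apply: A; apply: ins1st_complete.
- by apply: size_incr; rewrite ?size_nseq sN.
- by have := inrange_res Iu; rewrite Ew sN => /andP[].
- by rewrite -Es prednK.
- by [].
move=> t lt; rewrite sN in lt.
rewrite -(adj0S WN lt) -Ru // (alt_bef (k := k)) ?cu // -Ei bef_insw.
rewrite -(prednK k0) altinc; last by rewrite (prednK k0) -Es; elim: (d.+1 :: ds') 0 (x :: v) => //= ? ? IH' ? ?; rewrite IH'.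
by rewrite /= nth_incr_nth nth_nseq lt addn0.
Qed.

Lemma norepP k g : 0 < k -> wf g -> norep k g -> ~ krep k g.
Proof.
rewrite /norep => k0 W R [w0 K0].
case Eg: (rev g) R => [//|r rows] S.
have {}Eg : g = catrev rows [:: r] by rewrite -[LHS]revK Eg.
rewrite {g}Eg in W K0; set G := catrev _ _ in W K0.
have G1 : size G = (size rows).+1 by rewrite /G catrevE size_cat size_rev addn1.
have [w1 K1 I1] : exists2 w, kword k G w & inrange (size G) w.
  exists (filter (gtn (size G)) w0); last exact: filter_all.
  case: K0 => c0 R0; split=> [i li|i j li lj ij].
    rewrite -(c0 i li) count_filter; apply: eq_count => x /=.
    by case: eqP => // ->; rewrite li.
  by rewrite -(R0 i j li lj ij) /alt !altf_filter.
have l1 : (size G).-1 < size G by rewrite G1.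
have [w K [hw n0 I]] : exists2 w, kword k G w & [/\ head 0 w = (size G).-1, w != [::] & inrange (size G) w].
  exists (rot (index (size G).-1 w1) w1); first exact: kword_rot.
  have iw : (size G).-1 \in w1 by rewrite -has_pred1 has_count; case: K1 => ->.
  split; [by rewrite rot_index|by rewrite rot_index|apply/allP => x; rewrite mem_rot => /(allP I1) //].
have Wr : size r = 0 by have := wf_catrev (rows := rows) W; case/andP => /eqP.
apply: (@srchP k rows [:: r] w) => //; first by rewrite hw G1.
have [] := iter_res (rows := rows) (G := [:: r]) W K I _ n0; first by rewrite hw G1.
move: (iter _ _ _) => u [cu _] Iu _ _.
have -> : u = nseq k 0.
  have A : all (pred1 0) u by apply: sub_all Iu => x /=; rewrite ltnS leqn0.
  rewrite -(cu 0) //; move: (A); rewrite all_count => /eqP ->; exact/all_pred1P.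
suff -> : vecs (nseq 1 0) (nseq k 0) = [seq [:: x] | x <- iota 0 k.+1] by [].
have E j c : vecs [:: c] (nseq j 0) = [seq [:: x] | x <- iota c j.+1].
  by elim: j c => //= j IH c; rewrite IH.
exact: E.
Qed.

(** * Burnside's lemma for graphs *)

Definition pstep (l : seq nat) (p : nat * nat) : nat * nat :=
  let a := nth 0 l p.1 in let b := nth 0 l p.2 in if a < b then (a, b) else (b, a).
Definition plt (p q : nat * nat) : bool := if p.1 < q.1 then true else if p.1 == q.1 then p.2 < q.2 else false.
(** Decides whether [p] is the least pair of its orbit, [q] running through the orbit until it
    returns to [p]. Exhausted fuel gives false, which can only weaken the lower bound. *)
Fixpoint pmin (l : seq nat) (fuel : nat) (p q : nat * nat) : bool := match fuel with
  | 0 => false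
  | f.+1 => if plt q p then false else if plt p q then pmin l f p (pstep l q) else true end.
Definition pairs n := [seq (i, j) | j <- iota 0 n, i <- iota 0 j].
(** A permutation fixes 2 to the power of its number of orbits on pairs many graphs; each orbit is
    counted at its least pair. *)
Definition leaf (n : nat) (l : seq nat) : positive :=
  iter (count (fun p => pmin l (n * n) p (pstep l p)) (pairs n)) xO xH.
Fixpoint pos_nat (n : nat) : positive := match n with 0 | 1 => xH | n'.+1 => Pos.succ (pos_nat n') end.
(* l lists the images of 0, ..., size l - 1, which form cycles of consecutive numbers
   and an open cycle starting at a.  The next vertex closes the cycle or is sent
   to an unused vertex; the r' choices of the latter are conjugate. *)
Fixpoint fixsum (n r : nat) (a : nat) (l : seq nat) : positive := match r with
  | 0 => leaf n l
  | 1 => leaf n (rcons l a)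
  | r'.+1 => let x := (size l).+1 in
     Pos.add (fixsum n r' x (rcons l a)) (Pos.mul (pos_nat r') (fixsum n r' a (rcons l x))) end.

Section Burnside.
Variable n : nat.
Let t2 := ('P : {action 'S_n &-> 'I_n})^*%act.
Let t3 := (t2^*)%act.
Definition graphs : {set {set {set 'I_n}}} := [set E : {set {set 'I_n}} | [forall e in E, #|e| == 2]].
Let F (s : 'S_n) := #|('Fix_(graphs | t3)[s])%g|.

Lemma graphs_acts : [acts [set: 'S_n], on graphs | t3].
Proof.
apply/actsP => s _ E; rewrite !inE; apply/forall_inP/forall_inP => H e.
  by move=> eE; rewrite -(card_setact 'P _ s); apply: H; apply: mem_setact.
by case/imsetP => e' e'E ->; rewrite card_setact; apply: H.
Qed.

Lemma burnside : \sum_(s : 'S_n) F s = #|orbit t3 [set: 'S_n] @: graphs| * n`!.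
Proof.
have := Frobenius_Cauchy graphs_acts; rewrite cardsT card_Sn => <-.
by apply: eq_bigl => s; rewrite inE.
Qed.

Lemma fix_conj s t : F (s ^ t)%g = F s.
Proof.
rewrite /F -[RHS](card_imset _ (act_inj t3 t)); apply: eq_card => E.
have sub s1 t1 E1 : E1 \in ('Fix_(graphs | t3)[s1])%g -> t3 E1 t1 \in ('Fix_(graphs | t3)[s1 ^ t1])%g.
  case/setIP => gE /afix1P fE; apply/setIP; split.
    by rewrite (acts_act graphs_acts) ?in_setT.
  by apply/afix1P; rewrite conjgE !actM actK fE.
apply/idP/imsetP => [H|[E' H ->]]; last exact: sub.
exists (t3 E t^-1)%g; last by rewrite actKV.
by have := sub _ (t^-1)%g _ H; rewrite conjgK.
Qed.

Definition agree (l : seq nat) := [set s : 'S_n | [forall i : 'I_n, (i < size l) ==> (s i == nth 0 l i :> nat)]].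
Definition A l := \sum_(s in agree l) F s.

Lemma agreeP l (s : 'S_n) : reflect (forall i : 'I_n, i < size l -> s i = nth 0 l i :> nat) (s \in agree l).
Proof.
rewrite inE; apply: (iffP forallP) => H i; first by move=> li; apply/eqP; move: (H i); rewrite li.
by apply/implyP => /H->.
Qed.

Lemma agree_rcons l y (s : 'S_n) (lx : size l < n) :
  (s \in agree (rcons l y)) = (s \in agree l) && (s (Ordinal lx) == y :> nat).
Proof.
apply/agreeP/andP => [H|[/agreeP H /eqP E] i].
  split; first by apply/agreeP => i li; have := H i; rewrite size_rcons nth_rcons li; apply; lia.
  by have := H (Ordinal lx); rewrite size_rcons nth_rcons /= ltnn eqxx => ->.
rewrite size_rcons ltnS nth_rcons leq_eqVlt => /predU1P[e|li]; last by rewrite li H.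
have -> : i = Ordinal lx by apply: val_inj.
by rewrite /= ltnn eqxx.
Qed.

(** Conjugation by the transposition of [(size l).+1] and [y] leaves the positions and images
    decided so far alone, since all of them are at most [size l], and it preserves the number of
    fixed graphs. *)
Lemma agree_sum_swap l y : size l < y -> y < n -> all (leq^~ (size l)) l ->
  A (rcons l y) = A (rcons l (size l).+1).
Proof.
move=> xy yn al; have x1n : (size l).+1 < n by lia.
have lx : size l < n by lia.
pose t := tperm (Ordinal x1n) (Ordinal yn).
have tfix (i : 'I_n) : i <= size l -> t i = i by move=> li; rewrite tpermD // -val_eqE /=; lia.
rewrite /A (reindex_inj (conjg_inj t)) /=; apply: eq_big => [s|s _]; last exact: fix_conj.
have V (i : 'I_n) : i <= size l -> (s ^ t)%g i = t (s i).
  by move=> li; rewrite conjgE tpermV !permM (tfix i li).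
rewrite !(agree_rcons _ _ lx) (V (Ordinal lx)) //=.
congr andb.
  apply/agreeP/agreeP => H i li; have nl : nth 0 l i <= size l by exact: (allP al) (mem_nth 0 li).
    have := H i li; rewrite V 1?ltnW // => E.
    by rewrite -[s i](tpermK (Ordinal x1n) (Ordinal yn)) -/t [t (t _)]tfix // E.
  by rewrite V 1?ltnW // tfix H.
have -> : (s (Ordinal lx) == (size l).+1 :> nat) = (s (Ordinal lx) == Ordinal x1n) by rewrite -val_eqE.
rewrite -(inj_eq (@perm_inj _ t) (s (Ordinal lx))) tpermL.
by rewrite -val_eqE.
Qed.

Lemma agree_sum_split l : size l < n -> A l = \sum_(0 <= y < n) A (rcons l y).
Proof.
move=> lx; rewrite big_mkord /A (partition_big (fun s : 'S_n => s (Ordinal lx)) predT) //=.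
by apply: eq_bigr => y _; apply: eq_bigl => s; rewrite (agree_rcons _ _ lx) val_eqE.
Qed.

(** Images up to [size l] other than [a] are simply dropped from the sum; for a lower bound it need
    not be shown that they contribute nothing. *)
Lemma agree_sum_step l a : size l < n -> a <= size l -> all (leq^~ (size l)) l ->
  A (rcons l a) + (n - (size l).+1) * A (rcons l (size l).+1) <= A l.
Proof.
move=> lx la al; rewrite (agree_sum_split lx) (@big_cat_nat _ _ _ (size l).+1) //=; apply: leq_add.
  by rewrite (bigD1_seq a) ?mem_index_iota ?iota_uniq //= leq_addr.
rewrite -sum_nat_const_nat leq_eqVlt; apply/orP; left; apply/eqP.
by apply: eq_big_nat => y /andP[xy yn]; rewrite agree_sum_swap.
Qed.

Definition epair (p : nat * nat) : {set 'I_n} := [set x : 'I_n | (val x == p.1) || (val x == p.2)].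
Definition okp (p : nat * nat) := (p.1 < p.2) && (p.2 < n).

Lemma epair_inj p q : okp p -> okp q -> epair p = epair q -> p = q.
Proof.
case: p q => [a b] [c d] /andP[/= ab bn] /andP[/= cd dn] /setP E.
have an := ltn_trans ab bn; have cn := ltn_trans cd dn.
have := E (Ordinal an); have := E (Ordinal bn); have := E (Ordinal cn); have := E (Ordinal dn).
rewrite !inE /= !eqxx ?orbT => H1 H2 H3 H4.
by have [-> ->] : a = c /\ b = d by lia.
Qed.

Lemma epair_card p : okp p -> #|epair p| = 2.
Proof.
case: p => a b /andP[/= ab bn]; have an := ltn_trans ab bn.
have -> : epair (a, b) = [set Ordinal an; Ordinal bn] by apply/setP => x; rewrite !inE -!val_eqE.
by rewrite cards2 -val_eqE /= (ltn_eqF ab).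
Qed.

Section Leaf.
Variables (l : seq nat) (s : 'S_n).
Hypotheses (sl : size l = n) (sA : s \in agree l).

Lemma lval (i : 'I_n) : s i = nth 0 l i :> nat.
Proof. by move/agreeP: sA; apply; rewrite sl. Qed.
Lemma l_inj i j : i < n -> j < n -> nth 0 l i = nth 0 l j -> i = j.
Proof.
move=> li lj; rewrite -(lval (Ordinal li)) -(lval (Ordinal lj)) => /val_inj /perm_inj.
by case.
Qed.

Lemma okp_step p : okp p -> okp (pstep l p).
Proof.
case: p => a b /andP[/= ab bn]; have an := ltn_trans ab bn; rewrite /okp /pstep /=.
have L i : i < n -> nth 0 l i < n by move=> li; rewrite -(lval (Ordinal li)).
have NE : nth 0 l a <> nth 0 l b by move/(l_inj an bn); lia.
have la := L a an; have lb := L b bn.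
by case: (ltnP (nth 0 l a) (nth 0 l b)) => /= H; rewrite ?H ?la ?lb //=; lia.
Qed.

Lemma epair_step p : okp p -> t2 (epair p) s = epair (pstep l p).
Proof.
move=> ok; have := okp_step ok; case: p ok => a b /andP[/= ab bn] _.
have an := ltn_trans ab bn; apply/setP => x.
have -> : (x \in epair (pstep l (a, b))) = (val x == nth 0 l a) || (val x == nth 0 l b).
  by rewrite inE /pstep /=; case: ifP => _ //=; rewrite orbC.
apply/imsetP/orP => [[y]|].
  by rewrite inE /= => /orP[/eqP e ->|/eqP e ->]; [left|right]; rewrite /= apermE lval -e.
by case=> /eqP e; [exists (Ordinal an)|exists (Ordinal bn)]; rewrite ?inE ?eqxx ?orbT //;
  apply: val_inj; rewrite /= apermE lval.
Qed.

Lemma epair_iter p k : okp p -> t2 (epair p) (s ^+ k)%g = epair (iter k (pstep l) p) /\ okp (iter k (pstep l) p).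
Proof.
move=> ok; elim: k => [|k [IH okk]]; first by rewrite expg0 act1.
by rewrite expgSr actM IH epair_step //=; split=> //; apply: okp_step.
Qed.

Definition ple p q := ~~ plt q p.
Lemma pltE p q : plt p q = (p.1 < q.1) || (p.1 == q.1) && (p.2 < q.2).
Proof. by rewrite /plt; case: ltnP => //=; case: eqP. Qed.
Lemma ple_refl p : ple p p.
Proof. by rewrite /ple pltE !ltnn andbF. Qed.
Lemma ple_anti p q : ple p q -> ple q p -> p = q.
Proof.
case: p q => [a b] [c d]; rewrite /ple !pltE /=.
by case: (ltngtP a c) => //= ->; case: (ltngtP b d) => //= ->.
Qed.

Lemma pminP fuel p q : pmin l fuel p q -> exists t, iter t (pstep l) q = p /\
  forall i, i <= t -> ple p (iter i (pstep l) q).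
Proof.
elim: fuel q => //= f IH q; case E1: (plt q p) => //; case E2: (plt p q).
  move=> /IH[t [Et Ht]]; exists t.+1; rewrite iterSr; split=> // -[|i] li; first by rewrite /ple E1.
  by rewrite iterSr; apply: Ht.
move=> _; have -> : q = p by apply: ple_anti; rewrite /ple ?E1 ?E2.
by exists 0; split=> // i; rewrite leqn0 => /eqP->; exact: ple_refl.
Qed.

Lemma iter_per (f : nat * nat -> nat * nat) p t k : iter t.+1 f p = p -> exists2 i, i <= t & iter k f p = iter i f p.
Proof.
move=> T; elim: k => [|k [i li E]]; first by exists 0.
rewrite [iter k.+1 f p]/= E; move: li; rewrite leq_eqVlt => /predU1P[->|li]; last by exists i.+1.
by exists 0 => //; rewrite -[RHS]T.
Qed.

Lemma pmin_le fuel p k : pmin l fuel p (pstep l p) -> ple p (iter k (pstep l) p).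
Proof.
case/pminP => t [Et Ht]; have T : iter t.+1 (pstep l) p = p by rewrite iterSr.
have [[|i] li ->] := iter_per k T; first exact: ple_refl.
by rewrite iterSr; apply: Ht; apply: ltnW.
Qed.

Lemma pmin_orbit f g p q : okp p -> okp q -> pmin l f p (pstep l p) -> pmin l g q (pstep l q) ->
  epair q \in orbit t2 <[s]>%g (epair p) -> p = q.
Proof.
move=> op oq mp mq O; have O' := O; rewrite orbit_sym in O'.
have L a b h : okp a -> okp b -> pmin l h a (pstep l a) -> epair b \in orbit t2 <[s]>%g (epair a) -> ple a b.
  move=> oa ob ma /orbitP[_ /cycleP[k ->]]; have [-> ok] := epair_iter k oa.
  by move=> /(epair_inj ok ob) <-; apply: pmin_le ma.
by apply: ple_anti; [apply: L mp O | apply: L mq O'].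
Qed.

Lemma pairs_ok p : p \in pairs n -> okp p.
Proof. by case/allpairsPdep => j [i [jn ij ->]]; rewrite !mem_iota in jn ij *; rewrite /okp /=; lia. Qed.

Lemma pairs_uniq : uniq (pairs n).
Proof.
by apply: allpairs_uniq_dep => [|j _|[a b] [c d] _ _ [-> ->]]; rewrite ?iota_uniq.
Qed.

(** A set of least pairs is sent to the union of their orbits, which is a graph fixed by [s].
    Intersecting with [M] recovers the set, as no two least pairs share an orbit. *)
Lemma fix_leaf : 2 ^ count (fun p => pmin l (n * n) p (pstep l p)) (pairs n) <= F s.
Proof.
pose ps := [seq p <- pairs n | pmin l (n * n) p (pstep l p)].
pose M := [set e in map epair ps].
have okps p : p \in ps -> okp p by rewrite mem_filter => /andP[_ /pairs_ok].
have cM : #|M| = size ps.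
  rewrite cardsE; apply: etrans (size_map epair ps); apply/card_uniqP.
  rewrite map_inj_in_uniq ?filter_uniq ?pairs_uniq // => p q /okps op /okps oq; exact: epair_inj.
rewrite -size_filter -/ps -cM -card_powerset.
pose U (B : {set {set 'I_n}}) := \bigcup_(e in B) orbit t2 <[s]>%g e.
have Minj e e' : e \in M -> e' \in M -> e' \in orbit t2 <[s]>%g e -> e' = e.
  rewrite !inE => /mapP[p pp ->] /mapP[q qq ->] O; congr epair; apply: esym.
  have := pp; have := qq; rewrite !mem_filter => /andP[mq _] /andP[mp _].
  by apply: pmin_orbit mp mq O; apply: okps.
have UM (B : {set {set 'I_n}}) : B \subset M -> M :&: U B = B.
  move=> BM; apply/setP => e; apply/setIP/idP => [[eM /bigcupP[e' e'B O]]|eB].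
    by rewrite (Minj e' e) // (subsetP BM).
  by split; [apply: (subsetP BM) | apply/bigcupP; exists e => //; apply: orbit_refl].
have injU : {in powerset M &, injective U}.
  by move=> B1 B2; rewrite !inE => /UM E1 /UM E2 E; rewrite -E1 -E2 E.
rewrite -(card_in_imset injU); apply: subset_leq_card; apply/subsetP => _ /imsetP[B BM ->].
rewrite inE in BM; apply/setIP; split.
  rewrite inE; apply/forall_inP => e /bigcupP[e' e'B /orbitP[g _ <-]].
  rewrite card_setact; have := subsetP BM _ e'B; rewrite inE => /mapP[p /okps op ->].
  by rewrite epair_card.
apply/afix1P/eqP; rewrite eqEcard card_setact leqnn andbT; apply/subsetP => e /imsetP[e1].
case/bigcupP => e' e'B O ->; apply/bigcupP; exists e' => //.
by rewrite orbit_actr ?cycle_id.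
Qed.
End Leaf.

Lemma nat_of_iter_xO k : nat_of_pos (iter k xO xH) = 2 ^ k.
Proof. by elim: k => //= k ->; rewrite expnS mul2n NatTrec.doubleE. Qed.

Definition permlist l := [&& size l == n, all (fun v => v < n) l & uniq l].

Lemma agree_ex l : permlist l -> exists s, s \in agree l.
Proof.
case/and3P => /eqP sl al ul.
pose f (i : 'I_n) : 'I_n := insubd i (nth 0 l i).
have vf i : val (f i) = nth 0 l i.
  by rewrite val_insubd (allP al) // mem_nth // sl.
have fi : injective f.
  move=> i j /(congr1 val); rewrite !vf => /eqP; rewrite nth_uniq ?sl // => /eqP; exact: val_inj.
by exists (perm fi); apply/agreeP => i _; rewrite permE vf.
Qed.

Lemma agree_sum_leaf l : permlist l -> nat_of_pos (leaf n l) <= A l.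
Proof.
move=> pl; have [s sA] := agree_ex pl; case/and3P: pl => /eqP sl _ _.
rewrite /leaf nat_of_iter_xO /A (bigD1 s) //=.
exact: leq_trans (fix_leaf sl sA) (leq_addr _ _).
Qed.

Lemma perm_permlist l : perm_eq l (iota 0 n) -> permlist l.
Proof.
move=> p; apply/and3P; split; first by rewrite (perm_size p) size_iota.
  by apply/allP => v; rewrite (perm_mem p) mem_iota.
by rewrite (perm_uniq p) iota_uniq.
Qed.

Lemma pos_natE k : 0 < k -> nat_of_pos (pos_nat k) = k.
Proof. by elim: k => // -[//|k] IH _; rewrite [pos_nat _]/= nat_of_succ_pos IH. Qed.

Lemma fixsum_le r a l : 0 < r -> size l + r = n -> perm_eq (a :: l) (iota 0 (size l).+1) ->
  nat_of_pos (fixsum n r a l) <= A l.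
Proof.
elim: r a l => // -[|r] IH a l _ sz p.
- have E : (size l).+1 = n by lia.
  rewrite E in p.
  have pl : permlist (rcons l a) by apply/perm_permlist; rewrite perm_rcons.
  apply: leq_trans (agree_sum_leaf pl) _.
  have I v : v \in a :: l -> v <= size l by rewrite (perm_mem p) mem_iota /= add0n -{1}E ltnS.
  apply: leq_trans (leq_addr _ _) (agree_sum_step _ (I a (mem_head _ _)) _); first by rewrite -E.
  by apply/allP => v vl; apply: I; rewrite inE vl orbT.
have lx : size l < n by lia.
have I v : v \in a :: l -> v <= size l by rewrite (perm_mem p) mem_iota /= add0n ltnS.
have -> : fixsum n r.+2 a l = Pos.add (fixsum n r.+1 (size l).+1 (rcons l a))
  (Pos.mul (pos_nat r.+1) (fixsum n r.+1 a (rcons l (size l).+1))) by [].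
rewrite nat_of_add_pos nat_of_mul_pos (pos_natE (ltn0Sn r)).
apply: leq_trans (agree_sum_step lx (I a (mem_head _ _)) _); last first.
  by apply/allP => v vl; apply: I; rewrite inE vl orbT.
have -> : n - (size l).+1 = r.+1 by lia.
have p2 : perm_eq ((size l).+1 :: a :: l) (iota 0 (size l).+2).
  have -> : iota 0 (size l).+2 = rcons (iota 0 (size l).+1) (size l).+1 by rewrite -addn1 iotaD -cats1.
  by rewrite perm_sym perm_rcons perm_cons perm_sym.
apply: leq_add; [|rewrite leq_mul2l]; last apply/orP; last right; apply: IH; rewrite ?size_rcons //; try by lia.
  by apply: perm_trans p2; rewrite perm_cons perm_rcons.
apply: perm_trans p2; rewrite -cat1s -[_ :: a :: l]cat1s; apply/seq.permP => q; rewrite !count_cat /= -cats1 count_cat /=; lia.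
Qed.

Theorem fixsum_orbits : 0 < n -> nat_of_pos (fixsum n n 0 [::]) <= #|orbit t3 [set: 'S_n] @: graphs| * n`!.
Proof.
move=> n0; rewrite -burnside; apply: leq_trans (fixsum_le n0 _ _) _ => //.
by rewrite /A [leqRHS](bigID (mem (agree [::]))) leq_addr.
Qed.
End Burnside.

(** * From codes to simple graphs *)

Definition closedp (g : code) (f : nat -> bool) := forall i j, i < size g -> j < size g -> cadj g i j -> f i -> f j.
(** Formulating connectivity by closed predicates avoids paths in codes; such predicates also pull
    back easily from [N :: H] to [H]. *)
Definition conng g := forall f, closedp g f -> forall i j, i < size g -> j < size g -> f i -> f j.

Definition comp_ok g (c : seq bool) := [/\ size c = size g, closedp g (nth false c), has id c &
  forall f, closedp g f -> forall i j, nth false c i -> nth false c j -> f i -> f j].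

Lemma meetsP N c : reflect (exists2 i, nth false N i & nth false c i) (meets N c).
Proof.
apply: (iffP idP) => [|[i]].
  elim: N c => [|x N IH] [|y c] //=; case: x => [|/IH[i Ni ci]]; last by exists i.+1.
  by case: y => [_|/IH[i Ni ci]]; [exists 0 | exists i.+1].
elim: N c i => [|x N IH] [|y c] [|i] //=; rewrite ?nth_nil //; first by move=> -> ->.
by move=> Ni /(IH _ _ Ni) ->; case: x; case: y.
Qed.

Lemma nth_true c i : nth false c i -> i < size c.
Proof. by case: ltnP => // le; rewrite nth_default. Qed.

Lemma size_join c d : size c = size d -> size (join c d) = size c.
Proof. by elim: c d => [|x c IH] [|y d] //= [/IH->]. Qed.
Lemma nth_join c d i : size c = size d -> nth false (join c d) i = nth false c i || nth false d i.
Proof. by elim: c d i => [|x c IH] [|y d] [|i] //= [/IH->]. Qed.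

Lemma join_nth n z cs i : size z = n -> (forall c, c \in cs -> size c = n) ->
  size (foldr join z cs) = n /\ nth false (foldr join z cs) i = nth false z i || has (fun c => nth false c i) cs.
Proof.
move=> sz; elim: cs => [|c cs IH] Hs /=; first by rewrite orbF.
have [|s1 n1] := IH; first by move=> d dc; apply: Hs; rewrite inE dc orbT.
have sc := Hs c (mem_head _ _); rewrite orbCA -n1.
by rewrite size_join ?nth_join ?sc.
Qed.

Lemma compsP g : wf g -> (forall c, c \in comps g -> comp_ok g c) /\
  (forall i, i < size g -> has (fun c => nth false c i) (comps g)).
Proof.
elim: g => [|N H IH] W //; have /andP[/eqP sN wH] := W; have [{}IH cov] := IH wH.
set cs := comps H in IH cov *.
pose J := foldr join [seq false | _ <- N] [seq c <- cs | meets N c].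
have -> : comps (N :: H) = (true :: J) :: [seq false :: c | c <- cs & ~~ meets N c] by [].
have Jn i : size J = size H /\ nth false J i = has (fun c => nth false c i) [seq c <- cs | meets N c].
  have [||-> ->] := @join_nth (size H) [seq false | _ <- N] [seq c <- cs | meets N c] i.
  - by rewrite size_map.
  - by move=> c; rewrite mem_filter => /andP[_ /IH[]].
  split=> //; have [lt|ge] := ltnP i (size N); first by rewrite (nth_map false).
  by rewrite [nth _ (map _ _) _]nth_default ?size_map.
have JP i : reflect (exists c, [/\ c \in cs, meets N c & nth false c i]) (nth false J i).
  have [_ ->] := Jn i; apply: (iffP hasP) => [[c]|[c [cc m ci]]].
    by rewrite mem_filter => /andP[m cc] ci; exists c.
  by exists c => //; rewrite mem_filter m.
have clS f : closedp (N :: H) f -> closedp H (fun i => f i.+1).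
  by move=> cf i j li lj a; apply: cf; rewrite // adjSS.
split=> [c0|[|i] li]; last 2 first.
- by [].
- have /hasP[c cc ci] := cov i li; apply/hasP; case m: (meets N c).
    by exists (true :: J); rewrite ?mem_head //=; apply/JP; exists c.
  by exists (false :: c) => //; rewrite inE; apply/orP; right; apply: map_f; rewrite mem_filter m.
rewrite inE => /predU1P[->|/mapP[d]].
  split=> //=; first by have [-> _] := Jn 0.
      move=> [|i] [|j] //= li lj; last first.
      by rewrite adjSS // => a /JP[c [cc m ci]]; apply/JP; exists c; split=> //; have [_ cell_of _ _] := IH c cc; apply: cell_of a ci.
    rewrite adj0S // => Nj _; have /hasP[c cc cj] := cov j lj; apply/JP; exists c; split=> //.
    by apply/meetsP; exists j.
  move=> f cf; suff F i : nth false (true :: J) i -> f i = f 0 by move=> i j /F -> /F ->.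
  case: i => // i /JP[c [cc /meetsP[k Nk ck] ci]].
  have [sc _ _ ac] := IH c cc; have lk : k < size H by rewrite -sc nth_true.
  have -> : f i.+1 = f k.+1 by apply/idP/idP; apply: (ac _ (clS f cf)).
  by apply/idP/idP; apply: cf; rewrite //= ?ltnS ?adjS0 ?adj0S.
rewrite mem_filter => /andP[nm dc] ->; have [sd cd hd ad] := IH d dc.
split=> //=; first by rewrite sd.
  move=> [|i] [|j] //= li lj; last by rewrite adjSS //; apply: cd.
  rewrite adjS0 // => Ni di; case/negP: nm; apply/meetsP; by exists i.
by move=> f cf [|i] [|j] //=; apply: (ad _ (clS f cf)).
Qed.

Lemma connP g : wf g -> conn g <-> conng g.
Proof.
case: g => [|N H] W //; have /andP[/eqP sN wH] := W; have [cok cov] := compsP wH.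
split=> [/= /allP A f cf|C].
  suff F i : i < size (N :: H) -> f i = f 0 by move=> i j /F -> /F ->.
  case: i => // i li; have /hasP[c cc ci] := cov i li.
  have [sc _ _ ac] := cok c cc; have /meetsP[k Nk ck] := A c cc; have lk : k < size H by rewrite -sc nth_true.
  have clS : closedp H (fun i => f i.+1).
    by move=> a b la lb ab; apply: cf; rewrite // adjSS.
  have -> : f i.+1 = f k.+1 by apply/idP/idP; apply: (ac _ clS).
  by apply/idP/idP; apply: cf; rewrite //= ?ltnS ?adjS0 ?adj0S.
apply/allP => c cc; apply: contraT => nm; have [sc cell_of hc _] := cok c cc.
have /(nthP false)[i li ci] : true \in c by case/hasP: hc => -[].
have := C (nth false (false :: c)) _ i.+1 0; apply=> //; last by rewrite /= -sc.
move=> [|a] [|b] //= la lb; last by rewrite adjSS //; apply: cell_of.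
by rewrite adjS0 // => Na ca; case/negP: nm; apply/meetsP; exists a.
Qed.

Section Alternate.
Variable T : finType.
Implicit Types (x y : T) (w : seq T).

Lemma altwordS x y n : altword x y n.+1 = x :: altword y x n.
Proof.
rewrite /altword /mkseq /= -[1]/(1 + 0) iotaDl -map_comp; congr cons; apply: eq_map => i /=.
by case: (odd i).
Qed.

Lemma altf_altword x y u : x != y -> all (pred2 x y) u -> altf x y u = (u == altword x y (size u)).
Proof.
elim: u x y => //= z u IH x y xy /andP[/orP zxy au].
have au' : all (pred2 y x) u by apply: sub_all au => a /=; rewrite orbC.
rewrite altwordS eqseq_cons; case: (eqVneq z x) => [zx|nx] /=; first by rewrite IH // eq_sym.
by case: zxy => [|->] //; rewrite (negbTE nx).
Qed.

Lemma alternateE x y w : x != y -> alternate x y w = alt x y w.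
Proof.
move=> xy; rewrite /alternate /alt; set u := filter _ _.
have au : all (pred2 x y) u by apply: filter_all.
have au' : all (pred2 y x) u by apply: sub_all au => a /=; rewrite orbC.
rewrite -(altf_altword xy au) -(altf_altword (_ : y != x) au') 1?eq_sym //.
by rewrite /u !altf_filter //= eqxx ?orbT.
Qed.
End Alternate.

Section Transfer.
Variables (T : finType) (x0 : T) (G : sgraph T) (g : code) (s : seq T).
Hypotheses (wg : wf g) (ps : perm_eq s (enum T)) (Ms : models x0 (adj G) s g).
Let us : uniq s. Proof. by rewrite (perm_uniq ps) enum_uniq. Qed.
Let sT x : x \in s. Proof. by rewrite (perm_mem ps) mem_enum. Qed.
Let sz : size s = size g. Proof. by case: Ms. Qed.

Definition toT (w : seq nat) := [seq nth x0 s i | i <- w & i < size s].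
Definition toN (w : seq T) := [seq index x s | x <- w].
Lemma toNK w : toT (toN w) = w.
Proof.
rewrite /toT (_ : filter _ _ = toN w) /toN -?map_comp; first by apply: map_id_in => x _ /=; rewrite nth_index.
by apply/all_filterP/allP => _ /mapP[x _ ->]; rewrite index_mem.
Qed.
Lemma toT_count w i : i < size g -> count_mem (nth x0 s i) (toT w) = count_mem i w.
Proof.
rewrite -sz => li; rewrite count_map count_filter; apply: eq_count => j /=.
apply/andP/eqP => [[e lj]|->]; last by rewrite eqxx li.
by apply/eqP; rewrite -(nth_uniq x0 lj li us).
Qed.
Lemma toT_alt w i j : i < size g -> j < size g -> alt (nth x0 s i) (nth x0 s j) (toT w) = alt i j w.
Proof.
rewrite -sz => li lj; have inj : {in (fun k => k < size s) &, injective (nth x0 s)}.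
  by move=> a b la lb /eqP; rewrite nth_uniq // => /eqP.
rewrite /alt /toT !(altf_map inj) ?filter_all //.
by rewrite ![altf _ _ (filter _ _)](altf_filter (p := fun k => k < size s)).
Qed.

Lemma toT_reps w : reps g w -> forall x y, x != y -> alternate x y (toT w) <-> adj G x y.
Proof.
move=> R x y xy; have li : index x s < size g by rewrite -sz index_mem.
have lj : index y s < size g by rewrite -sz index_mem.
rewrite alternateE // -[x](nth_index x0 (sT x)) -[y](nth_index x0 (sT y)).
rewrite toT_alt // R //; last by apply: contra xy => /eqP e; rewrite -[x](nth_index x0 (sT x)) e nth_index.
by case: Ms => _ ->.
Qed.

Lemma toN_reps w : (forall x y, x != y -> alternate x y w <-> adj G x y) -> reps g (toN w).
Proof.
move=> R i j li lj ij; have nij : nth x0 s i != nth x0 s j by rewrite nth_uniq ?sz.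
rewrite -toT_alt // toNK -alternateE //; case: Ms => _ <- //.
by apply/idP/idP => /(R _ _ nij).
Qed.

Lemma k_representableE k : 0 < k -> k_representable k G <-> krep k g.
Proof.
move=> k0; split=> [[w uw [_ R]]|[w [cw R]]].
  exists (toN w); split; last exact: toN_reps.
  by move=> i li; rewrite -toT_count // toNK uw.
have U x : count_mem x (toT w) = k.
  have li : index x s < size g by rewrite -sz index_mem.
  by rewrite -{1}[x](nth_index x0 (sT x)) toT_count // cw.
exists (toT w) => //; split; last exact: toT_reps.
by move=> x; rewrite -has_pred1 has_count U.
Qed.

Lemma word_representableE : word_representable G <-> wrep g.
Proof.
split=> [[w [iw R]]|[w iw R]].
  exists (toN w); last exact: toN_reps.
  by move=> i li; rewrite -has_pred1 has_count -toT_count // toNK -has_count has_pred1.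
exists (toT w); split; last exact: toT_reps.
move=> x; have li : index x s < size g by rewrite -sz index_mem.
by rewrite -has_pred1 has_count -[x](nth_index x0 (sT x)) toT_count // -has_count has_pred1 iw.
Qed.

Lemma connectedE : connected G <-> conn g.
Proof.
rewrite connP //; split=> [C f cf i j li lj|C x y].
  have /connectP[p pp] := C (nth x0 s i) (nth x0 s j).
  have [_ M] := Ms.
  suff F x : path (adj G) x p -> f (index x s) -> f (index (last x p) s).
    by move=> E fi; have := F _ pp; rewrite -E !index_uniq ?sz //; apply.
  elim: p x {pp} => //= y p IH x /andP[xy /IH F] fx; apply: F; apply: cf fx.
  - by rewrite -sz index_mem.
  - by rewrite -sz index_mem.
  by rewrite -M ?nth_index // -sz index_mem.
have [_ M] := Ms.
have := C (fun i => connect (adj G) x (nth x0 s i)) _ (index x s) (index y s).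
rewrite !nth_index // -sz !index_mem; apply=> // i j li lj ij xi.
by apply: connect_trans xi (connect1 _); rewrite M.
Qed.

Lemma stat_krep st : stat_ok g st -> stat_num st < 5 -> krep (stat_num st) g /\
  forall j, 0 < j -> krep j g -> stat_num st <= j.
Proof.
have L k : krep k.+1 g /\ ~ krep k g -> krep k.+1 g /\ forall j, 0 < j -> krep j g -> k < j.
  by move=> [K nK]; split=> // j j0 Kj; rewrite ltnNge; apply/negP => le; apply/nK/(krep_le j0 le).
by case: st => //= *; apply: L.
Qed.

Lemma is_repr_numberE st k : stat_ok g st -> 0 < k < 5 -> is_repr_number G (Some k) <-> stat_num st = k.
Proof.
move=> ok /andP[k0 k5]; split=> [[_ /k_representableE K m]|E]; last first.
  have s5 : stat_num st < 5 by rewrite E.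
  have [K m] := stat_krep ok s5; split=> //; first by apply/k_representableE => //; rewrite -E.
  by move=> j j0 /k_representableE H; rewrite -E; apply: m => //; apply: H.
have {}K := K k0.
have [s5|s5] := ltnP (stat_num st) 5; last first.
  by case: st ok s5 => //= c; case; apply: krep_wrep K.
have [K' m'] := stat_krep ok s5; apply/eqP; rewrite eqn_leq m' //= m //; first by case: (st).
by apply/k_representableE => //; case: (st).
Qed.

(** Any status other than 5 comes with a uniform word of uniformity at most 4, so a number above 4
    can only be infinite. *)
Lemma repr_number_gt4E st : stat_ok g st -> repr_number_gt 4 G <-> stat_num st = 5.
Proof.
move=> ok; split=> [[[j|] /= R l]|E]; last first.
- exists None => //= /word_representableE W.
  by case: st ok E => //= c; apply.
- have [s5|] := ltnP (stat_num st) 5; last by case: (st).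
  have [K _] := stat_krep ok s5; case: R; apply/word_representableE.
  by apply: krep_wrep K; case: (st).
have [s5|s5] := ltnP (stat_num st) 5; last by case: (st) s5.
have [K' m'] := stat_krep ok s5; case: R => _ _ /(_ (stat_num st)) H.
have : j <= stat_num st by apply: H; [case: (st) | apply/k_representableE => //; case: (st)].
by lia.
Qed.
End Transfer.

(** * Counting isomorphism classes by kept codes *)

Section Counting.
Variable n' : nat.
Let n := n'.+1.
Let x0 : 'I_n := ord0.
Let t2 := ('P : {action 'S_n &-> 'I_n})^*%act.
Let t3 := (t2^*)%act.
Implicit Types G H : sgraph 'I_n.

Lemma mem_setact_pair (E : {set {set 'I_n}}) (s : 'S_n) x y :
  ([set s x; s y] \in t3 E s) = ([set x; y] \in E).
Proof.
have -> : [set s x; s y] = t2 [set x; y] s by rewrite /t2 /= setactE imsetU !imset_set1.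
by rewrite /t3 /= setactE mem_imset //; apply: act_inj.
Qed.

Lemma graphs_eq A B : A \in graphs n -> B \in graphs n ->
  (forall x y, ([set x; y] \in A) = ([set x; y] \in B)) -> A = B.
Proof.
rewrite !inE => /forall_inP cA /forall_inP cB E; apply/setP => e; apply/idP/idP => He.
  by have /cards2P[x [y [_ e2]]] := cA _ He; rewrite e2 -E -e2.
by have /cards2P[x [y [_ e2]]] := cB _ He; rewrite e2 E -e2.
Qed.

Lemma edges_graphs G : edges G \in graphs n.
Proof. by rewrite inE; case: G. Qed.

Definition orb G := orbit t3 [set: 'S_n]%g (edges G).

Lemma isoP G H : reflect (exists s : 'S_n, forall x y, Defs.adj G x y = Defs.adj H (s x) (s y)) (isomorphic G H).
Proof.
apply: (iffP existsP) => -[s Hs]; exists s.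
  by move=> x y; apply/eqP; move/forallP: Hs => /(_ x) /forallP.
by apply/forallP => x; apply/forallP => y; rewrite Hs.
Qed.

(** Isomorphism classes are the orbits of the symmetric group on edge sets. This gives access to
    Burnside's lemma and makes isomorphism an equality of orbits. *)
Lemma iso_orb G H : isomorphic G H = (orb G == orb H).
Proof.
apply/isoP/eqP => [[s Hs]|E].
  rewrite /orb; have -> : edges H = t3 (edges G) s; last by apply/esym/orbit_act; rewrite inE.
  apply: graphs_eq; rewrite ?edges_graphs //.
    by rewrite (acts_act (graphs_acts n)) ?in_setT ?edges_graphs.
  by move=> x y; rewrite -[x](permKV s) -[y](permKV s) mem_setact_pair; apply/esym/Hs.
have : edges H \in orb G by rewrite E; apply: orbit_refl.
case/orbitP => s _ Es; exists s => x y.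
by rewrite /Defs.adj -Es mem_setact_pair.
Qed.

Definition code_edges (g : code) : {set {set 'I_n}} :=
  [set E | [exists i : 'I_n, exists j : 'I_n, [&& i != j, cadj g i j & E == [set i; j]]]].
Lemma code_edges2 g : [forall e in code_edges g, #|e| == 2].
Proof.
apply/forall_inP => e; rewrite inE => /existsP[i /existsP[j /and3P[ij _ /eqP->]]].
by rewrite cards2 ij.
Qed.
Definition graph_of g := SGraph (code_edges2 g).

Lemma adj_graph_of g i j : wf g -> size g = n -> Defs.adj (graph_of g) i j = cadj g i j.
Proof.
move=> wg sg; rewrite /Defs.adj /= inE.
have ls (k : 'I_n) : k < size g by rewrite sg.
apply/existsP/idP => [[a /existsP[b /and3P[ab gab /eqP E]]]|gij].
  have ia : i \in [set a; b] by rewrite -E set21.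
  have ja : j \in [set a; b] by rewrite -E set22.
  have ai : a \in [set i; j] by rewrite E set21.
  have bi : b \in [set i; j] by rewrite E set22.
  have ij : i != j.
    by apply: contraNneq ab => e; move: ai bi; rewrite e => /set2P[] -> /set2P[] ->.
  case/set2P: ia ij => ->; case/set2P: ja => ->; rewrite ?eqxx // => _.
  by rewrite adj_sym.
exists i; apply/existsP; exists j; rewrite gij eqxx !andbT.
by apply/eqP => ij; rewrite ij adj_irr in gij.
Qed.

Lemma models_iso g s G : wf g -> size g = n -> perm_eq s (enum 'I_n) -> models x0 (Defs.adj G) s g ->
  isomorphic (graph_of g) G.
Proof.
move=> wg sg ps [sz M]; have us : uniq s by rewrite (perm_uniq ps) enum_uniq.
have inj : injective (fun i : 'I_n => nth x0 s i).
  by move=> i j /eqP; rewrite nth_uniq ?sz ?sg // => /eqP; apply: val_inj.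
apply/isoP; exists (perm inj) => x y.
by rewrite adj_graph_of // !permE M ?sg.
Qed.

Lemma iso_models g G : wf g -> size g = n -> isomorphic (graph_of g) G ->
  exists2 s, perm_eq s (enum 'I_n) & models x0 (Defs.adj G) s g.
Proof.
move=> wg sg /isoP[s Hs].
have [ue me se ne] : [/\ uniq (enum 'I_n), forall x, x \in enum 'I_n, size (enum 'I_n) = n &
    forall k, k < n -> nth x0 (enum 'I_n) k = k :> nat].
  by split=> [|x||k lk]; rewrite ?enum_uniq ?mem_enum ?size_enum_ord ?nth_enum_ord.
move: (enum _) ue me se ne => es ue me se ne; exists (map s es).
  apply: uniq_perm => // [|x]; first by rewrite (map_inj_uniq (@perm_inj _ s)).
  by rewrite me -[x](permKV s) (mem_map (@perm_inj _ s)) me.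
split=> [|i j li lj]; first by rewrite size_map se sg.
by rewrite sg in li lj; rewrite !(nth_map x0) ?se // -Hs adj_graph_of // !ne.
Qed.

Variable K : seq (code * stat).
Hypothesis okK : allp (kept_ok n) K.
Hypothesis covK : forall e : rel 'I_n, symmetric e -> irreflexive e -> covers x0 e n (map fst K).
Hypothesis bigK : size K <= #|orbit t3 [set: 'S_n]%g @: graphs n|.

Lemma adjS G : symmetric (Defs.adj G).
Proof. by move=> x y; rewrite /Defs.adj setUC. Qed.
Lemma adjI G : irreflexive (Defs.adj G).
Proof.
move=> x; apply/negP; rewrite /Defs.adj => H; have := edges_graphs G.
by rewrite inE => /forall_inP /(_ _ H); rewrite cards2 eqxx.
Qed.

Lemma code_for G : exists2 g, g \in map fst K & isomorphic (graph_of g) G.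
Proof.
have [g [s [gK ps M]]] := covK (@adjS G) (@adjI G) (enum_uniq 'I_n) (size_enum_ord n).
exists g => //; have [x [wx sx _] E] := allp_map_in okK gK.
by rewrite -E in M *; apply: models_iso M.
Qed.

Lemma uniq_orb : uniq [seq orb (graph_of g) | g <- map fst K].
Proof.
set os := map _ _; have so : size os = size K by rewrite !size_map.
apply/card_uniqP/eqP; rewrite eqn_leq card_size so (leq_trans bigK) //.
apply: subset_leq_card; apply/subsetP => _ /imsetP[E gE ->].
have gE' : [forall e in E, #|e| == 2] by move: gE; rewrite inE.
have [g gK] := code_for (SGraph gE'); rewrite iso_orb => /eqP Eg.
by apply/mapP; exists g.
Qed.

(** The hypothesis forces [P] to be isomorphism-invariant, since it is read off from any code that
    models the graph. The classes satisfying [P] are then those of the kept graphs satisfying [p],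
    which are distinct by [uniq_orb]. *)
Theorem num_graphs_count (P : sgraph 'I_n -> Prop) (p : code * stat -> bool) :
  (forall G x s, kept_ok n x -> perm_eq s (enum 'I_n) -> models x0 (Defs.adj G) s x.1 -> P G <-> p x) ->
  num_graphs P = count p K.
Proof.
move=> Pp; rewrite /num_graphs; set D := [set G | _].
have PpI G x : kept_ok n x -> isomorphic (graph_of x.1) G -> P G <-> p x.
  by move=> ok /(iso_models (let: And3 w _ _ := ok in w) (let: And3 _ s _ := ok in s))[s ps M]; apply: Pp ps M.
pose L := map fst (filter p K).
pose cls G := [set H in D | isomorphic G H].
have subL : subseq L (map fst K) by rewrite /L filter_mask map_mask mask_subseq.
have LP g : g \in L -> g \in map fst K /\ P (graph_of g).
  move=> gL; split; first exact: mem_subseq subL _ gL.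
  have okL : allp (fun x => kept_ok n x /\ p x) (filter p K).
    by elim: (K) okK => //= x K' IH [okx /IH okK']; case: ifP.
  have [x [ok px] <-] := allp_map_in okL gL; apply/(PpI _ x) => //; by rewrite iso_orb.
have PL G : P G -> exists2 g, g \in L & isomorphic (graph_of g) G.
  move=> PG; have [g gK iG] := code_for G; exists g => //.
  elim: (K) okK gK {LP subL} @L => //= x K' IH [okx okK']; rewrite inE => /predU1P[e|/(IH okK') gL].
    by rewrite e in iG *; rewrite ((PpI _ _ okx iG).1 PG) mem_head.
  by case: (p x); rewrite //= inE gL orbT.
have -> : equivalence_partition (isomorphic (T:='I_n)) D = cls @: D by [].
have -> : cls @: D = [set c in [seq cls (graph_of g) | g <- L]].
  apply/setP => c; rewrite inE; apply/imsetP/mapP => [[G]|[g gL ->]].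
    rewrite inE => /asboolP /PL[g gL iG] ->; exists g => //.
    by apply/setP => H; rewrite !inE !iso_orb; move: iG; rewrite iso_orb => /eqP->.
  by exists (graph_of g) => //; rewrite inE; apply/asboolP; case: (LP g gL).
rewrite cardsE; have -> : count p K = size [seq cls (graph_of g) | g <- L].
  by rewrite !size_map size_filter.
apply/card_uniqP; have U : uniq [seq orb (graph_of g) | g <- L].
  by apply: subseq_uniq uniq_orb; apply: map_subseq.
have LD g : g \in L -> graph_of g \in D by move/LP => [_ Pg]; rewrite inE; apply/asboolP.
elim: (L) U LD => //= g L' IH /andP[ng U] LD.
rewrite IH ?andbT //; last by move=> h hL; apply: LD; rewrite inE hL orbT.
apply: contra ng => /mapP[h hL E]; apply/mapP; exists h => //.
have : graph_of h \in cls (graph_of g).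
  by rewrite E inE LD ?inE ?hL ?orbT // iso_orb eqxx.
by rewrite inE iso_orb => /andP[_ /eqP].
Qed.
End Counting.

(** * From checked data to the numbers of classes *)

Definition obs_of (obwt : seq (seq (code * rtree))) := map (map fst) obwt.

Lemma obs_okP (P : code -> Prop) (p : code -> bool) obs : (forall g, p g -> wf g /\ ~ P g) ->
  all (all p) obs -> obs_ok P obs.
Proof.
move=> pP /(all_nthP [::]) A a b; rewrite /nth2 => ne; apply: pP.
have [la|la] := ltnP (digit_val a) (size obs); last by rewrite [nth [::] obs _]nth_default // nth_nil in ne.
have [lb|lb] := ltnP (digit_val b) (size (nth [::] obs (digit_val a))); last by rewrite nth_default in ne.
exact: (elimT (all_nthP [::]) (A _ la)).
Qed.

Lemma obs_ok_wrep obwt : all (all (fun x => [&& wf x.1, 0 < size x.1 & refutes x.1 x.2])) obwt ->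
  obs_ok wrep (obs_of obwt).
Proof.
move=> /(all_nthP [::]) A a b; rewrite /nth2 /obs_of => ne.
have [la|la] := ltnP (digit_val a) (size obwt); last first.
  by rewrite [nth [::] _ (digit_val a)]nth_default ?nth_nil ?size_map // in ne.
rewrite (nth_map [::]) // in ne *.
have [lb|lb] := ltnP (digit_val b) (size (nth [::] obwt (digit_val a))); last by rewrite nth_default ?size_map in ne.
rewrite (nth_map ([::], Cyc DN)) //.
have /and3P[w s r] := elimT (all_nthP ([::], Cyc DN)) (A _ la) _ lb.
by split=> //; apply: refutesP r.
Qed.

Lemma obs_ok_krep k obs : 0 < k -> all (all (fun g => wf g && norep k g)) obs -> obs_ok (krep k) obs.
Proof. by move=> k0; apply: obs_okP => g /andP[w r]; split=> //; apply: norepP r. Qed.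

(** Coverage is asked for in every ambient graph, so the same classification serves graphs on
    ordinals in the counts and graphs on arbitrary finite types in the last assertion. *)
Definition classified n (K : seq (code * stat)) := allp (kept_ok n) K /\
  forall (T : eqType) (x0 : T) (e : rel T), symmetric e -> irreflexive e -> covers x0 e n (map fst K).

Lemma classified0 : classified 0 [:: ([::], S1)].
Proof.
split=> [|T x0 e _ _]; last exact: covers0.
by split=> //; split=> //=; exists [::]; split.
Qed.

Section Levels.
Variables (obsw obsc obs3 : seq (seq code)).
Hypotheses (okw : obs_ok wrep obsw) (okc : obs_ok (krep 2) obsc) (ok3 : obs_ok (krep 3) obs3).

Lemma classified_step n K rs : classified n K ->
  map fst K = map (getcode n) (flatten (flatten rs)) ->
  all (all (all (chkrec obsw obsc obs3 n (recs_at rs)))) rs -> classified n.+1 (kept n rs).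
Proof.
move=> [okK cov] E ck.
have gL : all (good_code n) (map (getcode n) (flatten (flatten rs))).
  rewrite -E all_map; apply/allp_all; apply: allp_impl okK => x [w s _] /=.
  by rewrite /good_code w s eqxx.
split; first exact: (level_kept okw okc ok3 ck gL).
move=> T x0 e eS eI; apply: (covers_step eS eI okw okc ok3 ck gL).
by rewrite -E; apply: cov.
Qed.
End Levels.

Definition tally_get (t : tally) (k : nat) : nat := let: Tal c0 c1 c2 c3 c4 c5 := t in
  nat_of_bin (nth N0 [:: c0; c1; c2; c3; c4; c5] k).
Definition stat_idx (x : code * stat) : nat := if conn x.1 then stat_num x.2 else 0.

Lemma nat_of_bsucc b : nat_of_bin (bsucc b) = (nat_of_bin b).+1.
Proof. by case: b => //= p; rewrite nat_of_succ_pos. Qed.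

Lemma tally_get_add t i k : i < 6 -> k < 6 -> tally_get (tally_add t i) k = (i == k) + tally_get t k.
Proof.
case: t => c0 c1 c2 c3 c4 c5.
by case: i => [|[|[|[|[|[|]]]]]] // _; case: k => [|[|[|[|[|[|]]]]]] // _; rewrite /= ?nat_of_bsucc.
Qed.

Lemma tally_tree_count H t N acc acc' k : k < 6 -> tally_get acc k = count (fun x => stat_idx x == k) acc' ->
  tally_get (tally_tree (comps H) t N acc) k = count (fun x => stat_idx x == k) (keptl H t N acc').
Proof.
move=> k6; elim: t N acc acc' => //= [a IHa b IHb|s] N acc acc' E; first by apply/IHa/IHb.
by rewrite tally_get_add //; [rewrite E|case: ifP => // _; case: s].
Qed.

Lemma tally_recs_count n rs k : k < 6 ->
  tally_get (tally_recs n (flatten (flatten rs))) k = count (fun x => stat_idx x == k) (kept n rs).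
Proof.
move=> k6; rewrite /tally_recs /kept; elim: (flatten _) => [|r L IH] /=; last exact: tally_tree_count.
by case: k k6 => [|[|[|[|[|[|]]]]]].
Qed.

Lemma stat_idx6 x : stat_idx x < 6.
Proof. by rewrite /stat_idx; case: ifP => // _; case: x.2. Qed.

Fixpoint pos_fact (n : nat) : positive := match n with 0 => xH | n'.+1 => Pos.mul (pos_nat n) (pos_fact n') end.
Lemma pos_factE n : nat_of_pos (pos_fact n) = n`!.
Proof. by elim: n => // n IH; rewrite /= nat_of_mul_pos IH (pos_natE (ltn0Sn n)) factS. Qed.

Definition Nadd (a b : N) := match a, b with N0, _ => b | _, N0 => a | Npos p, Npos q => Npos (Pos.add p q) end.
Lemma nat_of_Nadd a b : nat_of_bin (Nadd a b) = nat_of_bin a + nat_of_bin b.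
Proof. by case: a b => [|p] [|q] //=; rewrite ?addn0 ?nat_of_add_pos. Qed.
Definition Nmul (a b : N) := match a, b with Npos p, Npos q => Npos (Pos.mul p q) | _, _ => N0 end.
Arguments Nadd : simpl never.
Arguments Nmul : simpl never.
Lemma nat_of_Nmul a b : nat_of_bin (Nmul a b) = nat_of_bin a * nat_of_bin b.
Proof. by case: a b => [|p] [|q] //=; rewrite ?muln0 ?nat_of_mul_pos. Qed.
Definition tally_total (t : tally) : N := let: Tal c0 c1 c2 c3 c4 c5 := t in foldr Nadd N0 [:: c0; c1; c2; c3; c4; c5].

Lemma ttotalE t : nat_of_bin (tally_total t) = \sum_(k < 6) tally_get t k.
Proof.
case: t => c0 c1 c2 c3 c4 c5; rewrite !big_ord_recl big_ord0 /=.
by rewrite !nat_of_Nadd.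
Qed.

Lemma ttotal_size n rs : nat_of_bin (tally_total (tally_recs n (flatten (flatten rs)))) = size (kept n rs).
Proof.
rewrite ttotalE; under eq_bigr => k _ do rewrite tally_recs_count //.
elim: (kept n rs) => [|x K IH] /=; first by rewrite big1.
rewrite big_split /= IH (bigD1 (Ordinal (stat_idx6 x))) //= eqxx big1 // => i /negbTE.
by rewrite -val_eqE /= eq_sym => ->.
Qed.

Section LevelCounts.
Variables (n' : nat) (rs : seq (seq (seq hrec))) (t : tally).
Let n := n'.+1.
Let K := kept n' rs.
Hypothesis clK : classified n K.
Hypothesis tK : tally_recs n' (flatten (flatten rs)) = t.
Hypothesis bK : Nmul (tally_total t) (Npos (pos_fact n)) = Npos (fixsum n n 0 [::]).

(** The total of the tally times [n!] equals [fixsum], which is at most the number of orbits times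
    [n!]; the factorial cancels. *)
Lemma size_le_orbits : size K <= #|orbit (('P : {action 'S_n &-> 'I_n})^*^*)%act [set: 'S_n]%g @: graphs n|.
Proof.
have := congr1 nat_of_bin bK; rewrite nat_of_Nmul -tK ttotal_size -/K.
rewrite -[nat_of_bin (Npos (pos_fact n))]/(nat_of_pos (pos_fact n)) pos_factE.
rewrite -[RHS]/(nat_of_pos (fixsum n n 0 [::])) => E.
have := fixsum_orbits (ltn0Sn n'); rewrite -E leq_pmul2r //; exact: fact_gt0.
Qed.

Lemma num_graphs_stat k (Q : sgraph 'I_n -> Prop) : 0 < k < 6 ->
  (forall G g s st, wf g -> perm_eq s (enum 'I_n) -> models ord0 (Defs.adj G) s g -> stat_ok g st ->
     Q G <-> stat_num st = k) ->
  num_graphs (fun G : sgraph 'I_n => connected G /\ Q G) = tally_get t k.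
Proof.
case/andP => k0 k6 HQ; have [okK cov] := clK.
rewrite -tK tally_recs_count //.
apply: (num_graphs_count okK (cov _ ord0) size_le_orbits) => G [g st] s [/= wg sg ok] ps M.
rewrite (connectedE wg ps M) (HQ G g s st wg ps M ok) /stat_idx /=.
case: (conn g); last by split=> [[]|/eqP e] //; rewrite -e in k0.
by split=> [[_ ->]|/eqP].
Qed.

Theorem repr_countsE : repr_counts n =
  let: Tal _ c1 c2 c3 c4 c5 := t in map nat_of_bin [:: c1; c2; c3; c4; c5].
Proof.
have L k : 0 < k < 5 -> num_connected_repr n k = tally_get t k.
  move=> k15; apply: num_graphs_stat => [|G g s st wg ps M ok]; first by lia.
  exact: (is_repr_numberE ps M ok k15).
rewrite /repr_counts !L //; transitivity [:: tally_get t 1; tally_get t 2; tally_get t 3; tally_get t 4; tally_get t 5]; last by case: (t).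
congr [:: _; _; _; _; _].
apply: num_graphs_stat => // G g s st wg ps M ok.
exact: (repr_number_gt4E wg ps M ok).
Qed.
End LevelCounts.

Theorem repr_number_gt4_not_wr n K : classified n K -> forall (T : finType) (G : sgraph T), #|T| = n ->
  repr_number_gt 4 G -> ~ word_representable G.
Proof.
move=> [okK cov] T G cT [[j|] R l]; last exact: R.
have [x0|T0] := pickP (fun _ : T => true); last first.
  (* Without vertices the empty word is 1-uniform and represents the graph. *)
  have : j <= 1; last by lia.
  case: R => _ _; apply=> //; exists [::]; first by move=> x; have := T0 x.
  by split=> x; have := T0 x.
have aS : symmetric (Defs.adj G) by move=> x y; rewrite /Defs.adj setUC.
have aI : irreflexive (Defs.adj G).
  move=> x; apply/negP; rewrite /Defs.adj; case: G {R aS} => E HE /= xE.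
  by move/forall_inP: HE => /(_ _ xE); rewrite cards2 eqxx.
have sT : size (enum T) = n by rewrite -cardE.
have [g [s [gK ps M]]] := cov T x0 _ aS aI _ (enum_uniq T) sT.
have [[g' st] [/= wg _ ok] e] := allp_map_in okK gK; rewrite /= in e; subst g'.
have : repr_number_gt 4 G by exists (Some j).
rewrite (repr_number_gt4E wg ps M ok) => s5; rewrite (word_representableE ps M).
by case: st ok s5.
Qed.

(** Large numerals of type [nat] stay in the form [Nat.of_num_uint] of a decimal. Reading the
    decimal in binary, with [xO (xI (xO xH))] for ten, makes them comparable with the tallies
    without unary evaluation. *)
Fixpoint uint_N (d : Decimal.uint) (acc : N) : N :=
  let up b := Nadd b (Nmul (Npos (xO (xI (xO xH)))) acc) in
  match d with
  | Decimal.Nil => acc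
  | Decimal.D0 d => uint_N d (up N0)
  | Decimal.D1 d => uint_N d (up (Npos xH))
  | Decimal.D2 d => uint_N d (up (Npos (xO xH)))
  | Decimal.D3 d => uint_N d (up (Npos (xI xH)))
  | Decimal.D4 d => uint_N d (up (Npos (xO (xO xH))))
  | Decimal.D5 d => uint_N d (up (Npos (xI (xO xH))))
  | Decimal.D6 d => uint_N d (up (Npos (xO (xI xH))))
  | Decimal.D7 d => uint_N d (up (Npos (xI (xI xH))))
  | Decimal.D8 d => uint_N d (up (Npos (xO (xO (xO xH)))))
  | Decimal.D9 d => uint_N d (up (Npos (xI (xO (xO xH)))))
  end.

Lemma tail_addE a b : Nat.tail_add a b = a + b.
Proof. by elim: a b => //= a IH b; rewrite IH addnS. Qed.
Lemma tail_addmulE r a b : Nat.tail_addmul r a b = r + a * b.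
Proof. by elim: a r => [|a IH] r /=; rewrite ?addn0 // IH tail_addE mulSn; lia. Qed.
Lemma tail_mulE a b : Nat.tail_mul a b = a * b.
Proof. exact: tail_addmulE. Qed.

Lemma of_uint_accE d acc : Nat.of_uint_acc d (nat_of_bin acc) = nat_of_bin (uint_N d acc).
Proof.
elim: d acc => //= d IH acc; rewrite -IH nat_of_Nadd nat_of_Nmul [Nat.tail_mul _ _]tail_mulE //.
Qed.
Lemma of_num_uintE d : Nat.of_num_uint (Number.UIntDecimal d) = nat_of_bin (uint_N d N0).
Proof. exact: (of_uint_accE d N0). Qed.

(** * Search for the certificates *)

(* An unverified search: the certificates it produces are accepted or rejected by the checker. *)
Module Generator.

Definition all_digits := [:: D0; D1; D2; D3; D4; D5; D6; D7; D8; D9; D10; D11; D12; D13;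
  D14; D15; D16; D17; D18; D19; D20; D21; D22; D23; D24; D25; D26; D27; D28; D29; D30; D31].
Definition digit_of n := nth D0 all_digits n.
Definition word := seq nat.
Fixpoint digits_of (s : seq nat) : digits := match s with [::] => DN | x :: s' => DC (digit_of x) (digits_of s') end.

Inductive trie (A : Type) := TE | TB (v : option A) (l r : trie A).
Arguments TE {A}.
Fixpoint tget A (p : positive) (t : trie A) : option A := match t with
  | TE => None
  | TB v l r => match p with xH => v | xO p => tget p l | xI p => tget p r end end.
Fixpoint tset A (p : positive) (x : A) (t : trie A) : trie A :=
  let '(v, l, r) := match t with TE => (None, TE, TE) | TB v l r => (v, l, r) end in
  match p with xH => TB (Some x) l r | xO p => TB v (tset p x l) r | xI p => TB v l (tset p x r) end.

Definition emb : Type := (nat * nat * seq nat)%type.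
Definition pos3 : Type := (nat * nat * nat)%type.
Definition nextpos (p : pos3) : pos3 := let '(a, b, c) := p in
  if eqn c 31 then (if eqn b 31 then (a.+1, 0, 0) else (a, b.+1, 0)) else (a, b, c.+1).

(** [GU] is a leaf not yet decided; the others become [Prune], [Wit], [Aut], [Iso] and [Kept]. *)
Inductive gleaf := GU | GP (j : nat) | GW (u : nat) | GA (s : seq nat)
  | GI (id : positive) (ps : pos3) (N : seq bool) (f : seq nat) | GK (id : positive).
Inductive gtree := GL (l : gleaf) | GB (a b : gtree).
Fixpoint glook (t : gtree) (bs : seq bool) : gleaf := match t with
  | GL l => l
  | GB t0 t1 => match bs with b :: bs' => glook (if b then t1 else t0) bs' | [::] => GU end end.
Fixpoint gupd (t : gtree) (bs : seq bool) (x : gleaf) : gtree := match t with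
  | GL _ => GL x
  | GB t0 t1 => match bs with b :: bs' => if b then GB t0 (gupd t1 bs' x) else GB (gupd t0 bs' x) t1
                | [::] => t end end.

Record ginfo := Ginfo { gps : pos3; gtr : gtree }.
Record pend := Pend { pcode : code; pid : positive; pps : pos3; pnw : option emb; pnc : option emb;
  pp2 : seq word; pp3 : seq word }.

Fixpoint find1 A (p : A -> bool) (s : seq A) : option A :=
  match s with [::] => None | x :: s' => if p x then Some x else find1 p s' end.
Fixpoint first A B (f : A -> option B) (s : seq A) : option B :=
  match s with [::] => None | x :: s' => match f x with Some y => Some y | None => first f s' end end.
Fixpoint mem_n (x : nat) s := match s with [::] => false | y :: s' => if eqn x y then true else mem_n x s' end.

Fixpoint prj (dn : seq nat) (N : seq bool) (c j : nat) : option nat := match dn, N with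
  | d :: dn', b :: N' => if (if b then d.+1 < c else d < c) then Some j else prj dn' N' c j.+1
  | _, _ => None end.
Section En.
Variables (m : seq (seq cell)) (degs sums : seq nat).
Definition degG (N : seq bool) u := nth 0 degs u + nth false N u.
Definition sumG (N : seq bool) c u := nth 0 sums u + inter (nth [::] m u) N + (if nth false N u then c else 0).
Fixpoint en (ds : seq nat) N dn c S : gtree :=
  match prj dn N c 0 with Some j => GL (GP j) | None =>
  match ds with
  | d :: ds' => GB (en ds' (false :: N) (d :: dn) c S) (en ds' (true :: N) (d :: dn) c.+1 (d.+1 + S))
  | [::] =>
    match find1 (fun u => if eqn (degG N u) c then sumG N c u < S else false) (iota 0 (size degs)) with
    | Some u => GL (GW u) | None => GL GU end
  end end.
Definition ties (N : seq bool) : seq nat :=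
  let c := count id N in
  let S := foldr (fun p a => if p.2 then (p.1).+1 + a else a) 0 (zip degs N) in
  [seq u <- iota 0 (size degs) | if eqn (degG N u) c then eqn (sumG N c u) S else false].
End En.
Fixpoint unk (t : gtree) (N : seq bool) (acc : seq (seq bool)) := match t with
  | GL GU => N :: acc | GL _ => acc
  | GB a b => unk a (false :: N) (unk b (true :: N) acc) end.

Section Aut.
Variables (m : seq (seq cell)) (keys : seq (nat * nat)).
Let n := size m.
Definition keq i j := let a := nth (0,0) keys i in let b := nth (0,0) keys j in
  if eqn a.1 b.1 then eqn a.2 b.2 else false.
Fixpoint consr (row : seq cell) (rowy : seq cell) (f : seq nat) : bool := match row, f with
  | c :: row', x :: f' => if eqb (isadj c) (isadj (nth Self rowy x)) then consr row' rowy f' else false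
  | _, _ => true end.
Definition okimg (k y : nat) (frev : seq nat) : bool :=
  if mem_n y frev then false else if keq k y then
  consr (rev (take k (nth [::] m k))) (nth [::] m y) frev else false.
Fixpoint aext (fuel k : nat) (frev : seq nat) : option (seq nat) := match fuel with
  | 0 => Some (rev frev)
  | fuel'.+1 => first (fun y => if okimg k y frev then aext fuel' k.+1 (y :: frev) else None) (iota 0 n)
  end.
Fixpoint orbv (fuel : nat) (gens : seq (seq nat)) (todo seen : seq nat) : seq nat := match fuel, todo with
  | fuel'.+1, x :: todo' =>
     let nw := undup [seq y <- [seq nth 0 g x | g <- gens] | ~~ mem_n y seen] in
     orbv fuel' gens (nw ++ todo') (nw ++ seen)
  | _, _ => seen end.
(** One step of a stabiliser chain: generators fixing all vertices below [i] are added, one for each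
    image of [i] that the present generators do not reach. *)
Fixpoint sgs1 (i : nat) (js : seq nat) (gens : seq (seq nat)) (orb : seq nat) := match js with
  | [::] => gens
  | j :: js' => if mem_n j orb then sgs1 i js' gens orb else
     let p := rev (iota 0 i) in
     match (if okimg i j p then aext (n - i.+1) i.+1 (j :: p) else None) with
     | Some g => let gens' := g :: gens in sgs1 i js' gens' (orbv n gens' [:: i] [:: i])
     | None => sgs1 i js' gens orb end end.
Definition sgs := foldr (fun i gens => sgs1 i (iota i.+1 (n - i.+1)) gens (orbv n gens [:: i] [:: i])) [::] (iota 0 n).
Definition invp (g : seq nat) := [seq index x g | x <- iota 0 n].
End Aut.
Fixpoint memN (x : seq bool) (s : seq (seq bool * seq nat)) := match s with
  | [::] => false | y :: s' => if eqbs x y.1 then true else memN x s' end.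
Fixpoint bfsN (fuel : nat) (gs : seq (seq nat * seq nat)) (todo seen : seq (seq bool * seq nat)) :=
  match fuel, todo with
  | fuel'.+1, (N1, s1) :: todo' =>
     let '(t, sn) := foldl (fun ts g => let '(t, sn) := ts in
        let N2 := [seq nth false N1 x | x <- g.1] in
        if memN N2 sn then ts else let e := (N2, [seq nth 0 g.2 x | x <- s1]) in (e :: t, e :: sn)) (todo', seen) gs in
     bfsN fuel' gs t sn
  | _, _ => seen end.

(* locating a graph among the representatives by deleting minimal vertices *)
Definition delv A v (s : seq A) := take v s ++ drop v.+1 s.
Definition delM v (m : seq (seq cell)) := map (delv v) (delv v m).
Definition keysof (m : seq (seq cell)) : seq (nat * nat) :=
  let ds := map deg m in zip ds (map (fun r => sumr r ds) m).
Fixpoint argmin (ks : seq (nat * nat)) (i bi : nat) (b : nat * nat) : nat := match ks with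
  | [::] => bi
  | k :: ks' => if (if k.1 < b.1 then true else if eqn k.1 b.1 then k.2 < b.2 else false)
                then argmin ks' i.+1 i k else argmin ks' i.+1 bi b end.
Fixpoint fin (fuel : nat) (T : positive -> option ginfo) (row : seq cell) (id : positive) (v : nat) (f : seq nat)
   : option (positive * positive * pos3 * seq bool * seq nat) :=
  match fuel with 0 => None | fuel'.+1 =>
  let N := [seq isadj (nth Self row x) | x <- f] in
  match T id with None => None | Some r =>
  match glook (gtr r) (rev N) with
  | GK cid => Some (cid, id, gps r, N, v :: f)
  | GA s => fin fuel' T row id v [seq nth 0 f x | x <- s]
  | GI id' ps' N' fi => match T id' with None => None | Some r' =>
      match glook (gtr r') (rev N') with
      | GK cid => Some (cid, id', ps', N', [seq nth 0 (v :: f) x | x <- fi]) | _ => None end end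
  | _ => None end end end.
Fixpoint loc (Ts : seq (trie ginfo)) (m : seq (seq cell)) : option (positive * seq nat) :=
  match Ts with
  | [::] => Some (xH, [::])
  | T :: Ts' => let v := argmin (keysof m) 0 0 (1000, 0) in
    match loc Ts' (delM v m) with None => None | Some (id, f) =>
    match fin 5 (fun i => tget i T) (nth [::] m v) id v (map (bump v) f) with
    | Some (cid, _, _, _, h) => Some (cid, h) | None => None end end end.

Fixpoint cmp1 (N : seq bool) (v : seq nat) : bool := match N, v with
  | b :: N', x :: v' => if b then (if x is _.+2 then false else cmp1 N' v') else cmp1 N' v'
  | _, _ => true end.
Fixpoint cmp2 (N : seq bool) (p v : seq nat) (un : bool) : cmpr := match N, p, v with
  | b :: N', y :: p', x :: v' => if b then
       (if x <= y then cmp2 N' p' v' true else if eqn x y.+1 then cmp2 N' p' v' un else Over)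
       else cmp2 N' p' v' un
  | _, _, _ => if un then Under else Fit end.
Definition cstat N (p : option (seq nat)) v := match p with
  | None => if cmp1 N v then Fit else Over | Some p => cmp2 N p v false end.
Fixpoint altq (ch : seq (seq nat)) : seq bool := match ch with
  | [::] => [::]
  | v :: ch' => match ch' with [::] => map (fun x => x <= 1) v | p :: _ => incs p v (altq ch') end end.
Section Ins.
Variables (k : nat) (N : seq bool).
Section Insf.
Variables (B : Type) (kont : seq nat -> option B).
Fixpoint insf (r : nat) (ch : seq (seq nat)) (p : option (seq nat)) (V : seq (seq nat)) (d : nat) (acc : seq nat) {struct r} : option B :=
  match r with
  | 0 => if eqbs (altq ch) N then kont (rev acc) else None
  | r'.+1 => (fix go (V : seq (seq nat)) (d : nat) {struct V} : option B := match V with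
     | [::] => None
     | v :: V' => match cstat N p v with
        | Over => None | Under => go V' d.+1
        | Fit => match insf r' (v :: ch) (Some v) V 0 (d :: acc) with
                 | Some ds => Some ds | None => go V' d.+1 end end end) V d
  end.
End Insf.
Definition ins1 r ch p V d := insf (fun ds => Some ds) r ch p V d [::].
(* at most q solutions *)
Fixpoint insq (r : nat) (ch : seq (seq nat)) (p : option (seq nat)) (V : seq (seq nat)) (d q : nat) {struct r} : seq (seq nat) * nat :=
  match r with
  | 0 => if eqbs (altq ch) N then ([:: [::]], q.-1) else ([::], q)
  | r'.+1 => (fix go (V : seq (seq nat)) (d q : nat) {struct V} : seq (seq nat) * nat := match q with 0 => ([::], 0) | _ =>
     match V with
     | [::] => ([::], q)
     | v :: V' => match cstat N p v with
        | Over => ([::], q) | Under => go V' d.+1 q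
        | Fit => let '(l1, q1) := insq r' (v :: ch) (Some v) V 0 q in
                 let '(l2, q2) := go V' d.+1 q1 in (map (cons d) l1 ++ l2, q2) end end end) V d q
  end.
End Ins.
Fixpoint insw (w : word) (ds : seq nat) : word := match ds with
  | [::] => map S w | d :: ds' => map S (take d w) ++ 0 :: insw (drop d w) ds' end.
Definition rnd x := (x * 13 + 7) %% 101.
(** A pseudo-random step between words of the same graph: the letter [x] is deleted and reinserted
    in one of at most four ways. *)
Definition mutate k (m : seq (seq cell)) (w : word) x seed : word :=
  let Nx := map isadj (delv x (nth [::] m x)) in
  let w' := [seq (if y < x then y else y.-1) | y <- w & ~~ eqn y x] in
  let V := vecs (map (fun=> 0) Nx) w' in
  let '(l, q) := insq Nx k [::] None (drop (seed %% size w').+1 V) (seed %% size w').+1 4 in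
  let l := match l with [::] => (insq Nx k [::] None (behead V) 1 4).1 | _ => l end in
  match l with [::] => w | _ =>
  [seq match y with 0 => x | y'.+1 => bump x y' end | y <- insw w' (nth [::] l (seed %% size l))] end.

(* covering state: uncovered, certificates, words (reversed), number of words *)
Definition cov : Type := (seq (seq bool) * seq (seq bool * (nat * seq nat)) * seq word * nat)%type.
Definition cover1 k (st : cov) (w : word) : cov := let '(unc, cer, ws, q) := st in
  match unc with [::] => st | M0 :: _ =>
  let V := vecs (map (fun=> 0) M0) w in
  let '(unc', new) := foldr (fun N un => let '(u, nw) := un in
     match ins1 N k [::] None V 0 with Some ds => (u, (N, (q, ds)) :: nw) | None => (N :: u, nw) end)
     ([::], [::]) unc in
  match new with [::] => st | _ => (unc', new ++ cer, w :: ws, q.+1) end end.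
(* a trie of neighbourhoods, to find all those realised by inserting a letter three times *)
Inductive ttr := TT0 | TTL (N : seq bool) | TTB (a b : ttr).
Fixpoint tins (bs : seq bool) (N : seq bool) (t : ttr) : ttr := match bs with
  | [::] => TTL N
  | b :: bs' => let '(x, y) := match t with TTB x y => (x, y) | _ => (TT0, TT0) end in
     if b then TTB x (tins bs' N y) else TTB (tins bs' N x) y end.
Fixpoint tdel (bs : seq bool) (t : ttr) : ttr := match bs, t with
  | b :: bs', TTB x y => let '(x, y) := if b then (x, tdel bs' y) else (tdel bs' x, y) in
     match x, y with TT0, TT0 => TT0 | _, _ => TTB x y end
  | _, _ => TT0 end.
(** State of an old letter after two insertions: counts 0, 1, or counts 1, 2, or alternation already
    lost. *)
Inductive pq := P | Q | Dd.
Fixpoint est (v1 v2 : seq nat) : seq pq := match v1, v2 with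
  | x :: v1', y :: v2' => match x, y with 0, 1 => P | 1, 2 => Q | _, _ => Dd end :: est v1' v2'
  | _, _ => [::] end.
Fixpoint tsub (e : seq pq) (t : ttr) : bool := match t with
  | TT0 => false | TTL _ => true
  | TTB a b => match e with [::] => false | x :: e' => if tsub e' a then true else
     match x with Dd => false | _ => tsub e' b end end end.
Fixpoint twalk (e : seq pq) (v : seq nat) (t : ttr) : option (seq bool) := match t with
  | TT0 => None | TTL N => Some N
  | TTB a b => match e, v with x :: e', y :: v' =>
      if match x with Dd => false | P => match y with 2 => true | _ => false end | Q => match y with 3 => true | _ => false end end
      then twalk e' v' b else twalk e' v' a
    | _, _ => None end end.
Definition bst : Type := (ttr * seq (seq bool * seq nat))%type.
Fixpoint bk e (V : seq (seq nat)) i j k (st : bst) : bst := match V with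
  | [::] => st
  | v :: V' => bk e V' i j k.+1 (match twalk e v st.1 with
       | Some N => (tdel N st.1, (N, [:: i; j; k]) :: st.2) | None => st end) end.
Fixpoint bj v1 (V : seq (seq nat)) i j (st : bst) : bst := match V with
  | [::] => st
  | v :: V' => bj v1 V' i j.+1 (let e := est v1 v in if tsub e st.1 then bk e V i j 0 st else st) end.
Fixpoint bi (V : seq (seq nat)) i (st : bst) : bst := match V with
  | [::] => st
  | v :: V' => bi V' i.+1 (match st.1 with TT0 => st | _ => bj v V i 0 st end) end.
Definition cover3 (st : cov) (w : word) : cov := let '(unc, cer, ws, q) := st in
  match unc with [::] => st | M0 :: _ =>
  let V := vecs (map (fun=> 0) M0) w in
  let t := foldr (fun N t => tins N N t) TT0 unc in
  let '(_, hits) := match w with [::] => bi V 0 (t, [::]) | _ => bi (behead V) 1 (t, [::]) end in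
  match hits with [::] => st | _ =>
    ([seq N <- unc | ~~ has (fun h => eqbs N h.1) hits], map (fun h => (h.1, (q, h.2))) hits ++ cer, w :: ws, q.+1) end end.
Definition coverw k st w := if eqn k 3 then cover3 st w else cover1 k st w.
Fixpoint walk k m (fuel seed x : nat) (w : word) (st : cov) : cov := match fuel with
  | 0 => st
  | f.+1 => match st.1.1.1 with [::] => st | _ =>
      let w' := mutate k m w x seed in
      walk k m f (rnd seed) (if x.+1 < size m then x.+1 else 0) w' (coverw k st w') end end.

(** Vertices with many neighbours already placed come next, so that a search is constrained early;
    the weight 10 exceeds every degree, which only breaks ties. *)
Fixpoint ordb (m : seq (seq cell)) (todo : seq nat) (fuel : nat) (acc : seq nat) : seq nat := match fuel with
  | 0 => acc
  | f.+1 => match todo with [::] => acc | x0 :: _ =>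
    let val x := count (fun y => isadj (nth Self (nth [::] m x) y)) acc * 10 + deg (nth [::] m x) in
    let b := foldl (fun b x => if val b < val x then x else b) x0 todo in
    ordb m [seq x <- todo | ~~ eqn x b] f (b :: acc) end end.
Fixpoint codeof (m : seq (seq cell)) (f : seq nat) : code := match f with
  | [::] => [::] | x :: f' => [seq isadj (nth Self (nth [::] m x) y) | y <- f'] :: codeof m f' end.
Fixpoint dfs k (rows : seq (seq bool)) (w : word) : option word := match rows with
  | [::] => Some w
  | N :: rows' =>
    let ko ds := dfs k rows' (insw w ds) in
    let V := vecs (map (fun=> 0) N) w in
    match w with [::] => insf N ko k [::] None V 0 [::] | _ => insf N ko k [::] None (behead V) 1 [::] end end.

(* The orientations excluded by the refutations are those that are not semi-transitive. *)
Section Ref.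
Variable m : seq (seq cell).
Definition madj i j := isadj (nth Self (nth [::] m i) j).
Definition outs := seq (seq nat).
Definition addarc (o : outs) i j : outs := upd i j o.
Fixpoint dsc (fuel : nat) (o : outs) (todo seen : seq nat) : seq nat := match fuel, todo with
  | f.+1, x :: todo' => if mem_n x seen then dsc f o todo' seen else dsc f o (nth [::] o x ++ todo') (x :: seen)
  | _, _ => seen end.
Definition descs (o : outs) : seq (seq nat) := [seq dsc 60 o [:: v] [::] | v <- iota 0 (size m)].
Fixpoint pathv (fuel : nat) (o : outs) (D : seq (seq nat)) (u v : nat) : seq nat := match fuel with
  | 0 => [:: u] | f.+1 => if eqn u v then [:: u] else
    match find1 (fun w => mem_n v (nth [::] D w)) (nth [::] o u) with
    | Some w => u :: pathv f o D w v | None => [:: u] end end.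
Definition betw (D : seq (seq nat)) u v := [seq x <- nth [::] D u | mem_n v (nth [::] D x)].
Definition badpair (D : seq (seq nat)) (B C : seq nat) (cross : bool) : option (nat * nat) :=
  first (fun x => match find1 (fun z => if eqn x z then false else if madj x z then false else
     if cross then true else mem_n z (nth [::] D x)) C with Some z => Some (x, z) | None => None end) B.
Fixpoint nonadjpair (p : seq nat) (pre : seq nat) : option (seq nat * nat * seq nat * nat * seq nat) := match p with
  | [::] => None
  | x :: p' => match (fix g (q : seq nat) (mid : seq nat) := match q with
       | [::] => None | y :: q' => if madj x y then g q' (y :: mid) else Some (rev mid, y, q') end) p' [::] with
     | Some (q, y, r) => Some (rev pre, x, q, y, r)
     | None => nonadjpair p' (x :: pre) end end.
Definition sht (p : seq nat) : option rtree := match nonadjpair p [::] with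
  | Some (a, x, q, z, r) => Some (Sht (digits_of a) (digit_of x) (digits_of q) (digit_of z) (digits_of r))
  | None => None end.
(** Tests the arc from [i] to [j] before it is added. It may close a cycle, close a path with a
    non-adjacent pair, or complete such a path between the ends of an existing arc. *)
Definition viol (o : outs) (D : seq (seq nat)) i j : option rtree :=
  let pt := pathv 9 o D in
  let Dj := nth [::] D j in
  if mem_n i Dj then Some (Cyc (digits_of (pt j i))) else
  match (if mem_n j (nth [::] D i) then let B := betw D i j in
           match badpair D B B false with Some (x, z) => sht (pt i x ++ behead (pt x z) ++ behead (pt z j)) | None => None end
         else None) with Some r => Some r | None =>
  first (fun s => if mem_n i (nth [::] D s) then
    first (fun y => if mem_n y Dj then
       let B := betw D s i in let C := betw D j y in
       match badpair D B C true with
       | Some (x, z) => sht (pt s x ++ behead (pt x i) ++ pt j z ++ behead (pt z y))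
       | None => match badpair D B B false with
         | Some (x, z) => sht (pt s x ++ behead (pt x z) ++ behead (pt z i) ++ pt j y)
         | None => match badpair D C C false with
           | Some (x, z) => sht (pt s i ++ pt j x ++ behead (pt x z) ++ behead (pt z y))
           | None => None end end end
       else None) (nth [::] o s)
    else None) (iota 0 (size m)) end.
(** An edge with an orientation refuted at once is forced into the other; otherwise the search
    branches on an edge whose ends carry the most arcs. *)
Fixpoint dpll (fuel : nat) (o ino : outs) (un : seq (nat * nat)) : option rtree := match fuel with
  | 0 => None
  | f.+1 => match un with [::] => None | e0 :: _ =>
    let D := descs o in
    let forced := first (fun e => let '(i, j) := e in
       match viol o D i j, viol o D j i with
       | None, None => None | a, b => Some (e, a, b) end) un in
    let rem e := [seq x <- un | ~~ (if eqn x.1 e.1 then eqn x.2 e.2 else false)] in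
    match forced with
    | Some (e, a, b) => let '(i, j) := e in
      match a, b with
      | Some r, Some r' => Some (Br (digit_of i) (digit_of j) r r')
      | Some r, None => match dpll f (addarc o j i) (addarc ino i j) (rem e) with
                 | Some t => Some (Br (digit_of i) (digit_of j) r t) | None => None end
      | None, Some r => match dpll f (addarc o i j) (addarc ino j i) (rem e) with
                 | Some t => Some (Br (digit_of i) (digit_of j) t r) | None => None end
      | None, None => None end
    | None =>
       let val e := let '(i, j) := e in
         size (nth [::] o i) + size (nth [::] ino i) + size (nth [::] o j) + size (nth [::] ino j) in
       let e0 := (foldl (fun b e => let v := val e in if b.2 < v then (e, v) else b) (e0, val e0) un).1 in
       let '(i, j) := e0 in
       match dpll f (addarc o i j) (addarc ino j i) (rem e0) with None => None | Some t1 =>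
       match dpll f (addarc o j i) (addarc ino i j) (rem e0) with None => None | Some t2 =>
         Some (Br (digit_of i) (digit_of j) t1 t2) end end
    end end end.
Definition refute : option rtree :=
  let n := size m in
  let s := n.-1 in
  let es := flatten [seq [seq (i, j) | j <- iota 0 i & madj i j] | i <- rev (iota 0 s)] in
  let o := [seq [seq j <- iota 0 n | if eqn i s then madj i j else false] | i <- iota 0 n] in
  let ino := [seq (if madj s i then [:: s] else [::]) | i <- iota 0 n] in
  dpll 40 o ino es.
End Ref.

Record gst := Gst {
  tab : trie ginfo; etab : trie (option emb * option emb);
  nid : positive; npos : pos3; kids : seq pend;
  obw : seq (code * rtree); nbw : pos3;
  obc : seq code; nbc : pos3;
  ob3 : seq code; nb3 : pos3;
  recs : seq hrec }.
(* obstruction indices reuse the three-digit counter as (0, b, c) *)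
Definition ix (p : pos3) : nat * nat := let '(a, b, c) := p in (b, c).

Fixpoint lookN A (N : seq bool) (s : seq (seq bool * A)) : option A := match s with
  | [::] => None | (x, y) :: s' => if eqbs N x then Some y else lookN N s' end.
Fixpoint peqb (p q : positive) := match p, q with
  | xH, xH => true | xO p, xO q => peqb p q | xI p, xI q => peqb p q | _, _ => false end.

Inductive btrie := BL (o : option (positive * seq nat)) | BB (a b : btrie).
Fixpoint blook (t : btrie) (bs : seq bool) : option (positive * seq nat) := match t with
  | BL o => o | BB a b => match bs with b0 :: bs' => blook (if b0 then b else a) bs' | [::] => None end end.
Fixpoint bbuild (Ts : seq (trie ginfo)) (m : seq (seq cell)) (k : nat) (N : seq bool) : btrie := match k with
  | 0 => BL (loc Ts (ext_mat (map cell_of N) m))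
  | k'.+1 => BB (bbuild Ts m k' (false :: N)) (bbuild Ts m k' (true :: N)) end.
Definition buildLT Ts (prev : seq pend) : trie btrie :=
  foldl (fun t pd => let m := mat (pcode pd) in tset (pid pd) (bbuild Ts m (size m) [::]) t) TE prev.
Definition hloc (Ts : seq (trie ginfo)) (m : seq (seq cell)) : seq (option (positive * seq nat)) :=
  [seq match loc (behead Ts) (delM u m) with Some (id, f) => Some (id, map (bump u) f) | None => None end | u <- iota 0 (size m)].

Section Proc.
Variable LT : trie btrie.
(** Deleting an old vertex [u0] from the extension gives an extension of [H] without [u0], and the
    extensions of its representative are tabulated in [LT]. *)
Definition locG (hl : seq (option (positive * seq nat))) (N : seq bool) (u0 : nat) : option (positive * seq nat) :=
  match nth None hl u0 with None => None | Some (id, g) =>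
  match tget id LT with None => None | Some t =>
  match blook t (rev [seq nth false N x | x <- g]) with None => None | Some (id', h) =>
    Some (id', [seq match p with 0 => 0 | p'.+1 => (nth 0 g p').+1 end | p <- h]) end end end.

Variables (Ts : seq (trie ginfo)) (n : nat) .

(** Duplicates are sought only among the vertices that tie with the new one: deleting such a vertex
    shows another way in which the same graph arises. *)
Definition phase1 hl (st : gst) (pd : pend) :=
  let H := pcode pd in let m := mat H in
  let degs := map deg m in let sums := map (fun r => sumr r degs) m in
  let T0 := en m degs sums (rev degs) [::] [::] 0 0 in
  let us := unk T0 [::] [::] in
  let gs := [seq (g, invp m g) | g <- sgs m (zip degs sums)] in
  foldl (fun s N => let '(T, kept, id, ps) := s in
    match glook T (rev N) with
    | GU =>
      let orb := match gs with [::] => [::] | _ => bfsN 300 gs [:: (N, iota 0 n)] [:: (N, iota 0 n)] end in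
      let T1 := foldl (fun T e => if eqbs e.1 N then T else gupd T (rev e.1) (GA e.2)) T orb in
      let tget' i := if peqb i (pid pd) then Some (Ginfo (pps pd) T1) else tget i (tab st) in
      let mg := ext_mat (map cell_of N) m in
      let dup := first (fun u0 => let u := u0.+1 in
         match locG hl N u0 with None => None | Some (id', f) =>
         fin 5 tget' (nth [::] mg u) id' u f end) (ties m degs sums N) in
      match dup with
      | Some (_, id', ps', N', h) => (gupd T1 (rev N) (GI id' ps' N' h), kept, id, ps)
      | None => (gupd T1 (rev N) (GK id), (N, id, ps) :: kept, Pos.succ id, nextpos ps)
      end
    | _ => s end) (T0, [::], nid st, npos st) us.

(** A known obstruction in a vertex-deleted subgraph is reused, which keeps the list of obstructions
    short. *)
Definition efind (st : gst) hl (N : seq bool) (nw : bool) : option emb :=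
  first (fun u => match locG hl N u with None => None | Some (id', h) =>
    match tget id' (etab st) with None => None | Some (a, b) =>
    match (if nw then a else b) with None => None | Some (ab, f) =>
      Some (ab, [seq nth 0 h x | x <- f]) end end end) (iota 0 n).

Definition word_restrict (w : word) : word := [seq x.-1 | x <- w & ~~ eqn x 0].
Definition dfsG k (mg : seq (seq cell)) : option word :=
  let o := ordb mg (iota 0 n.+1) n.+1 [::] in
  match dfs k (rev (codeof mg o)) [::] with
  | Some w => Some [seq nth 0 o x | x <- w] | None => None end.
Definition embc (c : option (nat * nat * seq nat)) : ncert := match c with
  | None => Inh | Some (a, b, f) => Emb (digit_of a) (digit_of b) (digits_of f) end.
Definition shift (e : option emb) : option emb := match e with
  | Some (ab, f) => Some (ab, map S f) | None => None end.
Definition emb3 (e : option emb) : ocert := match e with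
  | Some (a, b, f) => OEmb (digit_of a) (digit_of b) (digits_of f) | None => NoC end.

(* neighbourhood, status, embedded obstructions, 2-word and 3-word *)
Definition entry : Type := (seq bool * (stat * option emb * option emb * word * word))%type.
Definition up3 (w : word) : word := rev (undup (rev w)) ++ w.

(** Cheap methods precede expensive ones: inherited obstructions and inserted letters, then mutated
    words and refutations, and exhaustive search only for what remains. *)
Definition classify hl (st : gst) (pd : pend) (Ns : seq (seq bool)) : seq entry * seq word * seq word * gst :=
  let H := pcode pd in let m := mat H in
  match pnw pd with
  | Some _ => ([seq (N, (SN Inh, shift (pnw pd), shift (pnc pd), [::], [::])) | N <- Ns], [::], [::], st)
  | None =>
    let hfull := all (all id) H in
        let isf N := if hfull then all id N else false in
    let es0 := [seq (N, (S1, None, None, iota 0 n.+1 ++ iota 0 n.+1, iota 0 n.+1 ++ iota 0 n.+1 ++ iota 0 n.+1)) | N <- Ns & isf N] in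
    let Ns := [seq N <- Ns | ~~ isf N] in
    let ex k fuel seed (ws : seq word) st := match ws with [::] => st | w :: _ =>
       let st := foldl (coverw k) st ws in match H with _ :: _ :: _ => walk k m fuel seed 0 w st | _ => st end end in
    let '(nonc, c2, w2, st1) :=
      match pnc pd with
      | Some e => ([seq (N, None) | N <- Ns], [::], [::], st)
      | None =>
        let found := [seq (N, efind st hl N false) | N <- Ns] in
        let f1 := [seq x <- found | if x.2 is Some _ then true else false] in
        let r1 := [seq x.1 | x <- found & if x.2 is Some _ then false else true] in
        let cv := ex 2 15 5 (pp2 pd) (r1, [::], [::], 0) in
        let '(unc, cer, ws, q) := cv in
        let '(cv, f2, st') := foldl (fun s N => let '(cv, f2, st) := s in
            let '(unc, cer, ws, q) := cv in
            if has (eqbs N) unc then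
            let mg := ext_mat (map cell_of N) m in
            match dfsG 2 mg with
            | Some w => (cover1 2 cv (word_restrict w), f2, st)
            | None => let o := ordb mg (iota 0 n.+1) n.+1 [::] in
               (([seq M <- unc | ~~ eqbs M N], cer, ws, q), (N, Some (ix (nbc st), o)) :: f2,
                Gst (tab st) (etab st) (nid st) (npos st) (kids st) (obw st) (nbw st)
                  (codeof mg o :: obc st) (nextpos (nbc st)) (ob3 st) (nb3 st) (recs st))
            end else s) (cv, [::], st) unc in
        let '(_, cer, ws, q) := cv in
        (f1 ++ f2, cer, rev ws, st')
      end in
    let es2 := [seq (let w := insw (nth [::] w2 x.2.1) x.2.2 in
       (x.1, (S2 (digit_of x.2.1) (digit_of (nth 0 x.2.2 0)) (digit_of (nth 0 x.2.2 1)), None, None, w, up3 w))) | x <- c2] in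
    let ncof N := match lookN N nonc with Some (Some e) => Some e | _ => None end in
    let ncc N := if pnc pd is Some _ then shift (pnc pd) else ncof N in
    let Ns3 := [seq x.1 | x <- nonc] in
    let found := [seq (N, efind st1 hl N true) | N <- Ns3] in
    let f1 := [seq x <- found | if x.2 is Some _ then true else false] in
    let r1 := [seq x.1 | x <- found & if x.2 is Some _ then false else true] in
    let '(unc, cer, ws, q) := ex 3 20 5 (pp3 pd) (r1, [::], [::], 0) in
    let '(r2, f2, st1) := foldl (fun s N => let '(r2, f2, st) := s in
        let mg := ext_mat (map cell_of N) m in
        let o := ordb mg (iota 0 n.+1) n.+1 [::] in
        match refute (mat (codeof mg o)) with
        | Some t => (r2, (N, Some (ix (nbw st), o)) :: f2,
             Gst (tab st) (etab st) (nid st) (npos st) (kids st) ((codeof mg o, t) :: obw st) (nextpos (nbw st))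
                  (obc st) (nbc st) (ob3 st) (nb3 st) (recs st))
        | None => (N :: r2, f2, st) end) ([::], [::], st1) unc in
    let cv := ex 3 400 11 (pp3 pd) (r2, cer, ws, q) in
    let '(cv, s4, st2) := foldl (fun s N => let '(cv, s4, st) := s in
        let '(unc, cer, ws, q) := cv in
        if has (eqbs N) unc then
        let mg := ext_mat (map cell_of N) m in
        match dfsG 3 mg with
        | Some w => (cover3 cv (word_restrict w), s4, st)
        | None =>
             let o := ordb mg (iota 0 n.+1) n.+1 [::] in
             let '(b, c) := ix (nb3 st) in
             let o4 := ordb mg (iota 1 n) n [:: 0] in
             let w := match dfs 4 (rev (codeof mg o4)) [::] with Some w => [seq nth 0 o4 x | x <- w] | None => [::] end in
             (([seq M <- unc | ~~ eqbs M N], cer, ws, q), (N, (S4 (digit_of b) (digit_of c) (digits_of o) (digits_of w), None, None, [::], [::])) :: s4,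
               Gst (tab st) (etab st) (nid st) (npos st) (kids st) (obw st) (nbw st)
                  (obc st) (nbc st) (codeof mg o :: ob3 st) (nextpos (nb3 st)) (recs st))
          end else s) (cv, [::], st1) cv.1.1.1 in
    let '(_, c3, ws, q) := cv in
    let es3 := [seq (x.1, (S3 (embc (ncof x.1)) (digit_of x.2.1) (digit_of (nth 0 x.2.2 0)) (digit_of (nth 0 x.2.2 1)) (digit_of (nth 0 x.2.2 2)), None, ncc x.1, [::], insw (nth [::] (rev ws) x.2.1) x.2.2)) | x <- c3] in
    let esN := [seq (x.1, (SN (embc x.2), x.2, ncc x.1, [::], [::])) | x <- f1 ++ f2] in
    (es0 ++ es2 ++ es3 ++ esN ++ s4, w2, rev ws, st2)
  end.

Fixpoint chunk A (fuel k : nat) (s : seq A) : seq (seq A) := match fuel with 0 => [::] | f.+1 =>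
  match s with [::] => [::] | _ => take k s :: chunk f k (drop k s) end end.

Fixpoint enc0 (fuel : nat) (s : seq bool) : digits := match fuel with 0 => DN | f.+1 => match s with [::] => DN | _ =>
  DC (digit_of (foldr (fun (b : bool) a => b + (a + a)) 0 (take 5 s))) (enc0 f (drop 5 s)) end end.
Definition enc := enc0 20.
Definition d3 (p : pos3) := let '(a, b, c) := p in (digit_of a, digit_of b, digit_of c).
Fixpoint build (t T : gtree) (N : seq bool) (es : seq entry) (auts : seq (seq nat)) : tree * seq (seq nat) := match t with
  | GB a b => let '(a', auts) := build a T (false :: N) es auts in
              let '(b', auts) := build b T (true :: N) es auts in (Node a' b', auts)
  | GL l => match l with
    | GU => (Prune D31, auts)
    | GP j => (Prune (digit_of j), auts)
    | GW u => (Wit (digit_of u), auts)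
    | GI _ ps N' f => let '(a, b, c) := d3 ps in (Iso a b c (enc N') (digits_of f), auts)
    | GK _ => match lookN N es with Some (s, _, _, _, _) => (Kept s, auts) | None => (Prune D31, auts) end
    | GA s =>
      let ok s := match glook T (rev [seq nth false N x | x <- s]) with GA _ => false | _ => true end in
      let i := find ok auts in
      let auts := if i < size auts then auts else rcons auts s in
      (Aut (digit_of (i %/ 32)) (digit_of (i %% 32)), auts)
    end end.

Definition process (st : gst) (pd : pend) : gst :=
  let hl := hloc Ts (mat (pcode pd)) in
  let '(T, keptr, id', ps') := phase1 hl st pd in
  let kept := rev keptr in
  let '(es, w2, w3, st) := classify hl st pd [seq x.1.1 | x <- kept] in
  let H := pcode pd in
  let newkids := [seq let '(N, i, ps) := x in
     match lookN N es with
       | Some (_, nw, nc, a, b) => Pend (N :: H) i ps nw nc (if a is [::] then [::] else [:: a]) (if b is [::] then [::] else [:: b])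
       | None => Pend (N :: H) i ps None None [::] [::] end | x <- kept] in
  let '(t, auts) := build T T [::] es [::] in
  let r := HRec (enc (flatten H)) (chunk 32 32 (map digits_of auts)) (emb3 (pnw pd)) (emb3 (pnc pd)) (map digits_of w2) (map digits_of w3) t in
  Gst (tset (pid pd) (Ginfo (pps pd) T) (tab st)) (etab st) id' ps' (catrev newkids (kids st))
      (obw st) (nbw st) (obc st) (nbc st) (ob3 st) (nb3 st) (r :: recs st).
End Proc.

Definition level_start (st : gst) (ks : seq pend) : gst :=
  Gst TE (foldl (fun t k => tset (pid k) (pnw k, pnc k) t) TE ks) xH (0, 0, 0) [::]
    (obw st) (nbw st) (obc st) (nbc st) (ob3 st) (nb3 st) [::].
Definition st0 := Gst TE TE xH (0,0,0) [::] [::] (0,0,0) [::] (0,0,0) [::] (0,0,0) [::].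
Definition root := [:: Pend [::] xH (0,0,0) None None [:: [::]] [:: [::]]].

Fixpoint levels  (L n : nat) (Ts : seq (trie ginfo)) (st : gst) (prev ks : seq pend) (out : seq (seq hrec)) :=
  match L with
  | 0 => (out, Ts, st, prev, ks)
  | L'.+1 =>
    let st := foldl (process (buildLT Ts prev) Ts n) (level_start st ks) ks in
    levels L' n.+1 (tab st :: Ts) st ks (rev (kids st)) (rev (recs st) :: out)
  end.
Definition nest A (s : seq A) := chunk 100 32 (chunk 1000 32 s).
Definition gen :=
  let '(out, Ts, st, pv, ks) := levels 8 0 [::] st0 [::] root [::] in
  let st := foldl (process (buildLT Ts pv) Ts 8) (level_start st ks) ks in
  (rev (map (@nest _) out), nest (rev (recs st)), chunk 100 32 (rev (obw st)), chunk 100 32 (rev (obc st)), chunk 100 32 (rev (ob3 st))).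
End Generator.

(** * The computation *)

(* The records of level 8 are split: evaluating them as one term takes superlinear time. *)
Definition lows := Eval vm_compute in Generator.gen.1.1.1.1.
Definition obwt := Eval vm_compute in Generator.gen.1.1.2.
Definition obc_ := Eval vm_compute in Generator.gen.1.2.
Definition ob3_ := Eval vm_compute in Generator.gen.2.
(** A block holds 32 times 32 records, so the 12346 graphs on 8 vertices fill 13 blocks. *)
Definition g8 i := nth [::] Generator.gen.1.1.1.2 i.
Definition r0 := Eval vm_compute in g8 0.
Definition r1 := Eval vm_compute in g8 1.
Definition r2 := Eval vm_compute in g8 2.
Definition r3 := Eval vm_compute in g8 3.
Definition r4 := Eval vm_compute in g8 4.
Definition r5 := Eval vm_compute in g8 5.
Definition r6 := Eval vm_compute in g8 6.
Definition r7 := Eval vm_compute in g8 7.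
Definition r8 := Eval vm_compute in g8 8.
Definition r9 := Eval vm_compute in g8 9.
Definition r10 := Eval vm_compute in g8 10.
Definition r11 := Eval vm_compute in g8 11.
Definition r12 := Eval vm_compute in g8 12.
Definition top := [:: r0; r1; r2; r3; r4; r5; r6; r7; r8; r9; r10; r11; r12].

Definition level (n : nat) : seq (seq (seq hrec)) := if n is 8 then top else nth [::] lows n.

(** The evaluation is left to the kernel's check of the cast, so that it is carried out only
    once. *)
Lemma obwt_ok : all (all (fun x => [&& wf x.1, 0 < size x.1 & refutes x.1 x.2])) obwt.
Proof. vm_cast_no_check (erefl true). Qed.
Lemma obc_ok : all (all (fun g => wf g && norep 2 g)) obc_.
Proof. vm_cast_no_check (erefl true). Qed.
Lemma ob3_ok : all (all (fun g => wf g && norep 3 g)) ob3_.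
Proof. vm_cast_no_check (erefl true). Qed.
Definition level_ok (n : nat) : bool := all (all (all (chkrec (obs_of obwt) obc_ ob3_ n (recs_at (level n))))) (level n).
Lemma lows_ok : all level_ok (iota 0 8).
Proof. vm_cast_no_check (erefl true). Qed.
Lemma top_ok : level_ok 8.
Proof. vm_cast_no_check (erefl true). Qed.
Definition kcodes (n : nat) : seq code := if n is n'.+1 then map fst (kept n' (level n')) else [:: [::]].
(** Every level stores the codes of its parents; these must be the graphs kept at the level before,
    in the same order, for the induction to connect. *)
Lemma codes_ok : all (fun n => kcodes n == map (getcode n) (flatten (flatten (level n)))) (iota 0 9).
Proof. vm_cast_no_check (erefl true). Qed.
Definition level_tally (n : nat) : tally := tally_recs n (flatten (flatten (level n))).
(** Level [n] holds parents on [n] vertices, so its tally concerns graphs on [n.+1] vertices. The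
    scope [AC] supplies the numerals of type [positive]. *)
Lemma tal3 : level_tally 2 = (Tal (Npos 2) (Npos 1) (Npos 1) N0 N0 N0)%AC.
Proof. by vm_compute. Qed.
Lemma tal4 : level_tally 3 = (Tal (Npos 5) (Npos 1) (Npos 5) N0 N0 N0)%AC.
Proof. by vm_compute. Qed.
Lemma tal5 : level_tally 4 = (Tal (Npos 13) (Npos 1) (Npos 20) N0 N0 N0)%AC.
Proof. by vm_compute. Qed.
Lemma tal6 : level_tally 5 = (Tal (Npos 44) (Npos 1) (Npos 109) (Npos 1) N0 (Npos 1))%AC.
Proof. by vm_compute. Qed.
Lemma tal7 : level_tally 6 = (Tal (Npos 191) (Npos 1) (Npos 788) (Npos 39) N0 (Npos 25))%AC.
Proof. by vm_compute. Qed.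
Lemma tal8 : level_tally 7 = (Tal (Npos 1229) (Npos 1) (Npos 8335) (Npos 1852) N0 (Npos 929))%AC.
Proof. by vm_compute. Qed.
Lemma tal9 : level_tally 8 = (Tal (Npos 13588) (Npos 1) (Npos 117282) (Npos 88838) (Npos 2) (Npos 54957))%AC.
Proof. vm_cast_no_check (erefl ((Tal (Npos 13588) (Npos 1) (Npos 117282) (Npos 88838) (Npos 2) (Npos 54957))%AC)). Qed.

Lemma classified_lev n K : n < 9 -> classified n K -> map fst K = kcodes n -> classified n.+1 (kept n (level n)).
Proof.
move=> n9 cK eK.
apply: (classified_step (obs_ok_wrep obwt_ok) (obs_ok_krep (isT : 0 < 2) obc_ok) (obs_ok_krep (isT : 0 < 3) ob3_ok) cK).
  by rewrite eK; apply/eqP; apply: (allP codes_ok); rewrite mem_iota.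
move: n9; rewrite ltnS leq_eqVlt => /predU1P[->|n8]; first exact: top_ok.
by apply: (allP lows_ok); rewrite mem_iota.
Qed.
Lemma classified_kept n : n < 9 -> classified n.+1 (kept n (level n)).
Proof.
elim: n => [|n IH] n9; first exact: classified_lev classified0 _.
by apply: (classified_lev n9 (IH _)) => //; apply: ltnW.
Qed.

Definition burnside_eq n t := Nmul (tally_total t) (Npos (pos_fact n)) = Npos (fixsum n n 0 [::]).
Lemma repr_counts_lev n t : n < 9 -> level_tally n = t ->
  burnside_eq n.+1 t ->
  repr_counts n.+1 = let: Tal _ c1 c2 c3 c4 c5 := t in map nat_of_bin [:: c1; c2; c3; c4; c5].
Proof. by move=> n9 tn b; apply: (repr_countsE (classified_kept n9) tn b). Qed.

Theorem mainTheorem3 :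
  (repr_counts 3 = [:: 1; 1; 0; 0; 0] /\
   repr_counts 4 = [:: 1; 5; 0; 0; 0] /\
   repr_counts 5 = [:: 1; 20; 0; 0; 0] /\
   repr_counts 6 = [:: 1; 109; 1; 0; 1] /\
   repr_counts 7 = [:: 1; 788; 39; 0; 25] /\
   repr_counts 8 = [:: 1; 8335; 1852; 0; 929] /\
   repr_counts 9 = [:: 1; 117282; 88838; 2; 54957]) /\
  (forall (T : finType) (G : sgraph T),
     #|T| <= 9 -> connected G -> repr_number_gt 4 G -> ~ word_representable G).
Proof.
split; last first.
  move=> T G + _; case cT: #|T| => [|n] n9.
    exact: (repr_number_gt4_not_wr classified0 cT).
  exact: (repr_number_gt4_not_wr (classified_kept n9) cT).
have b3 : burnside_eq 3 (Tal (Npos 2) (Npos 1) (Npos 1) N0 N0 N0)%AC by vm_compute.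
have b4 : burnside_eq 4 (Tal (Npos 5) (Npos 1) (Npos 5) N0 N0 N0)%AC by vm_compute.
have b5 : burnside_eq 5 (Tal (Npos 13) (Npos 1) (Npos 20) N0 N0 N0)%AC by vm_compute.
have b6 : burnside_eq 6 (Tal (Npos 44) (Npos 1) (Npos 109) (Npos 1) N0 (Npos 1))%AC by vm_compute.
have b7 : burnside_eq 7 (Tal (Npos 191) (Npos 1) (Npos 788) (Npos 39) N0 (Npos 25))%AC by vm_compute.
have b8 : burnside_eq 8 (Tal (Npos 1229) (Npos 1) (Npos 8335) (Npos 1852) N0 (Npos 929))%AC by vm_compute.
have b9 : burnside_eq 9 (Tal (Npos 13588) (Npos 1) (Npos 117282) (Npos 88838) (Npos 2) (Npos 54957))%AC by vm_compute.
rewrite (repr_counts_lev (n := 2) isT tal3 b3) (repr_counts_lev (n := 3) isT tal4 b4) (repr_counts_lev (n := 4) isT tal5 b5) (repr_counts_lev (n := 5) isT tal6 b6) (repr_counts_lev (n := 6) isT tal7 b7) (repr_counts_lev (n := 7) isT tal8 b8) (repr_counts_lev (n := 8) isT tal9 b9) !of_num_uintE.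
(* The large numerals have been rewritten to values of [nat_of_bin], so the large counts are
   compared in binary. *)
by do !split; congr [:: _; _; _; _; _].
Qed.
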